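(* Let $m$ be a positive measurable function on $\mathbb R$ such that $$\int_{\mathbb R}\frac{m(u)\,du}{u^2+1}<\infty$$ and $$m(u)\le\begin{cases}K|u|^{-b}, & |u|\le 1,\\ K|u|^{2N}, & |u|>1,\end{cases}$$ where $b<2$, $N\in\mathbb N_0$ and $K>0$. Then for every $g\in\mathfrak S_1$ the function $t\mapsto X_m(t)g$ is strongly continuous in $\mathfrak S_{-1}$, and there exists a continuous operator $W_m(t)$ from $\mathfrak S_1$ into $\mathfrak S_{-1}$ such that $$\frac{d}{dt}X_m(t)g=W_m(t)g .$$ Moreover, the function $t\mapsto W_m(t)g$ is continuous from $[a,b]$ into $\mathfrak S_{-1}$, for any compact real interval $[a,b]$.
   Context: Let $i_1,i_2,\dots$ be Grassmann generators: $i_ni_m+i_mi_n=0$ for all $n,m$. Let $\mathfrak I$ be the set of finite tuples $\alpha=(a_1,\dots,a_t)$, $t\ge1$, of positive integers with $a_1<\cdots<a_t$; $i_\alpha=i_{a_1}\cdots i_{a_t}$; $\mathfrak I_0=\mathfrak I\cup\{0\}$ with $i_0=1$. For $\alpha,\beta\in\mathfrak I_0$ having no common entry, $\alpha\vee\beta=\gamma\in\mathfrak I_0$ is the increasing tuple formed by the entries of $\alpha$ and $\beta$ (with $0\vee\alpha=\alpha\vee0=\alpha$), and $i_\alpha i_\beta=(-1)^{\sigma(\alpha,\beta)}i_\gamma$, where $\sigma(\alpha,\beta)$ is the number of transpositions needed to reorder; if $\alpha,\beta$ have a common entry, $i_\alpha i_\beta=0$ and no $\gamma$ satisfies $\alpha\vee\beta=\gamma$.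 Weights: $c_0=1$ and $c_\alpha=e^{\sum_{k=1}^n\varphi(a_k)}$ for $\alpha=(a_1,\dots,a_n)\in\mathfrak I$, where $\varphi(0)=0$, $\varphi(n)$ is increasing in $n\in\mathbb N_0$, and there is $\xi>\tfrac12\ln 2$ with $\varphi(n)\ge\xi n$ for all $n\ge1$. (Then $c_\alpha c_\beta=c_\gamma$ if $\alpha\vee\beta=\gamma$, and $\sum_\alpha c_\alpha^{-2d}<\infty$ for every integer $d\ge1$.) For $p\in\mathbb Z$, $\mathcal H_{p}$ is the Hilbert space of formal series $f=\sum_{\alpha\in\mathfrak I_0}f_\alpha i_\alpha$ ($f_\alpha\in\mathbb C$) with $\Vert f\Vert_{\mathcal H_{p}}=\left(\sum_{\alpha}|f_\alpha|^2c_\alpha^{2p}\right)^{1/2}<\infty$. $\mathfrak S_1=\bigcap_{p\in\mathbb Z}\mathcal H_p$ (Fréchet topology given by these norms) and $\mathfrak S_{-1}=\bigcup_{p\in\mathbb Z}\mathcal H_{-p}$ is its topological dual, with the strong topology, which coincides with the inductive limit topology. Operators: for $f\in\mathfrak S_{-1}$ and $g\in\mathfrak S_1$, $M_fg=fg=\sum_\gamma\Big(\sum_{\alpha\vee\beta=\gamma}(-1)^{\sigma(\alpha,\beta)}f_\alpha g_\beta\Big)i_\gamma$, and $M_f^*$ is the formal adjoint for the inner product $\langle z,w\rangle=\sum_\alpha z_\alpha\overline{w_\alpha}$, i.e. $M_f^*g=\sum_\gamma\Big(\sum_{\alpha,\beta:\ \alpha\vee\gamma=\beta}(-1)^{\sigma(\alpha,\gamma)}\overline{f_\alpha}g_\beta\Big)i_\gamma$.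 Put $T_f=M_f+M_f^*$. Process: $\widehat f$ is the Fourier transform; $S_m$ is the operator in $\mathbf L_2(\mathbb R)$ with $\widehat{S_mf}(u)=\sqrt{m(u)}\,\widehat f(u)$ and domain $\{f\in \mathbf L_2(\mathbb R):\int m|\widehat f|^2du<\infty\}$; $(\xi_n)_{n\ge1}$ are the (normalized) Hermite functions, an orthonormal basis of $\mathbf L_2(\mathbb R)$. Define $f_m(t)=\sum_{n\ge1}\left(\int_0^t(S_m\xi_n)(u)\,du\right)i_n$ and $X_m(t)=T_{f_m(t)}$, $t\in\mathbb R$. *)

(* Defs.v *)
From HB Require Import structures.
From mathcomp Require Import all_boot all_order all_algebra finmap.
From mathcomp Require Import complex ring lra.
From mathcomp Require Import all_classical all_reals all_analysis.

Set Implicit Arguments.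
Unset Strict Implicit.
Unset Printing Implicit Defensive.

Import Order.TTheory GRing.Theory Num.Theory.
Import numFieldNormedType.Exports.
Import ComplexField.Normc.

Local Open Scope complex_scope.
Local Open Scope classical_set_scope.
Local Open Scope ring_scope.

Record weight (R : realType) := Weight {
  wfun :> nat -> R ;
  weight0 : wfun 0%N = 0 ;
  weight_homo : {homo wfun : n p / (n <= p)%N >-> n <= p} ;
  weight_ge : exists2 xi : R, ln 2 / 2 < xi &
        forall n : nat, (1 <= n)%N -> xi * n%:R <= wfun n }.

(* The index [{a_1 < ... < a_t}] is the finite set of the [a_k - 1]: the natural
   number [a] stands for the generator [i_(a+1)], and [fset0] for the index 0. *)
Notation gindex := {fset nat}.

Notation gseries R := (gindex -> (R[i])^o).

Definition cw (R : realType) (phi : weight R) (al : gindex) : R :=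
  expR (\sum_(a <- al) phi a.+1).

Definition Hnorm2 (R : realType) (phi : weight R) (p : int) (f : gseries R)
    : \bar R :=
  (\esum_(al in [set: gindex]) (normc (f al) ^+ 2 * cw phi al ^ (2 * p))%:E)%E.

Definition Hsp (R : realType) (phi : weight R) (p : int) : set (gseries R) :=
  [set f | (Hnorm2 phi p f < +oo)%E].

Definition Hnorm (R : realType) (phi : weight R) (p : int) (f : gseries R) : R :=
  Num.sqrt (fine (Hnorm2 phi p f)).

Definition test_set (R : realType) (phi : weight R) : {pred gseries R} :=
  mem [set f | forall p : int, Hsp phi p f].

Definition dist_set (R : realType) (phi : weight R) : {pred gseries R} :=
  mem [set f | exists p : int, Hsp phi (- p) f].

Section closedness.
Variables (R : realType) (phi : weight R).

Lemma cw_ge1 al : 1 <= cw phi al.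
Proof.
case: phi => w w0 wi wl; rewrite /cw /= -expR0 ler_expR.
by apply: sumr_ge0 => a _; rewrite -w0; apply: wi.
Qed.

Lemma Hterm_ge0 p (f : gseries R) al : 0 <= normc (f al) ^+ 2 * cw phi al ^ (2 * p).
Proof.
by rewrite mulr_ge0 ?sqr_ge0 ?exprz_ge0// (le_trans ler01)// cw_ge1.
Qed.

Lemma normc_le2 (a x y : R[i]) :
  normc (a * x + y) ^+ 2 <= 2 * normc a ^+ 2 * normc x ^+ 2 + 2 * normc y ^+ 2.
Proof.
have h0 (z : R[i]) : 0 <= normc z by case: z => u v; rewrite sqrtr_ge0.
apply: (@le_trans _ _ ((normc (a * x) + normc y) ^+ 2)).
  by rewrite ler_pXn2r ?nnegrE ?h0 ?addr_ge0// le_normcD.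
rewrite normcM -mulrA -exprMn -mulrDr.
set u := _ * _; set v := normc y.
have : 0 <= (u - v) ^+ 2 by exact: sqr_ge0.
by lra.
Qed.

Lemma esumZ_lty (F : gindex -> R) (k : R) : 0 <= k -> (forall al, 0 <= F al) ->
  (\esum_(al in [set: gindex]) (F al)%:E < +oo)%E ->
  (\esum_(al in [set: gindex]) (k * F al)%:E < +oo)%E.
Proof.
move=> k0 F0 Foo; have [n kn] : exists n : nat, k <= n%:R.
  exists (Num.truncn k).+1; apply: ltW; exact: truncnS_gt.
apply: (@le_lt_trans _ _ (\esum_(al in [set: gindex]) (n%:R * F al)%:E)%E).
  apply: le_esum => al _; rewrite lee_fin; exact: ler_wpM2r.
elim: n {kn} => [|n IH].
  rewrite esum1 ?ltry// => al _; by rewrite mul0r.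
under eq_esum do rewrite -natr1 mulrDl mul1r EFinD.
rewrite esumD ?lte_add_pinfty// => al _; rewrite lee_fin ?mulr_ge0 ?ler0n//.
Qed.

Lemma Hsp_lin p (a : R[i]) (f g : gseries R) :
  Hsp phi p f -> Hsp phi p g -> Hsp phi p (a *: f + g).
Proof.
rewrite /Hsp /= /Hnorm2 => Hf Hg.
pose F (h : gseries R) al := normc (h al) ^+ 2 * cw phi al ^ (2 * p).
have F0 h al : 0 <= F h al by exact: Hterm_ge0.
apply: (@le_lt_trans _ _ (\esum_(al in [set: gindex])
   ((2 * normc a ^+ 2 * F f al)%:E + (2 * F g al)%:E))%E).
  apply: le_esum => al _; rewrite -EFinD lee_fin /F (mulrA (2 * _)) (mulrA 2 (normc (g al) ^+ 2)) -mulrDl.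
  apply: ler_wpM2r; last exact: (normc_le2 a (f al) (g al)).
  by rewrite exprz_ge0// (le_trans ler01)// cw_ge1.
rewrite esumD => [|al _|al _]; first last.
- by rewrite lee_fin mulr_ge0 ?F0.
- by rewrite lee_fin mulr_ge0 ?F0// mulr_ge0 ?sqr_ge0.
apply: lte_add_pinfty; apply: esumZ_lty => //.
by rewrite mulr_ge0 ?sqr_ge0.
Qed.

Lemma Hsp0 p : Hsp phi p (0 : gseries R).
Proof.
by rewrite /Hsp /= /Hnorm2 esum1 ?ltry// => al _; rewrite normc0 expr0n mul0r.
Qed.

Lemma Hsp_le p q f : p <= q -> Hsp phi q f -> Hsp phi p f.
Proof.
move=> pq; apply: le_lt_trans; apply: le_esum => al _; rewrite lee_fin.
apply: ler_wpM2l; rewrite ?sqr_ge0//.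
by rewrite ler_weXz2l ?cw_ge1// ler_pM2l.
Qed.

Lemma test_submod_closed : submod_closed (test_set phi).
Proof.
split=> [|a f g]; rewrite !inE /=; first by move=> p; exact: Hsp0.
by move=> Hf Hg p; exact: Hsp_lin.
Qed.

Lemma dist_submod_closed : submod_closed (dist_set phi).
Proof.
split=> [|a f g]; rewrite !inE /=; first by exists 0; exact: Hsp0.
move=> [p Hf] [q Hg]; exists (Num.max p q); apply: Hsp_lin.
  by apply: Hsp_le Hf; rewrite lerN2 le_max lexx.
by apply: Hsp_le Hg; rewrite lerN2 le_max lexx orbT.
Qed.

End closedness.

HB.instance Definition _ (R : realType) (phi : weight R) :=
  GRing.isSubmodClosed.Build _ _ (test_set phi) (test_submod_closed phi).
HB.instance Definition _ (R : realType) (phi : weight R) :=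
  GRing.isSubmodClosed.Build _ _ (dist_set phi) (dist_submod_closed phi).

(* [S1] is S_1 and [Sm1] is S_{-1}. *)
Record S1 (R : realType) (phi : weight R) :=
  MkS1 { S1_val :> gseries R ; S1_valP : S1_val \in test_set phi }.
HB.instance Definition _ (R : realType) (phi : weight R) :=
  [isSub for @S1_val R phi].
HB.instance Definition _ (R : realType) (phi : weight R) :=
  [Choice of S1 phi by <:].
HB.instance Definition _ (R : realType) (phi : weight R) :=
  [SubChoice_isSubLmodule of S1 phi by <:].

Record Sm1 (R : realType) (phi : weight R) :=
  MkSm1 { Sm1_val :> gseries R ; Sm1_valP : Sm1_val \in dist_set phi }.
HB.instance Definition _ (R : realType) (phi : weight R) :=
  [isSub for @Sm1_val R phi].
HB.instance Definition _ (R : realType) (phi : weight R) :=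
  [Choice of Sm1 phi by <:].
HB.instance Definition _ (R : realType) (phi : weight R) :=
  [SubChoice_isSubLmodule of Sm1 phi by <:].

(* Unconditional sum of an absolutely summable complex family. *)
Definition rsum (R : realType) (T : choiceType) (D : set T) (F : T -> R) : R :=
  fine (\esum_(x in D) (F^\+ x)%:E) - fine (\esum_(x in D) (F^\- x)%:E).
Definition csum (R : realType) (T : choiceType) (D : set T) (F : T -> R[i])
    : R[i] :=
  rsum D (fun x => complex.Re (F x)) +i* rsum D (fun x => complex.Im (F x)).

Definition inner (R : realType) (z w : gseries R) : R[i] :=
  csum [set: gindex] (fun al => z al * (w al)^*).

(* The locally convex topology of a family of seminorms [q] is the initial
   topology of all the maps [h |-> q (h - g)]. *)
Definition S1_dist (R : realType) (phi : weight R) (h : S1 phi)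
    : {ptws (int * S1 phi)%type -> R} :=
  fun pg => Hnorm phi pg.1 (val (h - pg.2)).
HB.instance Definition _ (R : realType) (phi : weight R) :=
  Topological.copy (S1 phi) (initial_topology (@S1_dist R phi)).

Definition S1_bounded (R : realType) (phi : weight R) (B : set (S1 phi)) : Prop :=
  forall p : int, exists M : R, forall h, B h -> Hnorm phi p h <= M.

(* Strong dual topology: uniform convergence on the bounded subsets of S_1. *)
Definition Sm1_dual (R : realType) (phi : weight R) (f : Sm1 phi)
    : {family @S1_bounded R phi, S1 phi -> (R[i])^o} :=
  fun h => inner f h.
HB.instance Definition _ (R : realType) (phi : weight R) :=
  Topological.copy (Sm1 phi) (initial_topology (@Sm1_dual R phi)).

(* Number of pairs [(a, b)] with [b < a], i.e. of transpositions of neighbours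
   needed to sort the concatenation of [al] and [be]. *)
Definition sigma (al be : gindex) : nat :=
  (\sum_(a <- al) \sum_(b <- be) (b < a))%N.

(* The pairs with [al \/ be = ga] are [(al, ga `\` al)] for [al] included in [ga];
   in [Madj], those with [al \/ ga = be] are [(al, al `|` ga)] for [al] disjoint
   from [ga]. *)
Definition Mop (R : realType) (f g : gseries R) : gseries R := fun ga =>
  \sum_(al <- fpowerset ga)
    (-1) ^+ sigma al (ga `\` al)%fset * f al * g (ga `\` al)%fset.

Definition Madj (R : realType) (f g : gseries R) : gseries R := fun ga =>
  csum [set al : gindex | [disjoint al & ga]%fset]
    (fun al => (-1) ^+ sigma al ga * (f al)^* * g (al `|` ga)%fset).

Definition Tmul (R : realType) (f g : gseries R) : gseries R :=
  Mop f g + Madj f g.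

Section process.
Variable R : realType.
Implicit Types (h H : R -> R[i]) (m : R -> R).

Let mu := @lebesgue_measure R.

Definition cRintegral (D : set R) h : R[i] :=
  (\int[mu]_(x in D) complex.Re (h x)) +i* (\int[mu]_(x in D) complex.Im (h x)).

Definition L2norm2 h : \bar R := (\int[mu]_x (normc (h x) ^+ 2)%:E)%E.

Definition L2 h : Prop :=
  [/\ measurable_fun setT (fun x => complex.Re (h x)),
      measurable_fun setT (fun x => complex.Im (h x)) &
      (L2norm2 h < +oo)%E].

Definition expi (x : R) : R[i] := cos x +i* sin x.

(* [H] is (a representative of) the Fourier transform of [h] on L_2, i.e. the
   limit in L_2 of the integrals of [exp(-iux) h(x)] dx over [-n, n]. A normalising
   constant in the transform would not change [S_m]. *)
Definition fourier_part h (n : nat) : R -> R[i] := fun u =>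
  cRintegral `[- n%:R, n%:R] (fun x => expi (- (u * x)) * h x).

Definition is_fourier h H : Prop :=
  [/\ L2 h, L2 H &
      L2norm2 (fun u => fourier_part h n u - H u) @[n --> \oo] --> 0%E].

Definition dom_S m h : Prop :=
  L2 h /\ exists2 H, is_fourier h H &
    (\int[mu]_u (m u * normc (H u) ^+ 2)%:E < +oo)%E.

Definition S_spec m h g : Prop :=
  [/\ dom_S m h, L2 g & exists2 H, is_fourier h H &
      is_fourier g (fun u => (Num.sqrt (m u))%:C * H u)].

(* A representative of [S_m h], which is defined up to a null set; [0] stands for
   [S_m h] when [h] is not in the domain. *)
Definition Sop m h : R -> R[i] := xget (fun=> 0) [set g | S_spec m h g].

(* Physicists' Hermite polynomials; [hermite n] is the function xi_(n+1). *)
Fixpoint hermite_poly (n : nat) : {poly R} :=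
  if n is k.+1 then 'X *+ 2 * hermite_poly k - (hermite_poly k)^`() else 1.

Definition hermite (n : nat) (x : R) : R :=
  (hermite_poly n).[x] * expR (- (x ^+ 2 / 2)) /
  Num.sqrt (2 ^+ n * n`!%:R * Num.sqrt pi).

Definition int0 h (t : R) : R[i] :=
  if 0 <= t then cRintegral `[0, t] h else - cRintegral `[t, 0] h.

Definition fm m (t : R) : gseries R := fun al =>
  \sum_(n <- al | al == [fset n]%fset)
    int0 (Sop m (fun x => (hermite n x)%:C)) t.

Definition Xm m (t : R) (g : gseries R) : gseries R := Tmul (fm m t) g.

End process.

(* Main.v *)
(* Integrating by parts, the Fourier transform of the n-th Hermite function is O(A^n) times
   (1 + |u|)^-1 (1 + u^2)^-1.  As [sqrt m <= 1 + m], the condition on m then makes the transform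
   of S_m xi_n integrable against 1 + |u| with bound C A^n.  Damping by exp(-eps |u|) (Poisson
   kernel) inverts the transform: the primitive of S_m xi_n is that of a bounded Lipschitz
   function, with constants C A^n in both cases.  Since phi(n) >= xi n, the factor A^n is absorbed
   by a power of c_alpha, and the summability of c_alpha^-2 turns the coefficientwise bounds on
   T_f g, applied to second-order Taylor remainders of f_m, into convergence in the strong dual.

   When S_m xi_n does not exist, [Sop] yields 0 and the bounds hold trivially, so that
   Plancherel's theorem is not needed. *)
From HB Require Import structures.
Require Import Defs.
From mathcomp Require Import all_boot all_order all_algebra finmap.
From mathcomp Require Import complex ring lra.
From mathcomp Require Import all_classical all_reals all_analysis.
From mathcomp Require Import measurable_realfun.
Set Implicit Arguments.
Unset Strict Implicit.
Unset Printing Implicit Defensive.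
Import Order.TTheory GRing.Theory Num.Theory.
Import numFieldNormedType.Exports.
Import ComplexField.Normc.
Local Open Scope complex_scope.
Local Open Scope classical_set_scope.
Local Open Scope ring_scope.

(** * Integrals over the line *)

(** [is_fourier] provides only an L_2 limit of integrals over [-n, n], so every estimate is made on
    truncated integrals and carries a boundary error exp(-M^2/4) until the limit is taken.
    Representatives of S_m xi_n are free on null sets, hence only integrals over intervals are
    inverted; the process uses nothing but primitives. The analysis is real: with a phase th, cos(u
    x + th) covers real and imaginary parts at once, integration by parts only shifts th by pi/2,
    and multiplication by -i exchanges the two parts of a transform. Bounds C A^n are stable under
    the recurrences of the Hermite functions, and no sharper growth in n is sought because any base
    A is paid for by some power of c_alpha. That power depends on A alone, neither on t nor on the
    test function, so each topological claim reduces to one scalar tending to 0 at a fixed order of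
    growth. For the derivative this scalar is O(|h|), since the Lipschitz bound makes the Taylor
    remainder quadratic in h with constant C A^n. *)

Section RealIntegrals.
Variable R : realType.
Notation mu := (@lebesgue_measure R).
Implicit Types (D : set R) (f g : R -> R).

Lemma integrable_le D f g : measurable D -> measurable_fun D f ->
  (forall x, D x -> `|f x| <= g x) -> mu.-integrable D (EFin \o g) ->
  mu.-integrable D (EFin \o f).
Proof.
move=> mD mf fg; apply: le_integrable => //; first exact/measurable_EFinP.
move=> x Dx /=; rewrite lee_fin; exact: (le_trans (fg _ Dx) (ler_norm _)).
Qed.

Lemma norm_Rintegral_le D f g : measurable D -> measurable_fun D f ->
  (forall x, D x -> `|f x| <= g x) -> mu.-integrable D (EFin \o g) ->
  `|\int[mu]_(x in D) f x| <= \int[mu]_(x in D) g x.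
Proof.
move=> mD mf fg ig; have i_f := integrable_le mD mf fg ig.
apply: le_trans; first exact: le_normr_Rintegral.
apply: le_Rintegral => //.
by have := integrable_abse i_f.
Qed.

Lemma integrable_mulrl D f (r : R) : measurable D -> mu.-integrable D (EFin \o f) ->
  mu.-integrable D (EFin \o (fun x => r * f x)).
Proof.
by move=> mD h; have := @integrableZl _ _ _ mu _ mD r _ h.
Qed.

Lemma integrable_addr D f g : measurable D -> mu.-integrable D (EFin \o f) ->
  mu.-integrable D (EFin \o g) -> mu.-integrable D (EFin \o (fun x => f x + g x)).
Proof. by move=> mD hf hg; have := @integrableD _ _ _ mu _ mD _ _ hf hg. Qed.

Lemma integrable_subr D f g : measurable D -> mu.-integrable D (EFin \o f) ->
  mu.-integrable D (EFin \o g) -> mu.-integrable D (EFin \o (fun x => f x - g x)).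
Proof. by move=> mD hf hg; have := @integrableB _ _ _ mu _ mD _ _ hf hg. Qed.

Lemma integrable_normr D f : measurable D -> mu.-integrable D (EFin \o f) ->
  mu.-integrable D (EFin \o (fun x => `|f x|)).
Proof. by move=> mD hf; have := integrable_abse hf. Qed.

Lemma integrable_sub D f : measurable D ->
  mu.-integrable [set: R] (EFin \o f) -> mu.-integrable D (EFin \o f).
Proof. by move=> mD; apply: integrableS. Qed.

Lemma Rintegral_sub D g : measurable D -> (forall x, 0 <= g x) ->
  mu.-integrable [set: R] (EFin \o g) ->
  \int[mu]_(x in D) g x <= \int[mu]_x g x.
Proof.
move=> mD g0 ig.
have i2 := integrable_sub mD ig.
rewrite -lee_fin !fineK; last 2 first.
- exact: integrable_fin_num ig.
- exact: integrable_fin_num i2.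
apply: ge0_subset_integral => //.
- by case/integrableP : ig.
- by move=> x _; rewrite lee_fin.
Qed.

Lemma integrable_itv (a b : R) f : continuous f ->
  mu.-integrable `[a, b] (EFin \o f).
Proof.
move=> cf; apply: continuous_compact_integrable; first exact: segment_compact.
by apply: continuous_subspaceT.
Qed.

Lemma integrable_oneDsqrV :
  mu.-integrable [set: R] (EFin \o (fun x : R => (1 + x ^+ 2)^-1)).
Proof.
have c : continuous (fun x : R => (1 + x ^+ 2)^-1) by exact: continuous_oneDsqrV.
have p (x : R) : 0 <= (1 + x ^+ 2)^-1 by rewrite invr_ge0 addr_ge0// sqr_ge0.
apply/integrableP; split.
  by apply/measurable_EFinP; exact: continuous_measurable_fun.
under eq_integral => x _ do rewrite /= ger0_norm//.
rewrite ge0_symfun_integralT//; last by move=> x /=; rewrite sqrrN.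
have := integral0y_oneDsqr R; rewrite /oneDsqr => h.
have -> : [set x : R | 0 <= x] = `[0, +oo[%classic.
  by apply/seteqP; split => x /=; rewrite in_itv/= andbT.
by rewrite h -EFinM ltry.
Qed.

End RealIntegrals.

(** * Hermite functions *)

Section HermiteFunctions.
Variable R : realType.
Implicit Types (n k : nat) (x : R).
Let Hp := hermite_poly R.

Lemma deriv_hermite_poly n : (Hp n.+1)^`() = Hp n *+ (2 * n.+1).
Proof.
elim: n => [|n IH]; first by rewrite /Hp /= mulr1 derivC subr0 derivMn derivX.
rewrite [Hp n.+2]/= derivB derivM derivMn derivX -/(Hp n.+1) IH.
rewrite derivMn.
have E : Hp n.+1 = 'X *+ 2 * Hp n - (Hp n)^`() by [].
by rewrite -E mulrnAr -addrA -mulrnBl -E [in RHS]mulnS mulrnDr mulr_natl.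
Qed.

Lemma hermite_polySS n :
  Hp n.+2 = 'X *+ 2 * Hp n.+1 - Hp n *+ (2 * n.+1).
Proof. by rewrite -deriv_hermite_poly. Qed.

Lemma hermite_horner n x :
  (Hp n.+2).[x] = 2 * x * (Hp n.+1).[x] - 2 * n.+1%:R * (Hp n).[x].
Proof.
rewrite hermite_polySS hornerD hornerN hornerMn hornerM hornerMn hornerX.
by rewrite -[x *+ 2]mulr_natl -[_ *+ (2 * _)]mulr_natl natrM.
Qed.

(** Orthonormal scaling without the Gaussian: in the three-term recurrence the coefficients become
    bounded multiples of x and 1. *)
Definition hermite_scaled n x : R := (Hp n).[x] / Num.sqrt (2 ^+ n * n`!%:R).
(** The square root of the n-th term of the series of exp(2 x^2); the growth of the scaled
    polynomials is measured by these terms. *)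
Definition expterm n x : R := (Num.sqrt 2 * `|x|) ^+ n / Num.sqrt n`!%:R.
Definition exptail n x : R := \sum_(k < n.+1) expterm k x.

Lemma sqrtr_exprn x n : 0 <= x -> Num.sqrt (x ^+ n) = Num.sqrt x ^+ n.
Proof.
move=> x0; elim: n => [|n IH]; first by rewrite !expr0 sqrtr1.
by rewrite !exprS sqrtrM// IH.
Qed.

Lemma sqrt_factS n : Num.sqrt (n.+1)`!%:R = Num.sqrt n.+1%:R * Num.sqrt n`!%:R :> R.
Proof. by rewrite factS natrM sqrtrM. Qed.

Lemma sqrt_fact_gt0 n : 0 < Num.sqrt (n`!%:R : R).
Proof. by rewrite sqrtr_gt0 ltr0n fact_gt0. Qed.

Lemma expterm_ge0 n x : 0 <= expterm n x.
Proof. by rewrite /expterm divr_ge0 ?exprn_ge0 ?mulr_ge0 ?sqrtr_ge0. Qed.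

Lemma exptermS n x : Num.sqrt 2 * `|x| * expterm n x = Num.sqrt n.+1%:R * expterm n.+1 x.
Proof.
rewrite /expterm sqrt_factS exprS.
have h1 := sqrt_fact_gt0 n; have h2 : 0 < Num.sqrt (n.+1%:R : R) by rewrite sqrtr_gt0 ltr0n.
by field; rewrite !gt_eqF.
Qed.

Lemma exptailS n x : exptail n.+1 x = exptail n x + expterm n.+1 x.
Proof. by rewrite /exptail big_ord_recr. Qed.

Lemma exptail_ge0 n x : 0 <= exptail n x.
Proof. by rewrite /exptail sumr_ge0// => i _; exact: expterm_ge0. Qed.

(** Multiplying the k-th term by sqrt 2 |x| gives sqrt (k+1) times the next one, and k <= n. The
    factor sqrt (n+1) is exactly what the recurrence of [hermite_scaled] divides by. *)
Lemma exptail_step n x : Num.sqrt 2 * `|x| * exptail n x <= Num.sqrt n.+1%:R * exptail n.+1 x.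
Proof.
rewrite {2}/exptail big_ord_recl mulrDr /exptail mulr_sumr.
apply: (@le_trans _ _ (Num.sqrt n.+1%:R * \sum_(i < n.+1) expterm (lift ord0 i) x)); last first.
  by rewrite lerDr mulr_ge0 ?sqrtr_ge0 ?expterm_ge0.
rewrite mulr_sumr; apply: ler_sum => i _; rewrite exptermS.
apply: ler_wpM2r; first exact: expterm_ge0.
by rewrite ler_wsqrtr// ler_nat.
Qed.

(** After squaring, (2 x^2)^n / n! = 8^n (x^2/4)^n / n!, where 8 <= 3^2 and the last quotient is a
    term of exp(x^2/4). The exponent 1/8 is small enough to be absorbed by the Gaussian in
    [hermite_le]. *)
Lemma expterm_le n x : expterm n x <= 3 ^+ n * expR (x ^+ 2 / 8).
Proof.
have h : expterm n x ^+ 2 <= (3 ^+ n * expR (x ^+ 2 / 8)) ^+ 2.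
  have -> : expterm n x ^+ 2 = (2 * x ^+ 2) ^+ n / n`!%:R.
    rewrite /expterm expr_div_n (sqr_sqrtr (ler0n _ _)) -exprM mulnC exprM.
    by rewrite (exprMn _ (Num.sqrt 2)) sqr_sqrtr// real_normK ?num_real.
  rewrite [leRHS]exprMn -expRM_natl -exprM mulnC exprM.
  have -> : 2 * (x ^+ 2 / 8) = x ^+ 2 / 4 by field.
  have -> : 2 * x ^+ 2 = 8 * (x ^+ 2 / 4) by field.
  rewrite exprMn -mulrA; apply: ler_pM.
  - by rewrite exprn_ge0.
  - by rewrite divr_ge0 ?ler0n// exprn_ge0// divr_ge0// sqr_ge0.
  - by rewrite lerXn2r ?nnegrE//; lra.
  have y0 : 0 <= x ^+ 2 / 4 by rewrite divr_ge0// sqr_ge0.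
  case: n => [|n].
    by rewrite expr0 fact0 divr1 (le_trans _ (expR_ge1Dx _))// lerDl.
  by rewrite (le_trans _ (expR_ge1Dxn n y0))// lerDr.
rewrite -(@ler_pXn2r _ 2)// ?nnegrE ?expterm_ge0// mulr_ge0 ?expR_ge0// exprn_ge0//.
Qed.

Lemma exptail_le n x : exptail n x <= 4 ^+ n * expR (x ^+ 2 / 8).
Proof.
elim: n => [|n IH].
  by rewrite /exptail big_ord_recl big_ord0 addr0 (expterm_le 0).
rewrite exptailS (le_trans (lerD IH (expterm_le _ _)))// -mulrDl ler_wpM2r ?expR_ge0//.
rewrite !exprS.
have : (3 : R) ^+ n <= 4 ^+ n by rewrite lerXn2r ?nnegrE//; lra.
by lra.
Qed.

(** The recurrence with its square roots turned into field elements: f, p, q, t stand for the roots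
    of n!, n+2, n+1 and 2, and a for t^n. Only t^2 = 2 and q^2 = n+1 are remembered. *)
Lemma hermite_scaled_alg (F : fieldType) (u w f p q t a x n : F) : f != 0 -> q != 0 -> p != 0 ->
  t != 0 -> t * t = 2 -> q * q = n -> a != 0 ->
  (2 * x * u - 2 * n * w) / (t * (a * t) * (p * (q * f))) =
  t / p * x * (u / (a * t * (q * f))) - q / p * (w / (a * f)).
Proof.
move=> f0 q0 p0 t0 t2 qn a0; rewrite -t2 -qn.
by field; rewrite f0 q0 p0 t0 a0.
Qed.

Lemma hermite_scaledSS n x :
  hermite_scaled n.+2 x = Num.sqrt 2 / Num.sqrt n.+2%:R * x * hermite_scaled n.+1 x
  - Num.sqrt n.+1%:R / Num.sqrt n.+2%:R * hermite_scaled n x.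
Proof.
rewrite /hermite_scaled hermite_horner.
rewrite !sqrtrM ?exprn_ge0// !sqrt_factS !sqrtr_exprn//.
have h0 := sqrt_fact_gt0 n.
have h1 : 0 < Num.sqrt (n.+1%:R : R) by rewrite sqrtr_gt0 ltr0n.
have h2 : 0 < Num.sqrt (n.+2%:R : R) by rewrite sqrtr_gt0 ltr0n.
have h3 : 0 < Num.sqrt (2 : R) by rewrite sqrtr_gt0.
have h4 : Num.sqrt (2:R) ^+ 2 = 2 by rewrite sqr_sqrtr.
have h5 : Num.sqrt (n.+1%:R:R) ^+ 2 = n.+1%:R by rewrite sqr_sqrtr.
rewrite !expr2 in h4 h5.
have h6 : (Num.sqrt 2 : R) ^+ n != 0 by rewrite gt_eqF// exprn_gt0.
rewrite !exprSr.
set a := Num.sqrt 2 ^+ n in h6 *.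
move: h4 h5 h6; rewrite -/(_ != 0).
move: (lt0r_neq0 h0) (lt0r_neq0 h1) (lt0r_neq0 h2) (lt0r_neq0 h3) => {h0 h1 h2 h3}.
move: (Num.sqrt n`!%:R) (Num.sqrt n.+2%:R) (Num.sqrt n.+1%:R) (Num.sqrt 2) a => f p q t a.
move: (Hp n.+1).[x] (Hp n).[x] => u w.
exact: hermite_scaled_alg.
Qed.

(** Two-step induction along the recurrence. Each of its two terms is at most 2^(n+1), respectively
    2^n, times the next partial sum, and 2^(n+1) + 2^n <= 2^(n+2). *)
Lemma hermite_scaled_le n x : `|hermite_scaled n x| <= 2 ^+ n * exptail n x.
Proof.
suff : `|hermite_scaled n x| <= 2 ^+ n * exptail n x /\
  `|hermite_scaled n.+1 x| <= 2 ^+ n.+1 * exptail n.+1 x by case.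
elim: n => [|n [IH0 IH1]].
  have s0 : exptail 0 x = 1 by rewrite /exptail big_ord1 /expterm expr0 fact0 sqrtr1 divr1.
  have -> : exptail 1 x = 1 + Num.sqrt 2 * `|x|.
    by rewrite exptailS s0 /expterm expr1 factS fact0 muln1 sqrtr1 divr1.
  have -> : hermite_scaled 0 x = 1.
    by rewrite /hermite_scaled /Hp /= expr0 fact0 mulr1 sqrtr1 divr1 hornerC.
  have h3 : 0 < Num.sqrt (2 : R) by rewrite sqrtr_gt0.
  have h4 : Num.sqrt (2:R) ^+ 2 = 2 by rewrite sqr_sqrtr.
  have -> : hermite_scaled 1 x = Num.sqrt 2 * x.
    rewrite /hermite_scaled /Hp /= mulr1 derivC subr0 hornerMn hornerX expr1 factS fact0 muln1 mulr1.
    by rewrite -mulr_natl -{1}h4; field; rewrite gt_eqF.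
  rewrite s0 normr1 expr0 mulr1 lexx; split => //.
  rewrite normrM gtr0_norm// expr1.
  have : 0 <= Num.sqrt 2 * `|x| by rewrite mulr_ge0// ltW.
  by lra.
split => //; rewrite hermite_scaledSS (le_trans (ler_normB _ _))//.
have h1 : 0 < Num.sqrt (n.+1%:R : R) by rewrite sqrtr_gt0 ltr0n.
have h2 : 0 < Num.sqrt (n.+2%:R : R) by rewrite sqrtr_gt0 ltr0n.
have h12 : Num.sqrt (n.+1%:R : R) <= Num.sqrt n.+2%:R by rewrite ler_wsqrtr// ler_nat.
apply: (@le_trans _ _ (2 ^+ n.+1 * exptail n.+2 x + 2 ^+ n * exptail n.+2 x)); last first.
  rewrite -mulrDl ler_wpM2r ?exptail_ge0// !exprS.
  have : 0 <= 2 ^+ n :> R by rewrite exprn_ge0.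
  by lra.
apply: lerD.
  rewrite 3!normrM normfV !(ger0_norm (sqrtr_ge0 _)).
  have h := exptail_step n.+1 x.
  apply: (@le_trans _ _ (Num.sqrt 2 / Num.sqrt n.+2%:R * `|x| * (2 ^+ n.+1 * exptail n.+1 x))).
    by apply: ler_wpM2l => //; rewrite mulr_ge0// divr_ge0 ?sqrtr_ge0.
  have -> : Num.sqrt 2 / Num.sqrt n.+2%:R * `|x| * (2 ^+ n.+1 * exptail n.+1 x) =
      2 ^+ n.+1 * (Num.sqrt 2 * `|x| * exptail n.+1 x / Num.sqrt n.+2%:R) by ring.
  by rewrite ler_pM2l ?exprn_gt0// ler_pdivrMr// [leRHS]mulrC.
rewrite normrM [X in X * _]normrM normfV !(ger0_norm (sqrtr_ge0 _)).
apply: (@le_trans _ _ (1 * (2 ^+ n * exptail n x))).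
  apply: ler_pM => //.
  by rewrite ler_pdivrMr// mul1r.
rewrite mul1r ler_wpM2l ?exprn_ge0// !exptailS.
have := expterm_ge0 n.+1 x; have := expterm_ge0 n.+2 x; lra.
Qed.

Lemma hermiteE n x :
  hermite n x = hermite_scaled n x * expR (- (x ^+ 2 / 2)) / Num.sqrt (Num.sqrt pi).
Proof.
rewrite /hermite /hermite_scaled [X in _ / X]sqrtrM ?mulr_ge0 ?exprn_ge0// invfM; ring.
Qed.

(** The base is 8 = 2 * 4, from [hermite_scaled_le] and [exptail_le]; the exponents satisfy 1/8 -
    1/2 <= -1/4, and the remaining normalisation is a root of pi, at least 1. *)
Lemma hermite_le n x : `|hermite n x| <= 8 ^+ n * expR (- (x ^+ 2 / 4)).
Proof.
rewrite hermiteE 2!normrM normfV (ger0_norm (expR_ge0 _)) (ger0_norm (sqrtr_ge0 _)).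
have p1 : 1 <= Num.sqrt (Num.sqrt (pi : R)).
  rewrite -{1}sqrtr1 ler_wsqrtr// -{1}sqrtr1 ler_wsqrtr//.
  by have := pi_ge2 R; lra.
rewrite ler_pdivrMr ?(lt_le_trans _ p1)//.
apply: (@le_trans _ _ (8 ^+ n * expR (- (x ^+ 2 / 4)))); last first.
  by rewrite ler_peMr// mulr_ge0 ?exprn_ge0 ?expR_ge0.
apply: (@le_trans _ _ (8 ^+ n * expR (x ^+ 2 / 8) * expR (- (x ^+ 2 / 2)))).
  apply: ler_wpM2r; first exact: expR_ge0.
  rewrite (le_trans (hermite_scaled_le _ _))//.
  have -> : (8:R) = 2 * 4 by ring.
  rewrite exprMn -mulrA ler_wpM2l ?exprn_ge0//.
  have -> : (2 * 4 : R) = 8 by ring.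
  exact: exptail_le.
rewrite -mulrA -expRD ler_wpM2l ?exprn_ge0// ler_expR.
have : 0 <= x ^+ 2 by exact: sqr_ge0.
by lra.
Qed.

End HermiteFunctions.

(** * Decay of oscillatory integrals of Hermite functions *)

Section HermiteFourier.
Variable R : realType.
Implicit Types (n k : nat) (x : R).
Let Hp := hermite_poly R.

Definition hnorm n : R := Num.sqrt (2 ^+ n * n`!%:R * Num.sqrt pi).
(** The coefficient of the ladder relation xi' = nu n h_(n-1) - nu (n+1) h_(n+1) between normalised
    Hermite functions. *)
Definition nu n : R := Num.sqrt (n%:R / 2).

Lemma nu_ge0 n : 0 <= nu n. Proof. exact: sqrtr_ge0. Qed.

Lemma nu_sqr n : nu n * nu n = n%:R / 2.
Proof. by rewrite -expr2 sqr_sqrtr// divr_ge0. Qed.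

Lemma nu_le n : nu n <= 2 ^+ n.
Proof.
apply: (@le_trans _ _ n%:R); last by rewrite -natrX ler_nat ltnW// ltn_expl.
rewrite -(@ler_pXn2r _ 2)// ?nnegrE ?nu_ge0// expr2 nu_sqr expr2.
case: n => [|n]; first by rewrite !mul0r.
have : 1 <= n.+1%:R :> R by rewrite ler1n.
by nra.
Qed.

Lemma hnorm_gt0 n : 0 < hnorm n.
Proof.
by rewrite sqrtr_gt0 !mulr_gt0 ?exprn_gt0 ?ltr0n ?fact_gt0// sqrtr_gt0 pi_gt0.
Qed.

Lemma hnormS n : hnorm n.+1 = 2 * nu n.+1 * hnorm n.
Proof.
rewrite /hnorm /nu; have -> : (2 : R) = Num.sqrt (2 ^+ 2) by rewrite sqrtr_sqr ger0_norm.
rewrite -!sqrtrM ?mulr_ge0 ?exprn_ge0 ?sqrtr_ge0//.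
rewrite sqrtr_sqr ger0_norm//; congr Num.sqrt.
by rewrite exprS factS natrM; field.
Qed.

Lemma is_derive_hermite n x : is_derive x 1 (@hermite R n)
  (nu n * hermite n.-1 x - nu n.+1 * hermite n.+1 x).
Proof.
have E : @hermite R n = (horner (Hp n) * (expR \o (fun x => - (x ^+ 2 / 2)))) * cst (hnorm n)^-1.
  by apply/funext => y.
have D1 : is_derive x 1 (expR \o (fun x : R => - (x ^+ 2 / 2))) (- x * expR (- (x ^+ 2 / 2))).
  apply: is_derive_eq; rewrite /GRing.scale /=; by field.
rewrite E; apply: is_derive_eq.
rewrite /GRing.scale /= /cst /hermite -/(hnorm n.-1) -/(hnorm n.+1) -/(Hp n.-1) -/(Hp n.+1).
have HS : (Hp n.+1).[x] = 2 * x * (Hp n).[x] - (Hp n)^`().[x].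
  rewrite [Hp n.+1]/= hornerD hornerN hornerM hornerMn hornerX.
  by rewrite -[x *+ 2]mulr_natl.
have Hd : nu n * ((Hp n.-1).[x] * expR (- (x ^+ 2 / 2)) / hnorm n.-1) =
    (Hp n)^`().[x] * expR (- (x ^+ 2 / 2)) / (2 * hnorm n).
  (* For n = 0 the predecessor [n.-1] is again 0, but [nu 0] = 0 removes that term. *)
  case: (n) => [|k]; first by rewrite /nu mul0r sqrtr0 mul0r /Hp /= derivC horner0 !mul0r.
  rewrite deriv_hermite_poly hornerMn -pred_Sn -(mulr_natl _ (2 * _)) natrM hnormS.
  have -> : k.+1%:R = 2 * (nu k.+1 * nu k.+1) by rewrite nu_sqr; field.
  have h0 := hnorm_gt0 k.
  have h1 : 0 < nu k.+1 by rewrite sqrtr_gt0 divr_gt0.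
  move: h0 h1; move: (hnorm k) (nu _) (_.[x]) (expR _) => h v u e h0 v0.
  by field; rewrite !gt_eqF.
rewrite Hd HS hnormS.
have h0 := hnorm_gt0 n.
have h1 : 0 < nu n.+1 by rewrite sqrtr_gt0 divr_gt0.
move: h0 h1; move: ((horner _ * _) x) (hnorm n) (nu _) (Hp n).[x] (_.[x]) (expR _) => z h v u w e h0 v0.
by field; rewrite !gt_eqF.
Qed.

Lemma continuous_hermite n : continuous (@hermite R n).
Proof.
move=> x; apply: differentiable_continuous; apply/derivable1_diffP.
by have [] := is_derive_hermite n x.
Qed.

Notation mu := (@lebesgue_measure R).

Definition osc n (M u th : R) : R :=
  \int[mu]_(x in `[- M, M]) (cos (u * x + th) * hermite n x).

Lemma is_derive_phase (u th x : R) :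
  is_derive x 1 (fun x : R => sin (u * x + th)) (u * cos (u * x + th)).
Proof.
apply: is_derive_eq; rewrite /GRing.scale /=; ring.
Qed.

Lemma derivable_continuous (f : R -> R) : (forall x, derivable f x 1) -> continuous f.
Proof.
by move=> h x; apply: differentiable_continuous; apply/derivable1_diffP.
Qed.

Lemma derivable_LR (f : R -> R) (a b : R) : (forall x, derivable f x 1) ->
  derivable_oo_LRcontinuous f a b.
Proof.
move=> h; have c := derivable_continuous h.
split; first by move=> x _; exact: h.
- by apply: cvg_at_right_filter; exact: c.
- by apply: cvg_at_left_filter; exact: c.
Qed.

Lemma continuous_cos_phase (u th : R) : continuous (fun x : R => cos (u * x + th)).
Proof.
apply: derivable_continuous => x; apply: ex_derive.
Qed.

Lemma integrable_osc n (M u th : R) :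
  mu.-integrable `[- M, M] (EFin \o (fun x => cos (u * x + th) * hermite n x)).
Proof.
apply: integrable_itv => x; apply: cvgM; first exact: continuous_cos_phase.
exact: continuous_hermite.
Qed.

Lemma osc_sub n (M u th : R) : 0 < M -> u * osc n M u th =
  sin (u * M + th) * hermite n M - sin (- (u * M) + th) * hermite n (- M)
  - (nu n * osc n.-1 M u (th - pi / 2) - nu n.+1 * osc n.+1 M u (th - pi / 2)).
Proof.
move=> M0.
have NM : - M < M by lra.
have sinE y : sin y = cos (y - pi / 2).
  by rewrite cosB cos_pihalf sin_pihalf mulr0 add0r mulr1.
have D : forall x, derivable (@hermite R n) x 1 by move=> x; have [] := is_derive_hermite n x.
pose dh x := nu n * hermite n.-1 x - nu n.+1 * hermite n.+1 x.
have E := @Rintegration_by_parts R (hermite n) (fun x => sin (u * x + th))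
  dh (fun x => u * cos (u * x + th)) (- M) M NM.
rewrite /osc -RintegralZl//; last exact: integrable_osc.
rewrite -!RintegralZl//; try exact: integrable_osc.
rewrite -RintegralB//; last 2 first.
- by apply: integrable_mulrl => //; exact: integrable_osc.
- by apply: integrable_mulrl => //; exact: integrable_osc.
transitivity (\int[mu]_(x in `[- M, M]) (hermite n x * (u * cos (u * x + th)))).
  by apply: eq_Rintegral => x _; ring.
rewrite E; first last.
- by move=> x _; rewrite derive1E; have [_ ->] := is_derive_phase u th x.
- by apply: derivable_LR => x; have [] := is_derive_phase u th x.
- apply: continuous_subspaceT => x; apply: cvgMr; exact: continuous_cos_phase.
- by move=> x _; rewrite derive1E; have [_ ->] := is_derive_hermite n x.
- exact: derivable_LR.
- apply: continuous_subspaceT => x; apply: cvgB; apply: cvgMr; exact: continuous_hermite.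
congr (_ - _); first by rewrite mulrN; ring.
by apply: eq_Rintegral => x _; rewrite /dh sinE addrA; ring.
Qed.

Let I0 : R := \int[mu]_x (1 + x ^+ 2)^-1.

Lemma oneDsqrV_ge0 (x : R) : 0 <= (1 + x ^+ 2)^-1.
Proof. by rewrite invr_ge0 addr_ge0// sqr_ge0. Qed.

Lemma I0_ge0 : 0 <= I0.
Proof. by apply: Rintegral_ge0 => x _; exact: oneDsqrV_ge0. Qed.

Lemma expRN_le (y : R) : 0 <= y -> expR (- y) <= (1 + y)^-1.
Proof.
by move=> y0; rewrite expRN
    lef_pV2 ?posrE ?expR_gt0 ?expR_ge1Dx//; lra.
Qed.

(** From exp(-x^2/4) <= 1 / (1 + x^2/4) <= 4 / (1 + x^2), the last of which has a finite integral
    whatever M is. *)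
Lemma osc_le n (M u th : R) : `|osc n M u th| <= 4 * I0 * 8 ^+ n.
Proof.
have i1 : mu.-integrable [set: R] (EFin \o (fun x : R => 4 * 8 ^+ n * (1 + x ^+ 2)^-1)).
  by apply: integrable_mulrl => //; exact: integrable_oneDsqrV.
have p1 x : 0 <= 4 * 8 ^+ n * (1 + x ^+ 2)^-1 :> R.
  by rewrite !mulr_ge0 ?exprn_ge0 ?oneDsqrV_ge0.
apply: (@le_trans _ _ (\int[mu]_(x in `[- M, M]) (4 * 8 ^+ n * (1 + x ^+ 2)^-1))).
  apply: norm_Rintegral_le => //; last exact: integrable_sub.
  - apply: (@measurable_funS _ _ _ _ setT) => //; apply: continuous_measurable_fun => x.
    by apply: cvgM; [exact: continuous_cos_phase|exact: continuous_hermite].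
  - move=> x _; rewrite normrM -[leRHS]mul1r; apply: ler_pM => //.
      by rewrite ler_norml cos_geN1 cos_le1.
    apply: le_trans (hermite_le n x) _.
    rewrite (mulrC 4) -[leRHS]mulrA ler_wpM2l ?exprn_ge0//.
    have x2 : 0 <= x ^+ 2 by exact: sqr_ge0.
    apply: le_trans (expRN_le _) _; first by lra.
    have h1 : 0 < 1 + x ^+ 2 / 4 by lra.
    have h2 : 0 < 1 + x ^+ 2 by lra.
    by rewrite ler_pdivlMr// mulrC ler_pdivrMr//; lra.
apply: (le_trans (Rintegral_sub _ p1 i1)) => //.
rewrite RintegralZl//; last exact: integrable_oneDsqrV.
by rewrite -/I0 mulrAC.
Qed.

(** Induction on k by [osc_sub]. The truncated function jumps at M and -M, so the powers of u cannot
    be gained uniformly at fixed M; the jump is Gaussian in M and is kept as the second summand,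
    which vanishes for fixed u as M grows. *)
Lemma osc_decay k : exists C A : R, [/\ 0 <= C, 1 <= A & forall n M u th, 0 < M ->
  `|u| ^+ k * `|osc n M u th| <= C * A ^+ n * (1 + `|u| ^+ k * expR (- (M ^+ 2 / 4)))].
Proof.
elim: k => [|k [C [A [C0 A1 IH]]]].
  exists (4 * I0), 8; split; [by rewrite mulr_ge0// I0_ge0|by rewrite ler1n|].
  move=> n M u th _; rewrite expr0 !mul1r (le_trans (osc_le n M u th))//.
  by rewrite ler_peMr ?lerDl ?expR_ge0// !mulr_ge0 ?I0_ge0 ?exprn_ge0.
have A0 : 0 <= A by lra.
(* The inner summands pay for the boundary values, the index n-1 and the index n+1; the outer 2
   turns |u|^k into 1 + |u|^(k+1). In the base, 8^n comes from the boundary values and 2^n A^n from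
   [nu] and the induction hypothesis. *)
exists (2 * (2 + C + 2 * C * A)), (8 * A); split.
- by rewrite mulr_ge0// !addr_ge0// mulr_ge0// mulr_ge0.
- by lra.
move=> n M u th M0.
set e := expR _; have e0 : 0 <= e by exact: expR_ge0.
have e1 : e <= 1 by rewrite /e -[leRHS]expR0 ler_expR; have := sqr_ge0 M; lra.
have An p : 0 <= A ^+ p by rewrite exprn_ge0.
have uk : 0 <= `|u| ^+ k by rewrite exprn_ge0.
have ukS : `|u| ^+ k <= 1 + `|u| ^+ k.+1.
  case: (leP `|u| 1) => u1.
    by rewrite (@le_trans _ _ 1) ?exprn_ile1// lerDl exprn_ge0.
  by rewrite (@le_trans _ _ (`|u| ^+ k.+1)) ?lerDr// ler_weXn2l// ltW.
set E := 1 + `|u| ^+ k * e.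
have E0 : 0 <= E by rewrite addr_ge0// mulr_ge0.
have EE : E <= 2 * (1 + `|u| ^+ k.+1 * e).
  have : `|u| ^+ k * e <= (1 + `|u| ^+ k.+1) * e by rewrite ler_wpM2r.
  have : 0 <= `|u| ^+ k.+1 * e by rewrite mulr_ge0// exprn_ge0.
  by rewrite /E; lra.
have hM (y z : R) : y ^+ 2 = M ^+ 2 -> `|sin z * hermite n y| <= 8 ^+ n * e.
  move=> yM; rewrite normrM -[leRHS]mul1r; apply: ler_pM => //.
    by rewrite ler_norml sin_geN1 sin_le1.
  by apply: le_trans (hermite_le n y) _; rewrite yM.
have J1 := IH n.-1 M u (th - pi / 2) M0; have J2 := IH n.+1 M u (th - pi / 2) M0.
rewrite -/e -/E in J1 J2.
have main : `|u| ^+ k.+1 * `|osc n M u th| <=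
    `|u| ^+ k * (2 * (8 ^+ n * e) + 2 ^+ n * `|osc n.-1 M u (th - pi / 2)|
      + 2 ^+ n.+1 * `|osc n.+1 M u (th - pi / 2)|).
  rewrite exprSr -mulrA ler_wpM2l// -normrM osc_sub//.
  have N1 := hM M (u * M + th) erefl.
  have N2 := hM (- M) (- (u * M) + th) (sqrrN M).
  have N3 : `|nu n * osc n.-1 M u (th - pi / 2)| <= 2 ^+ n * `|osc n.-1 M u (th - pi / 2)|.
    by rewrite normrM ler_wpM2r// ger0_norm ?nu_ge0// nu_le.
  have N4 : `|nu n.+1 * osc n.+1 M u (th - pi / 2)| <= 2 ^+ n.+1 * `|osc n.+1 M u (th - pi / 2)|.
    by rewrite normrM ler_wpM2r// ger0_norm ?nu_ge0// nu_le.
  move: N1 N2 N3 N4; rewrite !ler_norml.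
  by move=> /andP[? ?] /andP[? ?] /andP[? ?] /andP[? ?]; apply/andP; split; lra.
apply: (le_trans main).
rewrite [leLHS]mulrDr [X in X + _]mulrDr.
have A8 : 8 ^+ n <= (8 * A) ^+ n by rewrite lerXn2r ?nnegrE ?mulr_ge0//; lra.
have B0 : 0 <= (8 * A) ^+ n by rewrite exprn_ge0// mulr_ge0.
have T1 : `|u| ^+ k * (2 * (8 ^+ n * e)) <= 2 * ((8 * A) ^+ n * E).
  rewrite mulrCA ler_wpM2l// mulrCA; apply: ler_pM => //; first by rewrite mulr_ge0.
  by rewrite /E lerDr.
have T2 : `|u| ^+ k * (2 ^+ n * `|osc n.-1 M u (th - pi / 2)|) <= C * ((8 * A) ^+ n * E).
  rewrite mulrCA; apply: le_trans (ler_wpM2l _ J1) _; first by rewrite exprn_ge0.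
  have -> : 2 ^+ n * (C * A ^+ n.-1 * E) = C * ((2 ^+ n * A ^+ n.-1) * E) by ring.
  rewrite ler_wpM2l// ler_wpM2r// exprMn; apply: ler_pM; rewrite ?exprn_ge0//.
    by rewrite lerXn2r ?nnegrE//; lra.
  by rewrite ler_weXn2l// leq_pred.
have T3 : `|u| ^+ k * (2 ^+ n.+1 * `|osc n.+1 M u (th - pi / 2)|) <=
    2 * C * A * ((8 * A) ^+ n * E).
  rewrite mulrCA; apply: le_trans (ler_wpM2l _ J2) _; first by rewrite exprn_ge0.
  have -> : 2 ^+ n.+1 * (C * A ^+ n.+1 * E) = 2 * C * A * ((2 ^+ n * A ^+ n) * E).
    by rewrite !exprS; ring.
  rewrite ler_wpM2l ?mulr_ge0// ler_wpM2r// exprMn ler_wpM2r//.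
  by rewrite lerXn2r ?nnegrE//; lra.
apply: (@le_trans _ _ ((2 + C + 2 * C * A) * ((8 * A) ^+ n * E))); first by lra.
rewrite [leRHS](_ : _ = (2 + C + 2 * C * A) * ((8 * A) ^+ n *
  (2 * (1 + `|u| ^+ k.+1 * e)))); last by ring.
by rewrite ler_wpM2l ?addr_ge0 ?mulr_ge0// ler_wpM2l.
Qed.

End HermiteFourier.

(** * Fourier transforms as almost everywhere limits *)

Section RealLemmas.
Variable R : realType.
Notation mu := (@lebesgue_measure R).
Implicit Types (f g : R -> R) (u v x y th : R).

Lemma cos_lip x y : `|cos x - cos y| <= `|x - y|.
Proof.
wlog xy : x y / x <= y.
  move=> H; case: (leP x y) => [|/ltW] h; first exact: H.
  by rewrite distrC (distrC x); exact: H.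
have cc : {within `[x, y], continuous (@cos R)}.
  by apply: continuous_subspaceT => z; exact: continuous_cos.
have [c _ E] := @MVT_segment R cos (fun z => - sin z) x y xy (fun z _ => is_derive_cos z) cc.
rewrite distrC E distrC normrM normrN -[leRHS]mul1r ler_wpM2r//.
by rewrite ler_norml sin_geN1 sin_le1.
Qed.

Lemma lip_continuous f (K : R) : (forall x y, `|f x - f y| <= K * `|x - y|) -> continuous f.
Proof.
move=> lf x; apply/cvgrPdist_le => e e0.
have K1 : 0 < `|K| + 1 by rewrite ltr_wpDl.
near=> y; apply: le_trans (lf _ _) _.
apply: (@le_trans _ _ ((`|K| + 1) * `|x - y|)).
  by rewrite ler_wpM2r// (le_trans (ler_norm _))// lerDl.
rewrite mulrC -ler_pdivlMr//.
near: y; apply: (@cvgr_dist_le _ _ _ (nbhs x) _ id x) => //.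
by rewrite divr_gt0.
Unshelve. all: by end_near. Qed.

Definition oscI f (M u th : R) : R :=
  \int[mu]_(x in `[- M, M]) (cos (u * x + th) * f x).

Lemma measurable_cosP D u th : measurable D -> measurable_fun D (fun x => cos (u * x + th)).
Proof.
move=> mD; apply: (@measurable_funS _ _ _ _ [set: R]) => //.
by apply: continuous_measurable_fun; exact: continuous_cos_phase.
Qed.

Lemma cos_norm x : `|cos x| <= 1.
Proof. by rewrite ler_norml cos_geN1 cos_le1. Qed.

Lemma integrable_cosM D f u th : measurable D -> mu.-integrable D (EFin \o f) ->
  mu.-integrable D (EFin \o (fun x => cos (u * x + th) * f x)).
Proof.
move=> mD i_f; apply: (integrable_le mD _ _ (integrable_normr mD i_f)) => /=.
  apply: measurable_funM; first exact: measurable_cosP.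
  by case/integrableP: i_f => /measurable_EFinP.
by move=> x _; rewrite normrM -[leRHS]mul1r ler_wpM2r// cos_norm.
Qed.

(** The cosine is 1-Lipschitz and |x| <= M on the interval. This serves to make truncated transforms
    continuous, hence measurable, in u. *)
Lemma oscI_lip f (M th : R) : 0 <= M -> mu.-integrable `[- M, M] (EFin \o f) ->
  forall u v, `|oscI f M u th - oscI f M v th| <=
    M * (\int[mu]_(x in `[- M, M]) `|f x|) * `|u - v|.
Proof.
move=> M0 i_f u v.
rewrite /oscI -RintegralB//; try exact: integrable_cosM.
have i_n := integrable_normr (measurable_itv _) i_f.
rewrite mulrAC -RintegralZl//.
apply: norm_Rintegral_le => //.
- have m_f : measurable_fun (`[- M, M] : set R) f by case/integrableP: i_f => /measurable_EFinP.
  by apply: measurable_funB; apply: measurable_funM => //; exact: measurable_cosP.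
- move=> x; rewrite /= in_itv/= => /andP[x1 x2]; rewrite -mulrBl normrM ler_wpM2r//.
  apply: le_trans (cos_lip _ _) _.
  have -> : u * x + th - (v * x + th) = x * (u - v) by ring.
  by rewrite normrM ler_wpM2r// ler_norml x1.
- exact: integrable_mulrl.
Qed.

Lemma oscI_continuous f (M th : R) : 0 <= M -> mu.-integrable `[- M, M] (EFin \o f) ->
  continuous (oscI f M ^~ th).
Proof. by move=> M0 i_f; apply: lip_continuous; exact: oscI_lip. Qed.

(** On a set of finite measure |f| <= f^2 + 1 gives an integrable majorant. *)
Lemma integrable_sqr D f : measurable D -> (mu D < +oo)%E -> measurable_fun D f ->
  (\int[mu]_(x in D) (f x ^+ 2)%:E < +oo)%E -> mu.-integrable D (EFin \o f).
Proof.
move=> mD Doo mf f2.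
have i2 : mu.-integrable D (EFin \o (fun x => f x ^+ 2)).
  apply/integrableP; split; first by apply/measurable_EFinP; exact: measurable_funX.
  under eq_integral => x _ do rewrite /= ger0_norm ?sqr_ge0//.
  exact: f2.
have i1 : mu.-integrable D (EFin \o (fun=> 1)).
  apply/integrableP; split; first by apply/measurable_EFinP; exact: measurable_cst.
  under eq_integral => x _ do rewrite /= normr1.
  by rewrite integral_cst// mul1e.
apply: (integrable_le mD mf _ (integrable_addr mD i1 i2)) => x _.
have := sqr_ge0 (`|f x| - 1); rewrite -(real_normK (num_real (f x))); have := normr_ge0 (f x); nra.
Qed.

(* Chebyshev on the sets where all late terms stay at distance [1 / j.+1]. *)
Lemma cvg_L2_ae (F : nat -> R -> R) (G : R -> R) :
  (forall n, measurable_fun [set: R] (F n)) -> measurable_fun [set: R] G ->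
  (\int[mu]_x ((F n x - G x) ^+ 2)%:E)%E @[n --> \oo] --> 0%E ->
  \forall x \ae mu, forall j : nat, exists2 n, (j <= n)%N & (F n x - G x) ^+ 2 < j.+1%:R^-1.
Proof.
move=> mF mG FG; apply: ae_foralln => j.
have mFG n : measurable_fun [set: R] (fun x => (F n x - G x) ^+ 2).
  by apply: measurable_funX; exact: measurable_funB.
have mFG' n : measurable_fun [set: R] (fun x => ((F n x - G x) ^+ 2)%:E).
  exact/measurable_EFinP.
pose S := \bigcap_(n in [set n | (j <= n)%N]) [set x | j.+1%:R^-1 <= (F n x - G x) ^+ 2].
have mS n : measurable [set x : R | j.+1%:R^-1 <= (F n x - G x) ^+ 2].
  rewrite -[X in measurable X]setTI.
  apply: (@measurable_fun_le _ _ _ _ (cst _) (fun x => (F n x - G x) ^+ 2)) => //.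
have {}mS : measurable S.
  apply: bigcap_measurable => //; by exists j => /=.
exists S; split => //; last first.
  move=> x /= Hx n /= jn; rewrite leNgt; apply/negP => h; apply: Hx; by exists n.
apply/eqP; rewrite -measure_le0 leNgt; apply/negP => S0.
have c0 : (0 < j.+1%:R^-1%:E * mu S)%E by rewrite mule_gt0.
have le n : (j <= n)%N -> (j.+1%:R^-1%:E * mu S <= \int[mu]_x ((F n x - G x) ^+ 2)%:E)%E.
  move=> jn; rewrite -integral_cst//.
  apply: (@le_trans _ _ (\int[mu]_(x in S) ((F n x - G x) ^+ 2)%:E)%E).
    apply: ge0_le_integral => //.
    - by move=> x _; rewrite lee_fin.
    - by apply: measurable_funTS; exact: mFG'.
    - by move=> x Sx; rewrite lee_fin; exact: Sx.
  apply: ge0_subset_integral => //; first exact: mFG'.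
  by move=> x _; rewrite lee_fin sqr_ge0.
have : (j.+1%:R^-1%:E * mu S <= 0)%E.
  rewrite -(cvg_lim _ FG)//; apply: lime_ge; first by apply/cvg_ex; exists 0%E.
  by exists j => // n /= jn; exact: le.
by rewrite leNgt c0.
Qed.

End RealLemmas.

Section FourierParts.
Variable R : realType.
Notation mu := (@lebesgue_measure R).
Implicit Types (h H : R -> R[i]) (u : R).

Lemma normc_sqr (z : R[i]) : normc z ^+ 2 = complex.Re z ^+ 2 + complex.Im z ^+ 2.
Proof. by case: z => a b /=; rewrite sqr_sqrtr// addr_ge0// sqr_ge0. Qed.

Lemma normc_ge0 (z : R[i]) : 0 <= normc z.
Proof. by case: z => a b; rewrite sqrtr_ge0. Qed.

Lemma normc_le_sum (z : R[i]) : normc z <= `|complex.Re z| + `|complex.Im z|.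
Proof.
rewrite -(@ler_pXn2r _ 2)// ?nnegrE ?normc_ge0 ?addr_ge0//.
rewrite normc_sqr sqrrD !real_normK ?num_real//.
by rewrite addrAC lerDl mulrn_wge0// mulr_ge0.
Qed.

Lemma sqr_Re_le h x : complex.Re (h x) ^+ 2 <= normc (h x) ^+ 2.
Proof. by rewrite normc_sqr lerDl sqr_ge0. Qed.

Lemma sqr_Im_le h x : complex.Im (h x) ^+ 2 <= normc (h x) ^+ 2.
Proof. by rewrite normc_sqr lerDr sqr_ge0. Qed.

Lemma measurable_normc2 h : measurable_fun [set: R] (fun x => complex.Re (h x)) ->
  measurable_fun [set: R] (fun x => complex.Im (h x)) ->
  measurable_fun [set: R] (fun x => (normc (h x) ^+ 2)%:E).
Proof.
move=> m1 m2; apply/measurable_EFinP.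
rewrite (_ : (fun x => _) = fun x => complex.Re (h x) ^+ 2 + complex.Im (h x) ^+ 2).
  by apply: measurable_funD; exact: measurable_funX.
by apply/funext => x; rewrite normc_sqr.
Qed.

Lemma integral_sqr_le (f : R -> R) h : measurable_fun [set: R] f ->
  measurable_fun [set: R] (fun x => complex.Re (h x)) ->
  measurable_fun [set: R] (fun x => complex.Im (h x)) ->
  (forall x, f x ^+ 2 <= normc (h x) ^+ 2) ->
  (\int[mu]_x (f x ^+ 2)%:E <= L2norm2 h)%E.
Proof.
move=> mf m1 m2 fh; apply: ge0_le_integral => //.
- by move=> x _; rewrite lee_fin sqr_ge0.
- by apply/measurable_EFinP; exact: measurable_funX.
- exact: measurable_normc2.
- by move=> x _; rewrite lee_fin.
Qed.

Lemma L2_sqr_lty (f : R -> R) h : measurable_fun [set: R] f -> L2 h ->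
  (forall x, f x ^+ 2 <= normc (h x) ^+ 2) ->
  (\int[mu]_x (f x ^+ 2)%:E < +oo)%E.
Proof.
by move=> mf [m1 m2 hoo] fh; apply: le_lt_trans hoo; exact: integral_sqr_le.
Qed.

Lemma L2_integrable (f : R -> R) (s t : R) : measurable_fun [set: R] f ->
  (\int[mu]_x (f x ^+ 2)%:E < +oo)%E -> mu.-integrable `[s, t] (EFin \o f).
Proof.
move=> mf foo; apply: integrable_sqr => //.
- by rewrite lebesgue_measure_itv/=; case: ifP => _; rewrite ?ltry// -EFinB ltry.
- exact: measurable_funTS.
- apply: le_lt_trans foo; apply: ge0_subset_integral => //.
    by apply/measurable_EFinP; exact: measurable_funX.
  by move=> x _; rewrite lee_fin sqr_ge0.
Qed.

Lemma L2_Re_itv h (s t : R) : L2 h ->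
  mu.-integrable `[s, t] (EFin \o (fun x => complex.Re (h x))).
Proof.
move=> hL; have [m1 _ _] := hL; apply: L2_integrable => //.
by apply: (L2_sqr_lty m1 hL) => x; exact: sqr_Re_le.
Qed.

Lemma L2_Im_itv h (s t : R) : L2 h ->
  mu.-integrable `[s, t] (EFin \o (fun x => complex.Im (h x))).
Proof.
move=> hL; have [_ m1 _] := hL; apply: L2_integrable => //.
by apply: (L2_sqr_lty m1 hL) => x; exact: sqr_Im_le.
Qed.

(** The real part of the truncated transform of a + ib, the sine being a cosine with phase -pi/2.
    The imaginary part is the real part for -i(a + ib) = b - ia, so this single form covers both. *)
Definition fourier_Re (a b : R -> R) (n : nat) u : R :=
  oscI a n%:R u 0 + oscI b n%:R u (- (pi / 2)).

Lemma cosNpi2 (y : R) : cos (y - pi / 2) = sin y.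
Proof. by rewrite cosB cos_pihalf sin_pihalf mulr0 add0r mulr1. Qed.

Lemma Re_fourier_part h n u : L2 h -> complex.Re (fourier_part h n u) =
  fourier_Re (fun x => complex.Re (h x)) (fun x => complex.Im (h x)) n u.
Proof.
move=> hL; rewrite /fourier_Re /oscI -RintegralD//; last 2 first.
- by apply: integrable_cosM => //; exact: L2_Re_itv.
- by apply: integrable_cosM => //; exact: L2_Im_itv.
rewrite /fourier_part /cRintegral /=; apply: eq_Rintegral => x _.
rewrite cosNpi2 addr0; case: (h x) => a b /=.
by rewrite cosN sinN; ring.
Qed.

Lemma Im_fourier_part h n u : L2 h -> complex.Im (fourier_part h n u) =
  fourier_Re (fun x => complex.Im (h x)) (fun x => - complex.Re (h x)) n u.
Proof.
move=> hL; rewrite /fourier_Re /oscI -RintegralD//; last 2 first.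
- by apply: integrable_cosM => //; exact: L2_Im_itv.
- apply: integrable_cosM => //.
  rewrite (_ : _ \o _ = EFin \o (fun x => -1 * complex.Re (h x))).
    by apply: integrable_mulrl => //; exact: L2_Re_itv.
  by apply/funext => x /=; rewrite mulN1r.
rewrite /fourier_part /cRintegral /=; apply: eq_Rintegral => x _.
rewrite cosNpi2 addr0; case: (h x) => a b /=.
by rewrite cosN sinN; ring.
Qed.

Lemma continuous_fourier_Re (a b : R -> R) n :
  mu.-integrable `[- n%:R, n%:R] (EFin \o a) ->
  mu.-integrable `[- n%:R, n%:R] (EFin \o b) -> continuous (fourier_Re a b n).
Proof.
by move=> ia ib u; apply: cvgD; apply: oscI_continuous.
Qed.

Lemma measurable_fourier_part h n : L2 h ->
  measurable_fun [set: R] (fun u => complex.Re (fourier_part h n u)) /\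
  measurable_fun [set: R] (fun u => complex.Im (fourier_part h n u)).
Proof.
move=> hL; split.
- rewrite (_ : (fun u => _) = fourier_Re (fun x => complex.Re (h x)) (fun x => complex.Im (h x)) n); last first.
    by apply/funext => u; exact: Re_fourier_part.
  apply: continuous_measurable_fun; apply: continuous_fourier_Re; first exact: L2_Re_itv.
  exact: L2_Im_itv.
- rewrite (_ : (fun u => _) = fourier_Re (fun x => complex.Im (h x)) (fun x => - complex.Re (h x)) n); last first.
    by apply/funext => u; exact: Im_fourier_part.
  apply: continuous_measurable_fun; apply: continuous_fourier_Re; first exact: L2_Im_itv.
  rewrite (_ : _ \o _ = EFin \o (fun x => -1 * complex.Re (h x))).
    by apply: integrable_mulrl => //; exact: L2_Re_itv.
  by apply/funext => x /=; rewrite mulN1r.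
Qed.

Lemma fourier_cvg_Re h H : is_fourier h H ->
  (\int[mu]_u ((complex.Re (fourier_part h n u) - complex.Re (H u)) ^+ 2)%:E)%E
    @[n --> \oo] --> 0%E.
Proof.
move=> [hL [mH1 mH2 _] cv]; apply: squeeze_cvge cv.
  apply: nearW => n; apply/andP; split.
    by apply: integral_ge0 => u _; rewrite lee_fin sqr_ge0.
  have [m1 m2] := measurable_fourier_part n hL.
  apply: integral_sqr_le.
  - exact: measurable_funB.
  - by under eq_fun do rewrite raddfB; exact: measurable_funB.
  - by under eq_fun do rewrite raddfB; exact: measurable_funB.
  - by move=> u; rewrite -raddfB; exact: (sqr_Re_le (fun u => fourier_part h n u - H u)).
exact: cvg_cst.
Qed.

Lemma fourier_cvg_Im h H : is_fourier h H ->
  (\int[mu]_u ((complex.Im (fourier_part h n u) - complex.Im (H u)) ^+ 2)%:E)%E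
    @[n --> \oo] --> 0%E.
Proof.
move=> [hL [mH1 mH2 _] cv]; apply: squeeze_cvge cv.
  apply: nearW => n; apply/andP; split.
    by apply: integral_ge0 => u _; rewrite lee_fin sqr_ge0.
  have [m1 m2] := measurable_fourier_part n hL.
  apply: integral_sqr_le.
  - exact: measurable_funB.
  - by under eq_fun do rewrite raddfB; exact: measurable_funB.
  - by under eq_fun do rewrite raddfB; exact: measurable_funB.
  - by move=> u; rewrite -raddfB; exact: (sqr_Im_le (fun u => fourier_part h n u - H u)).
exact: cvg_cst.
Qed.

End FourierParts.

(** * Almost everywhere decay of the transforms of the Hermite functions *)

Section HermiteDecay.
Variable R : realType.
Notation mu := (@lebesgue_measure R).
Implicit Types (u M th : R).

(** The factor 1 + |u| buys a Lipschitz inverse transform; the factor 1 + u^2 matches the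
    integrability condition on m. *)
Definition cubic_weight u : R := (1 + `|u|) * (1 + u ^+ 2).

Lemma cubic_weight_ge1 u : 1 <= cubic_weight u.
Proof.
rewrite /cubic_weight -[leLHS]mulr1; apply: ler_pM => //; first by rewrite lerDl.
by rewrite lerDl sqr_ge0.
Qed.

Lemma cubic_weightE u : cubic_weight u = 1 + `|u| + `|u| ^+ 2 + `|u| ^+ 3.
Proof. by rewrite /cubic_weight -(real_normK (num_real u)); ring. Qed.

(** The weight expands into |u|^k for k = 0, ..., 3; the four instances of [osc_decay] are added,
    with the sum of the four bases as common base. *)
Lemma osc_cubic_weight : exists C A : R, [/\ 0 <= C, 1 <= A & forall n M u th, 0 < M ->
  cubic_weight u * `|osc n M u th| <= C * A ^+ n * (1 + cubic_weight u * expR (- (M ^+ 2 / 4)))].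
Proof.
have [C0 [A0 [C0p A0p H0]]] := @osc_decay R 0.
have [C1 [A1 [C1p A1p H1]]] := @osc_decay R 1.
have [C2 [A2 [C2p A2p H2]]] := @osc_decay R 2.
have [C3 [A3 [C3p A3p H3]]] := @osc_decay R 3.
exists (C0 + C1 + C2 + C3), (A0 + A1 + A2 + A3); split; try lra.
move=> n M u th M0.
move: (H0 n M u th M0) (H1 n M u th M0) (H2 n M u th M0) (H3 n M u th M0).
set e := expR _; have e0 : 0 <= e by exact: expR_ge0.
set A := (A0 + A1 + A2 + A3); set J := `|osc _ _ _ _|.
have a0 : 0 <= `|u| by [].
have b0 : 0 <= `|u| ^+ 2 by rewrite exprn_ge0.
have c0 : 0 <= `|u| ^+ 3 by rewrite exprn_ge0.
have gen (C' A' x : R) : 0 <= C' -> 1 <= A' -> A' <= A -> 0 <= x -> x <= cubic_weight u ->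
    C' * A' ^+ n * (1 + x * e) <= C' * A ^+ n * (1 + cubic_weight u * e).
  move=> C'0 A'1 A'A x0 xw; apply: ler_pM.
  - by rewrite mulr_ge0// exprn_ge0//; lra.
  - by rewrite addr_ge0// mulr_ge0.
  - by rewrite ler_wpM2l// lerXn2r// nnegrE; lra.
  - by rewrite lerD2l ler_wpM2r.
rewrite expr0 expr1 => h0 h1 h2 h3.
have W := cubic_weightE u.
have k0 := gen C0 A0 1 C0p A0p ltac:(rewrite /A; lra) ler01 (cubic_weight_ge1 u).
have k1 := gen C1 A1 `|u| C1p A1p ltac:(rewrite /A; lra) a0 ltac:(lra).
have k2 := gen C2 A2 (`|u| ^+ 2) C2p A2p ltac:(rewrite /A; lra) b0 ltac:(lra).
have k3 := gen C3 A3 (`|u| ^+ 3) C3p A3p ltac:(rewrite /A; lra) c0 ltac:(lra).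
rewrite [in leLHS]W; move: (le_trans h0 k0) (le_trans h1 k1) (le_trans h2 k2) (le_trans h3 k3).
by move: (A ^+ n) (1 + cubic_weight u * e) => X Y; lra.
Qed.

Lemma limit_bound (F : nat -> R) (G B w : R) : 0 < w -> 0 <= B ->
  (forall j : nat, exists2 n, (j <= n)%N & (F n - G) ^+ 2 < j.+1%:R^-1) ->
  (forall n, (0 < n)%N -> w * `|F n| <= B * (1 + w * expR (- (n%:R ^+ 2 / 4)))) ->
  w * `|G| <= B.
Proof.
move=> w0 B0 FG FB; apply/ler_addgt0Pr => e e0.
(* An index above 4 w^2 / e^2 puts w |F n - G| below e/2; an index above 8 B w / e does the same for
   the boundary error, as exp(-n^2/4) <= 4/n. The successor in [j] also ensures n > 0. *)
pose X := 8 * B * w / e + 4 * w ^+ 2 / e ^+ 2.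
have X0 : 0 <= X by rewrite addr_ge0// divr_ge0 ?mulr_ge0 ?exprn_ge0// ltW.
pose j := (Num.truncn X).+1.
have Xj : X <= j%:R by apply: ltW; exact: truncnS_gt.
have [n jn nj] := FG j.
have jn' : j%:R <= n%:R :> R by rewrite ler_nat.
have j1 : 1 <= j%:R :> R by rewrite ler1n.
have n0 : (0 < n)%N by apply: leq_trans jn.
have h1 : w * `|F n - G| <= e / 2.
  rewrite -(@ler_pXn2r _ 2)// ?nnegrE ?mulr_ge0 ?divr_ge0//; try exact: ltW.
  rewrite exprMn real_normK ?num_real// (le_trans (ler_wpM2l _ (ltW nj))) ?sqr_ge0//.
  rewrite ler_pdivrMr// (_ : (e / 2) ^+ 2 = e ^+ 2 / 4); last by field.
  have : 4 * w ^+ 2 / e ^+ 2 <= j%:R.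
    by apply: le_trans Xj; rewrite lerDr divr_ge0 ?mulr_ge0// ltW.
  rewrite ler_pdivrMr ?exprn_gt0// => h.
  have : 0 < e ^+ 2 by rewrite exprn_gt0.
  have -> : j.+1%:R = j%:R + 1 :> R by rewrite natr1.
  by move: (j%:R) h => J h p; move: (e ^+ 2) h p => Y h p; lra.
have h2 : B * w * expR (- (n%:R ^+ 2 / 4)) <= e / 2.
  have n1 : 1 <= n%:R :> R by lra.
  have n2 : n%:R <= n%:R ^+ 2 :> R by rewrite expr2 ler_peMr// ler0n.
  apply: (@le_trans _ _ (B * w * (4 / n%:R))).
    apply: ler_wpM2l; first by rewrite mulr_ge0// ltW.
    apply: le_trans (expRN_le _) _; first by rewrite divr_ge0// sqr_ge0.
    have p1 : 0 < 1 + n%:R ^+ 2 / 4 :> R by lra.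
    have p2 : 0 < n%:R :> R by lra.
    by rewrite ler_pdivlMr// mulrC ler_pdivrMr//; lra.
  rewrite mulrA ler_pdivrMr; last lra.
  have : 8 * B * w / e <= n%:R.
    by apply: le_trans jn'; apply: le_trans Xj; rewrite lerDl divr_ge0 ?mulr_ge0 ?sqr_ge0// ltW.
  by rewrite ler_pdivrMr//; lra.
have h3 := FB n n0.
have h4 : w * `|G| <= w * `|F n| + w * `|F n - G|.
  rewrite -mulrDr; apply: ler_wpM2l; first exact: ltW.
  by have := ler_normB (F n) (F n - G); rewrite opprB addrC subrK.
by move: h3; rewrite mulrDr mulr1 mulrA; lra.
Qed.

Lemma oscI0 (M u th : R) : oscI (fun=> 0) M u th = 0.
Proof.
rewrite /oscI (_ : (fun x => _) = fun=> 0); last by apply/funext => x; rewrite mulr0.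
by rewrite /Rintegral integral0.
Qed.

(** A bound on truncated integrals with vanishing error passes to any L_2 limit almost everywhere,
    by [cvg_L2_ae] and [limit_bound]. The constants are chosen before n and before the
    representative H. *)
Lemma hermite_fourier_decay : exists C A : R, [/\ 0 <= C, 1 <= A &
  forall n (H : R -> R[i]), is_fourier (fun x => (hermite n x)%:C) H ->
  \forall u \ae mu, cubic_weight u * `|complex.Re (H u)| <= C * A ^+ n /\
                    cubic_weight u * `|complex.Im (H u)| <= C * A ^+ n].
Proof.
have [C [A [C0 A1 HO]]] := osc_cubic_weight.
exists C, A; split => // n H FH.
have [hL [mH1 mH2 _] _] := FH.
have B0 : 0 <= C * A ^+ n by rewrite mulr_ge0// exprn_ge0//; lra.
have E1 := cvg_L2_ae (fun j => (measurable_fourier_part j hL).1) mH1 (fourier_cvg_Re FH).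
have E2 := cvg_L2_ae (fun j => (measurable_fourier_part j hL).2) mH2 (fourier_cvg_Im FH).
have w0 u : 0 < cubic_weight u by apply: lt_le_trans (cubic_weight_ge1 u).
apply: (@filterS2 _ _ (ae_filter_ringOfSetsType mu) _ _ _ _ E1 E2) => u e1 e2; split.
- apply: (@limit_bound (fun N => complex.Re (fourier_part (fun x => (hermite n x)%:C) N u))) => //.
  move=> N N0; rewrite Re_fourier_part// /fourier_Re /= oscI0 addr0.
  by apply: HO; rewrite ltr0n.
- apply: (@limit_bound (fun N => complex.Im (fourier_part (fun x => (hermite n x)%:C) N u))) => //.
  move=> N N0; rewrite Im_fourier_part// /fourier_Re /= oscI0 add0r.
  have -> : oscI (fun x => - hermite n x) N%:R u (- (pi / 2)) = - osc n N%:R u (- (pi / 2)).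
    rewrite -[RHS]mulN1r /osc -RintegralZl//; last exact: integrable_osc.
    by apply: eq_Rintegral => x _; rewrite mulrN mulN1r.
  by rewrite normrN; apply: HO; rewrite ltr0n.
Qed.

End HermiteDecay.

(** * Fubini for bounded weights and the Poisson kernel *)

Section Fubini.
Variable R : realType.
Notation mu := (@lebesgue_measure R).
Local Notation T := (measurableTypeR R).
Implicit Types (k al : R -> R) (w : R -> R -> R).

(** Since |w| <= 1, the product |k(u)| |al(x)| dominates, and Tonelli makes the double integral
    finite. The weight will be a phase cosine or a normalised Poisson kernel. *)
Lemma Fubini_weighted_setT k al w :
  mu.-integrable [set: R] (EFin \o k) -> mu.-integrable [set: R] (EFin \o al) ->
  measurable_fun [set: T * T] (fun z => w z.1 z.2) ->
  (forall x y, `|w x y| <= 1) ->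
  mu.-integrable [set: R] (EFin \o (fun u => k u * \int[mu]_x (w u x * al x))) /\
  \int[mu]_u (k u * \int[mu]_x (w u x * al x)) =
  \int[mu]_x (al x * \int[mu]_u (w u x * k u)).
Proof.
move=> ik ia mw w1.
have mk : measurable_fun [set: R] k by case/integrableP: ik => /measurable_EFinP.
have ma : measurable_fun [set: R] al by case/integrableP: ia => /measurable_EFinP.
pose f (z : T * T) : R := k z.1 * (w z.1 z.2 * al z.2).
have mf : measurable_fun [set: T * T] (EFin \o f).
  apply/measurable_EFinP; apply: measurable_funM; first exact: measurableT_comp.
  by apply: measurable_funM => //; exact: measurableT_comp.
have mw1 u : measurable_fun [set: R] (w u).
  have := measurableT_comp mw (measurable_pair1 u); exact.
have mw2 x : measurable_fun [set: R] (w ^~ x).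
  have := measurableT_comp mw (measurable_pair2 x); exact.
have iw1 u : mu.-integrable [set: R] (EFin \o (fun x => w u x * al x)).
  apply: (integrable_le measurableT _ _ (integrable_normr measurableT ia)) => /=.
    exact: measurable_funM.
  by move=> x _; rewrite normrM -[leRHS]mul1r ler_wpM2r.
have iw2 x : mu.-integrable [set: R] (EFin \o (fun u => w u x * k u)).
  apply: (integrable_le measurableT _ _ (integrable_normr measurableT ik)) => /=.
    exact: measurable_funM.
  by move=> u _; rewrite normrM -[leRHS]mul1r ler_wpM2r.
have If : ((mu \x mu)%E).-integrable [set: T * T] (EFin \o f).
  apply/integrable12ltyP => //.
  apply: (@le_lt_trans _ _ (\int[mu]_u (`|k u| * \int[mu]_x `|al x|)%:E)%E).
    apply: ge0_le_integral => //.
    - by move=> u _; apply: integral_ge0.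
    - apply: (@measurable_fun_fubini_tonelli_F _ _ T T R mu (fun z => `|(f z)%:E|%E)) => //.
      exact: measurableT_comp.
    - by apply/measurable_EFinP; apply: measurable_funM => //; exact: measurableT_comp.
    - move=> u _; rewrite EFinM fineK; last first.
        exact: (integrable_fin_num measurableT (integrable_normr measurableT ia)).
      rewrite -integralZl//; last exact: (integrable_normr measurableT ia).
      apply: ge0_le_integral => //.
      + by apply: measurableT_comp => //; exact: (measurableT_comp mf (measurable_pair1 u)).
      + apply/measurable_EFinP; apply: measurable_funM => //; exact: measurableT_comp.
      + move=> x _; rewrite /= lee_fin /f /= normrM ler_wpM2l// normrM.
        by rewrite -[leRHS]mul1r ler_wpM2r.
  have : mu.-integrable [set: R] (EFin \o (fun u => `|k u| * \int[mu]_x `|al x|)).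
    rewrite (_ : (fun u => _) = fun u => (\int[mu]_x `|al x|) * `|k u|).
      by apply: integrable_mulrl => //; exact: integrable_normr.
    by apply/funext => u; rewrite mulrC.
  case/integrableP => _; under eq_integral => u _ do
    rewrite /= ger0_norm ?mulr_ge0 ?Rintegral_ge0//.
  by [].
have E1 u : ((k u * \int[mu]_x (w u x * al x))%:E = \int[mu]_x (f (u, x))%:E)%E.
  rewrite EFinM fineK; last exact: (integrable_fin_num measurableT (iw1 u)).
  by rewrite -integralZl//; exact: iw1.
have E2 x : ((al x * \int[mu]_u (w u x * k u))%:E = \int[mu]_u (f (u, x))%:E)%E.
  rewrite EFinM fineK; last exact: (integrable_fin_num measurableT (iw2 x)).
  rewrite -integralZl//; last exact: iw2.
  by apply: eq_integral => u _; rewrite /f /= -EFinM; congr EFin; ring.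
split.
  rewrite (_ : EFin \o _ = fun u => \int[mu]_x (f (u, x))%:E)%E; last exact/funext.
  exact: (integrable_fubini_F If).
rewrite /Rintegral; congr fine.
under eq_integral => u _ do rewrite E1.
under [in RHS]eq_integral => x _ do rewrite E2.
exact: (Fubini If).
Qed.

Lemma integrable_patch (D : set R) k : measurable D ->
  mu.-integrable D (EFin \o k) -> mu.-integrable [set: R] (EFin \o (k \_ D)).
Proof.
move=> mD ik; rewrite -restrict_EFin.
by apply: (@integrable_mkcond _ _ _ mu D (EFin \o k) mD).1.
Qed.

Lemma Fubini_weighted (D1 D2 : set R) k al w : measurable D1 -> measurable D2 ->
  mu.-integrable D1 (EFin \o k) -> mu.-integrable D2 (EFin \o al) ->
  measurable_fun [set: T * T] (fun z => w z.1 z.2) ->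
  (forall x y, `|w x y| <= 1) ->
  mu.-integrable D1 (EFin \o (fun u => k u * \int[mu]_(x in D2) (w u x * al x))) /\
  \int[mu]_(u in D1) (k u * \int[mu]_(x in D2) (w u x * al x)) =
  \int[mu]_(x in D2) (al x * \int[mu]_(u in D1) (w u x * k u)).
Proof.
move=> mD1 mD2 ik ia mw w1.
have [] := Fubini_weighted_setT (integrable_patch mD1 ik) (integrable_patch mD2 ia) mw w1.
have P (D : set R) (g h : R -> R) : (fun x => g x * (h \_ D) x) = (fun x => g x * h x) \_ D.
  by apply/funext => x; rewrite /patch; case: ifP => // _; rewrite mulr0.
have Q (D : set R) (g h : R -> R) : (fun x => (h \_ D) x * g x) = (fun x => h x * g x) \_ D.
  by apply/funext => x; rewrite /patch; case: ifP => // _; rewrite mul0r.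
have E1 u : \int[mu]_x (w u x * (al \_ D2) x) = \int[mu]_(x in D2) (w u x * al x).
  by rewrite [RHS]Rintegral_mkcond P.
have E2 x : \int[mu]_u (w u x * (k \_ D1) u) = \int[mu]_(u in D1) (w u x * k u).
  by rewrite [RHS]Rintegral_mkcond P.
under [fun u => _]eq_fun => u do rewrite E1.
rewrite Q -restrict_EFin => /(@integrable_mkcond _ _ _ mu D1 _ mD1).2 I1 I2; split; first exact: I1.
rewrite [LHS]Rintegral_mkcond I2 [RHS]Rintegral_mkcond -Q.
by apply: eq_Rintegral => x _; rewrite E2.
Qed.

End Fubini.

(** * The Poisson kernel as a damped cosine integral *)

Section Poisson.
Variable R : realType.
Notation mu := (@lebesgue_measure R).
Variable ep : R.
Hypothesis ep0 : 0 < ep.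
Implicit Types (u x y z : R).

Definition pden z : R := ep ^+ 2 + z ^+ 2.
Lemma pden_gt0 z : 0 < pden z. Proof. by rewrite ltr_wpDr ?sqr_ge0 ?exprn_gt0. Qed.

Lemma continuous_expNabs : continuous (fun u => expR (- (ep * `|u|))).
Proof.
move=> u; apply: continuous_comp; last exact: continuous_expR.
by apply: cvgN; apply: cvgMr; exact: norm_continuous.
Qed.

(** The summand 1 makes the integrand nonnegative, so that the fundamental theorem applies on the
    whole half line; it is subtracted again in [Rintegral_cosP]. The antiderivative F is the damping
    times a function B bounded by C, so it tends to 0. *)
Lemma half_line_cosP z :
  (\int[mu]_(u in `[0%R, +oo[) ((1 + cos (z * u)) * expR (- (ep * u)))%:E =
   (ep^-1 + ep / pden z)%:E)%E.
Proof.
have e0 : ep != 0 by rewrite gt_eqF.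
have d0 : pden z != 0 by rewrite gt_eqF// pden_gt0.
pose B u : R := - ep^-1 + (z * sin (z * u) - ep * cos (z * u)) / pden z.
pose F u : R := expR (- (ep * u)) * B u.
pose C : R := ep^-1 + (`|z| + ep) / pden z.
have ep1 : 0 <= ep by exact: ltW.
have d1 : 0 <= pden z by apply: ltW; exact: pden_gt0.
have C0 : 0 <= C.
  by apply: addr_ge0; [rewrite invr_ge0|rewrite divr_ge0// addr_ge0].
have BC u : `|B u| <= C.
  rewrite /B (le_trans (ler_normD _ _))// normrN gtr0_norm ?invr_gt0// lerD2l.
  rewrite normrM (gtr0_norm (x := (pden z)^-1)) ?invr_gt0 ?pden_gt0// ler_wpM2r ?invr_ge0//.
  apply: le_trans (ler_normB _ _) _; apply: lerD.
    by rewrite normrM -[leRHS]mulr1 ler_wpM2l// ler_norml sin_geN1 sin_le1.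
  by rewrite normrM (gtr0_norm ep0) -[leRHS]mulr1; apply: ler_wpM2l => //; exact: cos_norm.
have dF u : is_derive u 1 F ((1 + cos (z * u)) * expR (- (ep * u))).
  have E : F = (expR \o (fun u => - (ep * u))) *
     (cst (- ep^-1) + (cst z * (fun u => sin (z * u + 0)) -
      cst ep * (fun u => cos (z * u + 0))) * cst (pden z)^-1).
    by apply/funext => v; rewrite /F /B !fctE /= addr0.
  rewrite E; apply: is_derive_eq.
  rewrite !fctE /GRing.scale /= /cst !addr0 /pden.
  set c := cos _; set s := sin _; set e := expR _.
  by rewrite /pden in d0; field; rewrite d0 e0.
have cf : continuous (fun u => (1 + cos (z * u)) * expR (- (ep * u))).
  move=> u; apply: cvgM.
    apply: cvgD; first exact: cvg_cst.
    apply: continuous_comp; first by apply: cvgMr; exact: cvg_id.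
    exact: continuous_cos.
  apply: continuous_comp; last exact: continuous_expR.
  by apply: cvgN; apply: cvgMr; exact: cvg_id.
have DF u : derivable F u 1 by have [] := dF u.
have cF : continuous F by exact: derivable_continuous.
rewrite (@ge0_continuous_FTC2y R _ F 0 0).
- congr (_ %:E); rewrite /F /B !mulr0 oppr0 expR0 sin0 cos0; field.
  by rewrite d0.
- move=> u _; have h := cos_geN1 (z * u).
  by apply: mulr_ge0; [lra|exact: expR_ge0].
- exact: continuous_subspaceT.
- apply/cvgrPdist_le => e e1; near=> u.
  have u0 : 0 < u by near: u; apply: nbhs_pinfty_gt; rewrite num_real.
  rewrite sub0r normrN /F normrM (ger0_norm (expR_ge0 _)).
  apply: (@le_trans _ _ ((ep * u)^-1 * C)).
    apply: ler_pM => //.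
    apply: le_trans (expRN_le _) _; first by rewrite mulr_ge0// ltW.
    by rewrite lef_pV2 ?posrE ?mulr_gt0// ?lerDr// ltr_wpDl// mulr_gt0.
  rewrite mulrC ler_pdivrMr ?mulr_gt0//.
  have : C / (ep * e) <= u by near: u; apply: nbhs_pinfty_ge; rewrite num_real.
  by rewrite ler_pdivrMr ?mulr_gt0// (_ : u * (ep * e) = e * (ep * u)); [|ring].
- by move=> u _; exact: DF.
- by apply: cvg_at_right_filter; exact: cF.
- by move=> u _; rewrite derive1E; have [_ ->] := dF u.
Unshelve. all: by end_near. Qed.

Lemma full_line_cosP z :
  (\int[mu]_u ((1 + cos (z * u)) * expR (- (ep * `|u|)))%:E =
   (2 * (ep^-1 + ep / pden z))%:E)%E.
Proof.
rewrite ge0_symfun_integralT.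
- rewrite EFinM -half_line_cosP; congr (_ * _)%E.
  have -> : [set x : R | 0 <= x] = `[0, +oo[%classic.
    by apply/seteqP; split => x /=; rewrite in_itv/= andbT.
  apply: eq_integral => u; rewrite inE/= in_itv/= andbT => u0.
  by rewrite ger0_norm.
- move=> u; have h := cos_geN1 (z * u).
  by apply: mulr_ge0; [lra|exact: expR_ge0].
- move=> u; apply: cvgM; last exact: continuous_expNabs.
  apply: cvgD; first exact: cvg_cst.
  apply: continuous_comp; first by apply: cvgMr; exact: cvg_id.
  exact: continuous_cos.
- by move=> u /=; rewrite normrN mulrN cosN.
Qed.

Lemma integrable_cosP z :
  mu.-integrable [set: R] (EFin \o (fun u => (1 + cos (z * u)) * expR (- (ep * `|u|)))).
Proof.
apply/integrableP; split.
  apply/measurable_EFinP; apply: continuous_measurable_fun.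
  move=> u; apply: cvgM; last exact: continuous_expNabs.
  apply: cvgD; first exact: cvg_cst.
  apply: continuous_comp; first by apply: cvgMr; exact: cvg_id.
  exact: continuous_cos.
under eq_integral => u _.
  rewrite /= ger0_norm; last first.
    have h := cos_geN1 (z * u).
    by apply: mulr_ge0; [lra|exact: expR_ge0].
  over.
by rewrite full_line_cosP ltry.
Qed.

Lemma integrable_expNabs :
  mu.-integrable [set: R] (EFin \o (fun u => expR (- (ep * `|u|)))).
Proof.
rewrite (_ : (fun u => _) = fun u => 2^-1 * ((1 + cos (0 * u)) * expR (- (ep * `|u|)))).
  by apply: integrable_mulrl => //; exact: integrable_cosP.
by apply/funext => u; rewrite mul0r cos0 mulrA mulVf ?mul1r.
Qed.

Lemma Rintegral_expNabs : \int[mu]_u expR (- (ep * `|u|)) = 2 / ep.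
Proof.
have e0 : ep != 0 by rewrite gt_eqF.
transitivity (\int[mu]_u (2^-1 * ((1 + cos (0 * u)) * expR (- (ep * `|u|))))).
  by apply: eq_Rintegral => u _; rewrite mul0r cos0 mulrA mulVf ?mul1r.
rewrite RintegralZl//; last exact: integrable_cosP.
rewrite /Rintegral full_line_cosP /= /pden expr0n addr0; field.
by rewrite e0.
Qed.

Lemma Rintegral_cosP z :
  \int[mu]_u (cos (z * u) * expR (- (ep * `|u|))) = 2 * ep / pden z.
Proof.
have e0 : ep != 0 by rewrite gt_eqF.
have d0 : pden z != 0 by rewrite gt_eqF// pden_gt0.
transitivity (\int[mu]_u ((1 + cos (z * u)) * expR (- (ep * `|u|)) - expR (- (ep * `|u|)))).
  by apply: eq_Rintegral => u _; rewrite mulrDl mul1r addrAC subrr add0r.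
rewrite RintegralB//; last 2 first.
- exact: integrable_cosP.
- exact: integrable_expNabs.
rewrite Rintegral_expNabs /Rintegral full_line_cosP /=.
by field; rewrite d0 e0.
Qed.

Lemma integral_oppr (f : R -> R) : mu.-integrable [set: R] (EFin \o f) ->
  mu.-integrable [set: R] (EFin \o (fun u => f (- u))) ->
  \int[mu]_u f (- u) = \int[mu]_u f u.
Proof.
move=> i_f i_g; rewrite /Rintegral; congr fine.
rewrite [RHS](@eq_measure_integral _ _ _ _ (pushforward mu (-%R : R -> measurableTypeR R))).
  rewrite integral_pushforward//=.
  - by case/integrableP : i_f.
by move=> A mA _; apply/esym; exact: lebesgue_measureN.
Qed.

Lemma integrable_sinP z :
  mu.-integrable [set: R] (EFin \o (fun u => sin (z * u) * expR (- (ep * `|u|)))).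
Proof.
apply: (integrable_le measurableT _ _ integrable_expNabs).
  apply: continuous_measurable_fun => u; apply: cvgM; last exact: continuous_expNabs.
  apply: continuous_comp; first by apply: cvgMr; exact: cvg_id.
  exact: continuous_sin.
move=> u _; rewrite normrM (ger0_norm (expR_ge0 _)) -[leRHS]mul1r ler_wpM2r ?expR_ge0//.
by rewrite ler_norml sin_geN1 sin_le1.
Qed.

(** The integrand is odd: the reflection u -> -u shows that the integral equals its opposite. *)
Lemma Rintegral_sinP z :
  \int[mu]_u (sin (z * u) * expR (- (ep * `|u|))) = 0.
Proof.
have E : (fun u => sin (z * - u) * expR (- (ep * `|- u|))) =
         (fun u => -1 * (sin (z * u) * expR (- (ep * `|u|)))).
  by apply/funext => u; rewrite mulrN sinN normrN mulN1r mulNr.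
have H := @integral_oppr (fun u => sin (z * u) * expR (- (ep * `|u|))) (integrable_sinP z).
have {}H : \int[mu]_u (-1 * (sin (z * u) * expR (- (ep * `|u|)))) =
    \int[mu]_u (sin (z * u) * expR (- (ep * `|u|))).
  by rewrite -H ?E//; apply: integrable_mulrl => //; exact: integrable_sinP.
by move: H; rewrite RintegralZl//; [lra|exact: integrable_sinP].
Qed.

End Poisson.

(** * Fourier inversion *)

Section Inversion.
Variable R : realType.
Notation mu := (@lebesgue_measure R).
Local Notation T := (measurableTypeR R).
Implicit Types (a b f : R -> R) (M u th x y s t ep : R).

Lemma integrable_oppf D f : measurable D -> mu.-integrable D (EFin \o f) ->
  mu.-integrable D (EFin \o (fun x => - f x)).
Proof.
move=> mD h; rewrite (_ : (fun x => - f x) = fun x => -1 * f x).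
  exact: integrable_mulrl.
by apply/funext => x; rewrite mulN1r.
Qed.

Lemma oscIN f M u th : mu.-integrable `[- M, M] (EFin \o f) ->
  oscI (fun x => - f x) M u th = - oscI f M u th.
Proof.
move=> h; rewrite -[RHS]mulN1r /oscI -RintegralZl//; last exact: integrable_cosM.
by apply: eq_Rintegral => x _; rewrite mulrN mulN1r.
Qed.

Lemma oscI_phase f M u th : mu.-integrable `[- M, M] (EFin \o f) ->
  oscI f M u th = cos th * oscI f M u 0 - sin th * oscI f M u (- (pi / 2)).
Proof.
move=> h; rewrite /oscI -!RintegralZl//; try exact: integrable_cosM.
rewrite -RintegralB//; try by apply: integrable_mulrl => //; exact: integrable_cosM.
apply: eq_Rintegral => x _; rewrite cosNpi2 addr0 cosD; ring.
Qed.

(** The left side is the real part of exp(iuy) times the truncated transform; the exponential is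
    absorbed as a phase -uy, which brings the expression into the range of [poisson_osc]. *)
Lemma fourier_Re_phase a b n u y :
  mu.-integrable `[- n%:R, n%:R] (EFin \o a) ->
  mu.-integrable `[- n%:R, n%:R] (EFin \o b) ->
  fourier_Re a b n u * cos (u * y) - fourier_Re b (fun x => - a x) n u * sin (u * y) =
  oscI a n%:R u (- (u * y)) + oscI b n%:R u (- (u * y) - pi / 2).
Proof.
move=> ia ib; rewrite /fourier_Re oscIN// (oscI_phase _ (- (u * y)) ia).
rewrite (oscI_phase _ (- (u * y) - pi / 2) ib) cosNpi2 sinB cos_pihalf sin_pihalf.
rewrite cosN sinN; ring.
Qed.

Lemma measurable_phase y (c : R) :
  measurable_fun [set: T * T] (fun z : T * T => cos (z.1 * z.2 + (- (z.1 * y) + c))).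
Proof.
have m1 : measurable_fun [set: T * T] (fun z : T * T => (z.1 * z.2 + (- (z.1 * y) + c) : R)).
  apply: measurable_funD; first exact: measurable_funM.
  apply: measurable_funD; last exact: measurable_cst.
  by apply: measurableT_comp => //; apply: measurable_funM => //; exact: measurable_fst.
apply: (measurableT_comp _ m1).
by apply: continuous_measurable_fun; exact: continuous_cos.
Qed.

Lemma poisson_osc ep f M y c : 0 < ep -> mu.-integrable `[- M, M] (EFin \o f) ->
  mu.-integrable [set: R] (EFin \o (fun u => expR (- (ep * `|u|)) * oscI f M u (- (u * y) + c))) /\
  \int[mu]_u (expR (- (ep * `|u|)) * oscI f M u (- (u * y) + c)) =
  \int[mu]_(x in `[- M, M]) (f x *
     \int[mu]_u (cos (u * x + (- (u * y) + c)) * expR (- (ep * `|u|)))).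
Proof.
move=> e0 i_f.
have mI : measurable (`[- M, M]%classic : set R) by exact: measurable_itv.
have := @Fubini_weighted R setT `[- M, M] _ f (fun u x => cos (u * x + (- (u * y) + c)))
  measurableT mI (integrable_expNabs e0) i_f (measurable_phase y c) (fun u x => cos_norm _).
exact.
Qed.

(** After Fubini the inner integral against a is the Poisson kernel, while the one against b is an
    odd sine integral and vanishes. *)
Lemma poisson_fourier ep a b n y : 0 < ep ->
  mu.-integrable `[- n%:R, n%:R] (EFin \o a) ->
  mu.-integrable `[- n%:R, n%:R] (EFin \o b) ->
  let K u := expR (- (ep * `|u|)) * (fourier_Re a b n u * cos (u * y) -
     fourier_Re b (fun x => - a x) n u * sin (u * y)) in
  mu.-integrable [set: R] (EFin \o K) /\
  \int[mu]_u K u = \int[mu]_(x in `[- n%:R, n%:R]) (2 * ep / pden ep (x - y) * a x).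
Proof.
move=> e0 ia ib K.
have [Ia Ea] := poisson_osc y 0 e0 ia.
have [Ib Eb] := poisson_osc y (- (pi / 2)) e0 ib.
have KE : K = fun u => expR (- (ep * `|u|)) * oscI a n%:R u (- (u * y) + 0) +
    expR (- (ep * `|u|)) * oscI b n%:R u (- (u * y) - pi / 2).
  by apply/funext => u; rewrite /K fourier_Re_phase// -mulrDr addr0.
split; first by rewrite KE; exact: integrable_addr.
rewrite KE RintegralD// Ea Eb [X in _ + X](_ : _ = 0) ?addr0.
  apply: eq_Rintegral => x _; rewrite mulrC -Rintegral_cosP//; congr (_ * _).
  by apply: eq_Rintegral => u _; rewrite (_ : u * x + (- (u * y) + 0) = (x - y) * u)//; ring.
rewrite (_ : (fun x => _) = fun=> 0); first by rewrite /Rintegral integral0.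
apply/funext => x.
rewrite (_ : \int[mu]_u _ = 0) ?mulr0// -(Rintegral_sinP e0 (x - y)).
by apply: eq_Rintegral => u _; rewrite addrA cosNpi2 (_ : u * x - u * y = (x - y) * u)//; ring.
Qed.

(** The Poisson kernel centred at x, of total mass 2 pi, integrated over [s, t]. *)
Definition pavg ep s t x : R := 2 * (atan ((t - x) / ep) - atan ((s - x) / ep)).

Lemma continuous_pker ep x : 0 < ep -> continuous (fun y => 2 * ep / pden ep (x - y)).
Proof.
move=> e0 y; apply: cvgMr; apply: cvgV; first by rewrite gt_eqF// pden_gt0.
apply: cvgD; first exact: cvg_cst.
apply: cvgM; apply: cvgB; try exact: cvg_cst; exact: cvg_id.
Qed.

Lemma pavgE ep s t x : 0 < ep -> s < t ->
  \int[mu]_(y in `[s, t]) (2 * ep / pden ep (x - y)) = pavg ep s t x.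
Proof.
move=> e0 st.
pose F y : R := 2 * atan ((y - x) / ep).
have dF y : is_derive y 1 F (2 * ep / pden ep (x - y)).
  have d : 0 < pden ep (x - y) by exact: pden_gt0.
  have E : F = (cst 2 * (atan \o (fun y => (y - x) / ep))).
    by apply/funext => v.
  rewrite E; apply: is_derive_eq.
  rewrite /GRing.scale /= /cst.
  rewrite /pden in d *.
  by field; rewrite (gt_eqF e0) (gt_eqF d).
have DF y : derivable F y 1 by have [] := dF y.
rewrite /Rintegral (@continuous_FTC2 _ _ F)//=; first by rewrite /F /pavg mulrBr.
- by apply: continuous_subspaceT; exact: continuous_pker.
- exact: derivable_LR.
- by move=> y _; rewrite derive1E; have [_ ->] := dF y.
Qed.

Lemma poisson_avg ep a s t M : 0 < ep -> s < t ->
  mu.-integrable `[- M, M] (EFin \o a) ->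
  mu.-integrable `[s, t] (EFin \o (fun y =>
    \int[mu]_(x in `[- M, M]) (2 * ep / pden ep (x - y) * a x))) /\
  \int[mu]_(y in `[s, t]) (\int[mu]_(x in `[- M, M]) (2 * ep / pden ep (x - y) * a x)) =
  \int[mu]_(x in `[- M, M]) (a x * pavg ep s t x).
Proof.
move=> e0 st ia.
have e1 : ep != 0 by rewrite gt_eqF.
have mI : measurable (`[- M, M]%classic : set R) by exact: measurable_itv.
have mJ : measurable (`[s, t]%classic : set R) by exact: measurable_itv.
have ik : mu.-integrable `[s, t] (EFin \o (fun=> 2 / ep : R)).
  by apply: integrable_itv => x; exact: cvg_cst.
(* The kernel divided by its maximum 2/ep, so that w <= 1; the factor 2/ep becomes the integrable
   function on [s, t] in [Fubini_weighted]. *)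
pose w y x := ep ^+ 2 / pden ep (x - y).
have w1 y x : `|w y x| <= 1.
  rewrite /w ger0_norm ?divr_ge0 ?sqr_ge0//; last by apply: ltW; exact: pden_gt0.
  by rewrite ler_pdivrMr ?pden_gt0// mul1r lerDl sqr_ge0.
have mw : measurable_fun [set: T * T] (fun z : T * T => (w z.1 z.2 : R)).
  have m1 : measurable_fun [set: T * T] (fun z : T * T => (z.2 - z.1 : R)).
    by apply: measurable_funB; [exact: measurable_snd|exact: measurable_fst].
  have c : continuous (fun x => ep ^+ 2 / pden ep x).
    move=> x; apply: cvgMr; apply: cvgV; first by rewrite gt_eqF// pden_gt0.
    by apply: cvgD; [exact: cvg_cst|exact: exprn_continuous].
  exact: (measurableT_comp (continuous_measurable_fun c) m1).
have [I E] := @Fubini_weighted R `[s, t] `[- M, M] _ a w mJ mI ik ia mw w1.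
have iw y : mu.-integrable `[- M, M] (EFin \o (fun x => w y x * a x)).
  apply: (integrable_le mI _ _ (integrable_normr mI ia)) => /=.
    apply: measurable_funM; last by case/integrableP: ia => /measurable_EFinP.
    apply: measurable_funTS; apply: continuous_measurable_fun => x.
    apply: cvgMr; apply: cvgV; first by rewrite gt_eqF// pden_gt0.
    apply: cvgD; first exact: cvg_cst.
    by apply: cvgM; apply: cvgB; [exact: cvg_id|exact: cvg_cst|exact: cvg_id|exact: cvg_cst].
  by move=> x _; rewrite normrM -[leRHS]mul1r ler_wpM2r.
have wE y x : 2 / ep * w y x = 2 * ep / pden ep (x - y).
  have d : pden ep (x - y) != 0 by rewrite gt_eqF// pden_gt0.
  by rewrite /w; field; rewrite d e1.
have GE : (fun y => 2 / ep * \int[mu]_(x in `[- M, M]) (w y x * a x)) =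
    (fun y => \int[mu]_(x in `[- M, M]) (2 * ep / pden ep (x - y) * a x)).
  apply/funext => y; rewrite -RintegralZl//.
  by apply: eq_Rintegral => x _; rewrite mulrA wE.
rewrite -GE; split => //; rewrite E; apply: eq_Rintegral => x _; congr (_ * _).
rewrite -pavgE//; apply: eq_Rintegral => y _; rewrite -wE mulrC //.
Qed.

Lemma pavg_le ep s t x : `|pavg ep s t x| <= 2 * pi.
Proof.
have h1 := atan_gtNpi2 ((t - x) / ep); have h2 := atan_ltpi2 ((t - x) / ep).
have h3 := atan_gtNpi2 ((s - x) / ep); have h4 := atan_ltpi2 ((s - x) / ep).
by rewrite ler_norml /pavg; apply/andP; split; lra.
Qed.

Lemma mu_itv s t : s <= t -> fine (mu `[s, t]) = t - s.
Proof.
move=> st; rewrite lebesgue_measure_itv/= lte_fin; case: ifP => // /negbT.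
by rewrite -leNgt => ts; rewrite (@le_anti _ _ s t) ?st ?ts// subrr.
Qed.

(** A majorant independent of ep, for dominated convergence. Near the interval the total mass 2 pi
    is enough; far from it the kernel itself decays like x^-2. *)
Lemma pavg_decay s t : s < t -> exists2 C, 0 <= C &
  forall ep x, 0 < ep <= 1 -> `|pavg ep s t x| <= C * (1 + x ^+ 2)^-1.
Proof.
(* Beyond r one has |x - y| >= |x|/2 for y in [s, t], and x^2 >= 1; hence 2 ep / (ep^2 + (x-y)^2) <=
   8 / x^2 <= 16 / (1 + x^2). *)
move=> st; pose r := 2 * (`|s| + `|t|) + 1.
have s0 : 0 <= `|s| by []. have t0 : 0 <= `|t| by [].
have p0 : 0 <= pi :> R by exact: pi_ge0.
have ts0 : 0 <= t - s by rewrite subr_ge0 ltW.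
have r2 : 0 <= 1 + r ^+ 2 by rewrite addr_ge0// sqr_ge0.
have A0 : 0 <= 2 * pi * (1 + r ^+ 2) by rewrite !mulr_ge0.
exists (2 * pi * (1 + r ^+ 2) + 16 * (t - s)); first by rewrite addr_ge0// mulr_ge0.
move=> ep x /andP[e0 e1].
have x2 : 0 < 1 + x ^+ 2 by rewrite ltr_wpDr// sqr_ge0.
rewrite mulrDl; case: (leP `|x| r) => xr.
  apply: (@le_trans _ _ (2 * pi * (1 + r ^+ 2) * (1 + x ^+ 2)^-1)).
    apply: le_trans (pavg_le _ _ _ _) _.
    rewrite ler_pdivlMr// ler_wpM2l ?mulr_ge0// lerD2l -(real_normK (num_real x)).
    by rewrite lerXn2r ?nnegrE// (le_trans _ xr).
  by rewrite lerDl divr_ge0 ?mulr_ge0// ltW.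
apply: (@le_trans _ _ (16 * (t - s) * (1 + x ^+ 2)^-1)); last first.
  by rewrite lerDr divr_ge0// ltW.
rewrite -pavgE//.
have ic : mu.-integrable `[s, t] (EFin \o (fun=> 16 * (1 + x ^+ 2)^-1 : R)).
  by apply: integrable_itv => y; exact: cvg_cst.
have -> : 16 * (t - s) * (1 + x ^+ 2)^-1 = \int[mu]_(y in `[s, t]) (16 * (1 + x ^+ 2)^-1).
  rewrite Rintegral_cst// mu_itv ?ltW//; ring.
apply: norm_Rintegral_le => //.
  by apply: measurable_funTS; apply: continuous_measurable_fun; exact: continuous_pker.
move=> y; rewrite /= in_itv/= => /andP[sy yt].
have d0 := pden_gt0 e0 (x - y).
rewrite ger0_norm; last by rewrite divr_ge0 ?mulr_ge0// ltW.
have yb : `|y| <= `|s| + `|t|.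
  rewrite ler_norml; apply/andP; split.
    by have := ler_norm (- s); rewrite normrN; lra.
  by have := ler_norm t; lra.
have xy : `|x| <= 2 * `|x - y|.
  have := ler_normD (x - y) y; rewrite subrK.
  by rewrite /r in xr; lra.
have xx : x ^+ 2 <= 4 * (x - y) ^+ 2.
  rewrite -(real_normK (num_real x)) -(real_normK (num_real (x - y))).
  have := normr_ge0 x; nra.
have x1 : 1 <= x ^+ 2.
  rewrite -(real_normK (num_real x)) exprn_ege1//.
  by rewrite /r in xr; lra.
rewrite ler_pdivrMr// mulrAC ler_pdivlMr// /pden.
have : 0 <= ep ^+ 2 by exact: sqr_ge0.
by nra.
Qed.

End Inversion.

(** * Inverse transforms of weighted integrable functions and limits of the kernels *)

Section InversionLimit.
Variable R : realType.
Notation mu := (@lebesgue_measure R).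
Implicit Types (P Q a b f : R -> R) (x y s t ep : R).

(** The real part of the integral of exp(iuy) (P + iQ)(u) du, the inverse transform up to 2 pi. *)
Definition gammaR P Q y : R := \int[mu]_u (P u * cos (u * y) - Q u * sin (u * y)).

Definition wint P : Prop := mu.-integrable [set: R] (EFin \o (fun u => (1 + `|u|) * P u)).

(** One constant that bounds both [gammaR] and its Lipschitz constant; the weight 1 + |u| accounts
    for the differentiated exponential. *)
Definition wnorm P Q : R := \int[mu]_u ((1 + `|u|) * `|P u| + (1 + `|u|) * `|Q u|).

Lemma wint_measurable P : wint P -> measurable_fun [set: R] P.
Proof.
move=> /integrableP[/measurable_EFinP h _].
rewrite (_ : P = fun u => (1 + `|u|)^-1 * ((1 + `|u|) * P u)).
  apply: measurable_funM => //; apply: continuous_measurable_fun => u.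
  apply: cvgV; first by rewrite gt_eqF// ltr_wpDr.
  by apply: cvgD; [exact: cvg_cst|exact: norm_continuous].
apply/funext => u; rewrite mulrA mulVf ?mul1r// gt_eqF// ltr_wpDr//.
Qed.

Lemma wint_norm P : wint P -> wint (fun u => `|P u|).
Proof.
move=> h; have := integrable_normr measurableT h; rewrite /wint.
rewrite (_ : (fun x => `|_|) = (fun u => (1 + `|u|) * `|P u|))//.
by apply/funext => u; rewrite normrM ger0_norm// addr_ge0.
Qed.

Lemma wint_sum P Q : wint P -> wint Q ->
  mu.-integrable [set: R] (EFin \o (fun u => (1 + `|u|) * `|P u| + (1 + `|u|) * `|Q u|)).
Proof. by move=> /wint_norm hP /wint_norm hQ; apply: integrable_addr. Qed.

Lemma wint_le P f : wint P -> measurable_fun [set: R] f ->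
  (forall u, `|f u| <= (1 + `|u|) * `|P u|) -> mu.-integrable [set: R] (EFin \o f).
Proof.
move=> /wint_norm hP mf le; apply: (integrable_le measurableT mf _ hP) => u _.
exact: le.
Qed.

Lemma wint_integrable P : wint P -> mu.-integrable [set: R] (EFin \o P).
Proof.
move=> h; apply: (wint_le h); first exact: wint_measurable.
by move=> u; rewrite ler_peMl// lerDl.
Qed.

Lemma measurable_cosy y : measurable_fun [set: R] (fun u : R => cos (u * y)).
Proof.
apply: continuous_measurable_fun => u; apply: continuous_comp; last exact: continuous_cos.
by apply: cvgMl; exact: cvg_id.
Qed.

Lemma measurable_siny y : measurable_fun [set: R] (fun u : R => sin (u * y)).
Proof.
apply: continuous_measurable_fun => u; apply: continuous_comp; last exact: continuous_sin.
by apply: cvgMl; exact: cvg_id.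
Qed.

Lemma sin_norm x : `|sin x| <= 1.
Proof. by rewrite ler_norml sin_geN1 sin_le1. Qed.

Lemma sin_lip x y : `|sin x - sin y| <= `|x - y|.
Proof.
rewrite -2!cosNpi2; apply: le_trans (cos_lip _ _) _.
by rewrite (_ : x - pi / 2 - (y - pi / 2) = x - y)//; ring.
Qed.

Lemma integrable_gamma P Q y : wint P -> wint Q ->
  mu.-integrable [set: R] (EFin \o (fun u => P u * cos (u * y) - Q u * sin (u * y))).
Proof.
move=> hP hQ; apply: integrable_subr => //.
- apply: (integrable_le measurableT _ _ (integrable_normr measurableT (wint_integrable hP))).
    by apply: measurable_funM; [exact: wint_measurable|exact: measurable_cosy].
  by move=> u _; rewrite normrM -[leRHS]mulr1 ler_wpM2l// cos_norm.
- apply: (integrable_le measurableT _ _ (integrable_normr measurableT (wint_integrable hQ))).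
    by apply: measurable_funM; [exact: wint_measurable|exact: measurable_siny].
  by move=> u _; rewrite normrM -[leRHS]mulr1 ler_wpM2l// sin_norm.
Qed.

Lemma measurable_gamma P Q y : wint P -> wint Q ->
  measurable_fun [set: R] (fun u => P u * cos (u * y) - Q u * sin (u * y)).
Proof. by move=> hP hQ; case/integrableP: (integrable_gamma y hP hQ) => /measurable_EFinP. Qed.

Lemma gamma_le P Q y : wint P -> wint Q -> `|gammaR P Q y| <= wnorm P Q.
Proof.
move=> hP hQ; apply: norm_Rintegral_le => //; last exact: wint_sum.
  exact: measurable_gamma.
move=> u _; rewrite (le_trans (ler_normB _ _))// !normrM; apply: lerD.
  apply: (@le_trans _ _ (`|P u| * 1)); first by rewrite ler_wpM2l// cos_norm.
  by rewrite mulr1 ler_peMl// lerDl.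
apply: (@le_trans _ _ (`|Q u| * 1)); first by rewrite ler_wpM2l// sin_norm.
by rewrite mulr1 ler_peMl// lerDl.
Qed.

Lemma gamma_lip P Q x y : wint P -> wint Q ->
  `|gammaR P Q x - gammaR P Q y| <= wnorm P Q * `|x - y|.
Proof.
move=> hP hQ; rewrite /gammaR -RintegralB//; try exact: integrable_gamma.
rewrite mulrC /wnorm -RintegralZl//; last exact: wint_sum.
apply: norm_Rintegral_le => //; last by apply: integrable_mulrl => //; exact: wint_sum.
  by apply: measurable_funB; exact: measurable_gamma.
move=> u _.
have -> : P u * cos (u * x) - Q u * sin (u * x) - (P u * cos (u * y) - Q u * sin (u * y)) =
  P u * (cos (u * x) - cos (u * y)) - Q u * (sin (u * x) - sin (u * y)) by ring.
rewrite (le_trans (ler_normB _ _))// !normrM mulrDr.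
have H : `|u * x - u * y| <= (1 + `|u|) * `|x - y|.
  by rewrite -mulrBr normrM ler_wpM2r// lerDr.
apply: lerD.
  rewrite [leLHS]mulrC [leRHS]mulrA (mulrC `|x - y|) ler_wpM2r//.
  exact: le_trans (cos_lip _ _) H.
rewrite [leLHS]mulrC [leRHS]mulrA (mulrC `|x - y|) ler_wpM2r//.
exact: le_trans (sin_lip _ _) H.
Qed.

Lemma continuous_gamma P Q : wint P -> wint Q -> continuous (gammaR P Q).
Proof. by move=> hP hQ; apply: lip_continuous => x y; exact: gamma_lip. Qed.

Lemma integrable_sqr2 f : measurable_fun [set: R] f ->
  (\int[mu]_x (f x ^+ 2)%:E < +oo)%E -> mu.-integrable [set: R] (EFin \o (fun x => f x ^+ 2)).
Proof.
move=> mf foo; apply/integrableP; split.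
  by apply/measurable_EFinP; exact: measurable_funX.
by under eq_integral => x _ do rewrite /= ger0_norm ?sqr_ge0//.
Qed.

(* The Cauchy-Schwarz term is split by [|d| <= ep^2 + d^2 / ep^2]. *)
Lemma poisson_error P Q (F G : R -> R) ep y : 0 < ep ->
  wint P -> wint Q -> measurable_fun [set: R] F -> measurable_fun [set: R] G ->
  (\int[mu]_u ((F u - P u) ^+ 2)%:E <= (ep ^+ 3)%:E)%E ->
  (\int[mu]_u ((G u - Q u) ^+ 2)%:E <= (ep ^+ 3)%:E)%E ->
  mu.-integrable [set: R] (EFin \o (fun u =>
    expR (- (ep * `|u|)) * (F u * cos (u * y) - G u * sin (u * y)))) ->
  `|\int[mu]_u (expR (- (ep * `|u|)) * (F u * cos (u * y) - G u * sin (u * y))) - gammaR P Q y|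
    <= (6 + wnorm P Q) * ep.
Proof.
move=> e0 hP hQ mF mG dF dG iK.
have mP := wint_measurable hP; have mQ := wint_measurable hQ.
have iF : mu.-integrable [set: R] (EFin \o (fun u => (F u - P u) ^+ 2)).
  by apply: integrable_sqr2; [exact: measurable_funB|exact: le_lt_trans dF (ltry _)].
have iG : mu.-integrable [set: R] (EFin \o (fun u => (G u - Q u) ^+ 2)).
  by apply: integrable_sqr2; [exact: measurable_funB|exact: le_lt_trans dG (ltry _)].
have ie := integrable_expNabs e0.
have iw := wint_sum hP hQ.
have i1 := integrable_mulrl (2 * ep ^+ 2) measurableT ie.
have i2 := integrable_mulrl ((ep ^+ 2)^-1) measurableT (integrable_addr measurableT iF iG).
have i3 := integrable_mulrl ep measurableT iw.
have i12 := integrable_addr measurableT i1 i2.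
rewrite /gammaR -RintegralB//; last exact: integrable_gamma.
have e20 : 0 < ep ^+ 2 by rewrite exprn_gt0.
apply: le_trans (norm_Rintegral_le measurableT _ _ (integrable_addr measurableT i12 i3)) _.
- apply: measurable_funB; last exact: measurable_gamma.
  by case/integrableP: iK => /measurable_EFinP.
- move=> u _.
  set e := expR _; have p0 : 0 <= e by exact: expR_ge0.
  have u0 : 0 <= `|u| by [].
  have p1 : e <= 1 by rewrite /e -[leRHS]expR0 ler_expR oppr_le0 mulr_ge0// ltW.
  have p2 : 1 - e <= ep * `|u|.
    by have := expR_ge1Dx (- (ep * `|u|)); rewrite -/e; lra.
  set c := cos _; set s := sin _.
  have -> : e * (F u * c - G u * s) - (P u * c - Q u * s) =
    e * (F u - P u) * c - e * (G u - Q u) * s - ((1 - e) * P u * c - (1 - e) * Q u * s) by ring.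
  have cn : `|c| <= 1 by exact: cos_norm.
  have sn : `|s| <= 1 by exact: sin_norm.
  have D (d v : R) : `|v| <= 1 -> `|e * d * v| <= ep ^+ 2 * e + (ep ^+ 2)^-1 * d ^+ 2.
    move=> v1; rewrite normrM (le_trans (ler_wpM2l _ v1))// mulr1 normrM (ger0_norm p0).
    have d2 : 0 <= (ep ^+ 2)^-1 * d ^+ 2 by rewrite mulr_ge0 ?sqr_ge0// invr_ge0 ltW.
    apply: (@le_trans _ _ (e * (ep ^+ 2 + (ep ^+ 2)^-1 * d ^+ 2))).
      rewrite ler_wpM2l// -(ler_pM2l e20).
      rewrite [leRHS](_ : _ = ep ^+ 2 * ep ^+ 2 + d ^+ 2); last by field; rewrite gt_eqF.
      rewrite -(real_normK (num_real d)); move: (ep ^+ 2) (`|d|) e20 => q z q0.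
      by have := sqr_ge0 (q - z); have := sqr_ge0 q; have := sqr_ge0 z; nra.
    by rewrite mulrDr mulrC lerD2l ler_piMl.
  have D3 (v w : R) : `|w| <= 1 -> `|(1 - e) * v * w| <= ep * ((1 + `|u|) * `|v|).
    move=> w1; rewrite normrM (le_trans (ler_wpM2l _ w1))// mulr1 normrM.
    rewrite ger0_norm ?subr_ge0// mulrA ler_wpM2r//.
    by apply: le_trans p2 _; rewrite ler_wpM2l ?(ltW e0)// lerDr.
  have n1 := D (F u - P u) c cn; have n2 := D (G u - Q u) s sn.
  have n3 := D3 (P u) c cn; have n4 := D3 (Q u) s sn.
  move: n1 n2 n3 n4.
  set A := e * (F u - P u) * c; set B := e * (G u - Q u) * s.
  set A' := (1 - e) * P u * c; set B' := (1 - e) * Q u * s.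
  have := ler_normB (A - B) (A' - B'); have := ler_normB A B; have := ler_normB A' B'.
  by move=> *; lra.
have iD := integrable_addr measurableT iF iG.
rewrite RintegralD// RintegralD// RintegralZl// RintegralZl// RintegralD//.
rewrite RintegralZl// Rintegral_expNabs// -/(wnorm P Q).
rewrite [leRHS]mulrDl [ep * wnorm _ _]mulrC lerD2r.
have L (H : R -> R) : (\int[mu]_u (H u ^+ 2)%:E <= (ep ^+ 3)%:E)%E ->
    \int[mu]_u (H u ^+ 2) <= ep ^+ 3.
  move=> h; rewrite -lee_fin /Rintegral fineK// ge0_fin_numE; last first.
    by apply: integral_ge0 => u _; rewrite lee_fin sqr_ge0.
  exact: le_lt_trans h (ltry _).
have l1 := L _ dF; have l2 := L _ dG.
have -> : 2 * ep ^+ 2 * (2 / ep) = 4 * ep by field; rewrite gt_eqF.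
apply: (@le_trans _ _ (4 * ep + (ep ^+ 2)^-1 * (ep ^+ 3 + ep ^+ 3))).
  by rewrite lerD2l ler_wpM2l ?invr_ge0 ?(ltW e20)// lerD.
have -> : (ep ^+ 2)^-1 * (ep ^+ 3 + ep ^+ 3) = 2 * ep by field; rewrite gt_eqF.
lra.
Qed.

Lemma cvg_mul_natS (c : R) : 0 < c -> (c * k.+1%:R) @[k --> \oo] --> +oo.
Proof.
move=> c0; apply/cvgryPge => A; near=> k.
rewrite mulrC -ler_pdivrMr//.
apply: (@le_trans _ _ k%:R); last by rewrite ler_nat.
near: k; exact: nbhs_infty_ger.
Unshelve. all: by end_near. Qed.

Lemma cvg_atan_pos (c : R) : 0 < c -> atan (c * k.+1%:R) @[k --> \oo] --> pi / 2.
Proof. by move=> c0; apply: (cvg_comp _ _ (cvg_mul_natS c0)); exact: cvgy_atan. Qed.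

Lemma cvg_atan_neg (c : R) : c < 0 -> atan (c * k.+1%:R) @[k --> \oo] --> - (pi / 2).
Proof.
move=> c0; rewrite (_ : (fun k : nat => _) = fun k => - atan (- c * k.+1%:R)).
  by apply: cvgN; apply: cvg_atan_pos; rewrite oppr_gt0.
by apply/funext => k; rewrite mulNr atanN opprK.
Qed.

(** The pointwise limit of [pavg] as ep tends to 0, except at s and t, where the kernel charges both
    sides equally. *)
Definition limind s t x : R := if (s < x < t) then 2 * pi else 0.

Lemma pavg_cvg s t x : s < t -> x != s -> x != t ->
  pavg (k.+1%:R^-1) s t x @[k --> \oo] --> limind s t x.
Proof.
move=> st xs xt; rewrite /pavg /limind.
under eq_fun do rewrite invrK.
have pos (c : R) : 0 < c -> atan (c * k.+1%:R) @[k --> \oo] --> pi / 2 by exact: cvg_atan_pos.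
have neg (c : R) : c < 0 -> atan (c * k.+1%:R) @[k --> \oo] --> - (pi / 2) by exact: cvg_atan_neg.
case: (ltgtP x s) xs => // xs _; case: (ltgtP x t) xt => // xt _ /=.
- rewrite (_ : 0 = 2 * (pi / 2 - pi / 2)); last by rewrite subrr mulr0.
  by apply: cvgMr; apply: cvgB; apply: pos; rewrite subr_gt0.
- by move: (lt_trans st xt) => /ltW; rewrite leNgt xs.
- rewrite (_ : 2 * pi = 2 * (pi / 2 - - (pi / 2))); last by field.
  by apply: cvgMr; apply: cvgB; [apply: pos; rewrite subr_gt0|apply: neg; rewrite subr_lt0].
- rewrite (_ : 0 = 2 * (- (pi / 2) - - (pi / 2))); last by rewrite subrr mulr0.
  by apply: cvgMr; apply: cvgB; apply: neg; rewrite subr_lt0.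
Qed.

(** With v = 1/(1 + x^2) <= 1, one has |a| v <= a^2 + v^2 <= a^2 + v. *)
Lemma integrable_decay a : measurable_fun [set: R] a ->
  (\int[mu]_x (a x ^+ 2)%:E < +oo)%E ->
  mu.-integrable [set: R] (EFin \o (fun x => `|a x| * (1 + x ^+ 2)^-1)).
Proof.
move=> ma a2; have i2 := integrable_sqr2 ma a2.
have mo : measurable_fun [set: R] (fun x : R => (1 + x ^+ 2)^-1).
  by apply: continuous_measurable_fun; exact: continuous_oneDsqrV.
apply: (integrable_le measurableT _ _ (integrable_addr measurableT i2 (integrable_oneDsqrV R))).
  by apply: measurable_funM => //; exact: measurableT_comp.
move=> x _; rewrite normrM normr_id -(real_normK (num_real (a x))).
set v := (1 + x ^+ 2)^-1; have v0 : 0 <= v by exact: oneDsqrV_ge0.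
have v1 : v <= 1 by rewrite invf_le1 ?ltr_wpDr ?sqr_ge0// lerDl sqr_ge0.
rewrite (ger0_norm v0); move: (`|a x|) (normr_ge0 (a x)) => z z0.
by have := sqr_ge0 (z - v); nra.
Qed.

Lemma ereal_cvg0_near (u : nat -> \bar R) ep : (forall n, (0 <= u n)%E) ->
  u n @[n --> \oo] --> 0%E -> 0 < ep -> \forall n \near \oo, (u n <= ep%:E)%E.
Proof.
move=> u0 /fine_cvgP[fu cu] e0; move/cvgrPdist_le : cu => /(_ _ e0) cu.
near=> n.
have f : u n \is a fin_num by near: n.
have : `|0 - fine (u n)| <= ep by near: n.
by rewrite sub0r normrN -[u n]fineK// lee_fin => /(le_trans (ler_norm _)).
Unshelve. all: by end_near. Qed.

End InversionLimit.

Section InversionFinal.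
Variable R : realType.
Notation mu := (@lebesgue_measure R).
Implicit Types (P Q a b f : R -> R) (x y s t ep : R).

Lemma measurable_limind s t : measurable_fun [set: R] (limind s t).
Proof.
rewrite /limind; apply: measurable_fun_ifT => //.
by apply: measurable_and; exact: measurable_fun_ltr.
Qed.

Lemma ae_neq2 s t : \forall x \ae mu, x != s /\ x != t.
Proof.
exists [set s; t]; split => //.
- by apply: measurableU.
- by apply: countable_lebesgue_measure0; apply: finite_set_countable.
- move=> x /= /not_andP[] /negP; rewrite negbK => /eqP ->; [by left|by right].
Qed.

(** The integrals [I k] of a against [pavg], truncated to [-N k, N k], have two limits. Read through
    [poisson_fourier] they approach the integral of [gammaR]; read as averages of a they approach 2
    pi times the integral of a over ]s, t[ by dominated convergence. *)
Lemma fourier_inversion a b P Q s t :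
  measurable_fun [set: R] a -> measurable_fun [set: R] b ->
  (\int[mu]_x (a x ^+ 2)%:E < +oo)%E -> (\int[mu]_x (b x ^+ 2)%:E < +oo)%E ->
  wint P -> wint Q ->
  (\int[mu]_u ((fourier_Re a b n u - P u) ^+ 2)%:E)%E @[n --> \oo] --> 0%E ->
  (\int[mu]_u ((fourier_Re b (fun x => - a x) n u - Q u) ^+ 2)%:E)%E @[n --> \oo] --> 0%E ->
  s < t ->
  2 * pi * \int[mu]_(x in `[s, t]) a x = \int[mu]_(y in `[s, t]) gammaR P Q y.
Proof.
move=> ma mb a2 b2 hP hQ cP cQ st.
have ia M : mu.-integrable `[- M, M] (EFin \o a) by exact: L2_integrable.
have ib M : mu.-integrable `[- M, M] (EFin \o b) by exact: L2_integrable.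
have iNa M : mu.-integrable `[- M, M] (EFin \o (fun x => - a x)).
  by apply: integrable_oppf.
have mF n : measurable_fun [set: R] (fourier_Re a b n).
  by apply: continuous_measurable_fun; exact: continuous_fourier_Re.
have mG n : measurable_fun [set: R] (fourier_Re b (fun x => - a x) n).
  by apply: continuous_measurable_fun; exact: continuous_fourier_Re.
pose ep k : R := k.+1%:R^-1.
have ep0 k : 0 < ep k by rewrite invr_gt0.
have ep1 k : ep k <= 1 by rewrite invf_le1// ler1n.
(* Diagonal choice of the truncation: an L_2 error of ep^3 survives the division by ep^2 in
   [poisson_error] as O(ep), and N k >= k makes the intervals exhaust the line. *)
have /choice[N HN] : forall k, exists n, [/\ (k <= n)%N,
    (\int[mu]_u ((fourier_Re a b n u - P u) ^+ 2)%:E <= (ep k ^+ 3)%:E)%E &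
    (\int[mu]_u ((fourier_Re b (fun x => - a x) n u - Q u) ^+ 2)%:E <= (ep k ^+ 3)%:E)%E].
  move=> k; have e3 : 0 < ep k ^+ 3 by rewrite exprn_gt0.
  have I0 (H : R -> R) : (0 <= \int[mu]_u ((H u) ^+ 2)%:E)%E.
    by apply: integral_ge0 => u _; rewrite lee_fin sqr_ge0.
  have H1 := ereal_cvg0_near (fun n => I0 _) cP e3.
  have H2 := ereal_cvg0_near (fun n => I0 _) cQ e3.
  have : \forall n \near \oo, [/\ (k <= n)%N,
    (\int[mu]_u ((fourier_Re a b n u - P u) ^+ 2)%:E <= (ep k ^+ 3)%:E)%E &
    (\int[mu]_u ((fourier_Re b (fun x => - a x) n u - Q u) ^+ 2)%:E <= (ep k ^+ 3)%:E)%E].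
    near=> n; split; [near: n; exact: nbhs_infty_ge|near: n; exact: H1|near: n; exact: H2].
  by move=> /filter_ex[n hn]; exists n.
pose I k := \int[mu]_(x in `[- (N k)%:R, (N k)%:R]) (a x * pavg (ep k) s t x).
have cI1 : I k @[k --> \oo] --> \int[mu]_(y in `[s, t]) gammaR P Q y.
  have err k : `|I k - \int[mu]_(y in `[s, t]) gammaR P Q y| <=
      (t - s) * (6 + wnorm P Q) * ep k.
    have [Nk dP dQ] := HN k.
    have [i1 E1] := poisson_avg (ep0 k) st (ia (N k)%:R).
    have ig : mu.-integrable `[s, t] (EFin \o (gammaR P Q)).
      by apply: integrable_itv; exact: continuous_gamma.
    rewrite /I -E1 -RintegralB//.
    have ic : mu.-integrable `[s, t] (EFin \o (fun=> (6 + wnorm P Q) * ep k : R)).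
      by apply: integrable_itv => y; exact: cvg_cst.
    have -> : (t - s) * (6 + wnorm P Q) * ep k =
        \int[mu]_(y in `[s, t]) ((6 + wnorm P Q) * ep k).
      by rewrite Rintegral_cst// mu_itv ?ltW//; ring.
    apply: norm_Rintegral_le => //.
      apply: measurable_funB; first by case/integrableP: i1 => /measurable_EFinP.
      by case/integrableP: ig => /measurable_EFinP.
    move=> y _.
    have [i2 <-] := poisson_fourier y (ep0 k) (ia (N k)%:R) (ib (N k)%:R).
    exact: poisson_error.
  apply/cvgrPdist_le => e e0.
  have W0 : 0 <= wnorm P Q.
    by apply: Rintegral_ge0 => u _; rewrite addr_ge0// mulr_ge0// addr_ge0.
  have C0 : 0 < (t - s) * (6 + wnorm P Q) + 1.
    rewrite ltr_wpDl//; apply: mulr_ge0; first by rewrite subr_ge0 ltW.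
    exact: addr_ge0.
  near=> k; rewrite distrC; apply: le_trans (err k) _.
  apply: (@le_trans _ _ (((t - s) * (6 + wnorm P Q) + 1) * ep k)).
    by rewrite ler_wpM2r ?lerDl// ltW.
  rewrite mulrC -ler_pdivlMr//.
  rewrite /ep -[leRHS]invrK lef_pV2 ?posrE ?invr_gt0 ?divr_gt0//.
  apply: (@le_trans _ _ k%:R); last by rewrite ler_nat.
  by near: k; exact: nbhs_infty_ger.
have [C C0 HC] := pavg_decay st.
have cI2 : I k @[k --> \oo] --> \int[mu]_x (a x * limind s t x).
  pose f k := (EFin \o ((fun x => a x * pavg (ep k) s t x) \_ `[- (N k)%:R, (N k)%:R])).
  have mp k : measurable_fun [set: R] (pavg (ep k) s t).
    apply: continuous_measurable_fun => x; apply: cvgMr; apply: cvgB.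
    - apply: continuous_comp; last exact: continuous_atan.
      by apply: cvgMl; apply: cvgB; [exact: cvg_cst|exact: cvg_id].
    - apply: continuous_comp; last exact: continuous_atan.
      by apply: cvgMl; apply: cvgB; [exact: cvg_cst|exact: cvg_id].
  have mf k : measurable_fun [set: R] (f k).
    apply/measurable_EFinP; apply/(measurable_restrictT _ _).1 => //.
    by apply: measurable_funTS; exact: measurable_funM.
  have ml := measurable_limind s t.
  have mlim : measurable_fun [set: R] (EFin \o (fun x => a x * limind s t x)).
    by apply/measurable_EFinP; exact: measurable_funM.
  have id : mu.-integrable [set: R] (EFin \o (fun x => C * (`|a x| * (1 + x ^+ 2)^-1))).
    by apply: integrable_mulrl => //; exact: integrable_decay.
  have cvf : \forall x \ae mu, [set: R] x ->
    f k x @[k --> \oo] --> (EFin \o (fun x => a x * limind s t x)) x.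
    apply: (@filterS _ _ (ae_filter_ringOfSetsType mu) _ _ _ (ae_neq2 s t)) => x [xs xt] _.
    apply/fine_cvgP; split; first by near=> k.
    have : (a x * pavg (ep k) s t x) @[k --> \oo] --> a x * limind s t x.
      by apply: cvgMr; exact: pavg_cvg.
    apply: cvg_trans; apply: near_eq_cvg; near=> k.
    rewrite /f /= patchE ifT// inE/= in_itv/= -ler_norml.
    have [kN _ _] := HN k.
    apply: (@le_trans _ _ k%:R); last by rewrite ler_nat.
    by near: k; exact: nbhs_infty_ger.
  have dom : \forall x \ae mu, forall k, [set: R] x ->
    (`|f k x| <= (C * (`|a x| * (1 + x ^+ 2)^-1))%:E)%E.
    apply: aeW => x k _; rewrite /f /= lee_fin patchE; case: ifP => _.
      rewrite normrM mulrCA ler_wpM2l// HC// ep0 ep1//.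
    by rewrite normr0 mulr_ge0// mulr_ge0// oneDsqrV_ge0.
  have [il _ cv] := @dominated_convergence _ _ _ mu _ measurableT _ _ _ mf mlim cvf id dom.
  have E k : I k = fine (\int[mu]_x f k x)%E by rewrite /I Rintegral_mkcond.
  under eq_fun do rewrite E.
  apply: fine_cvg; rewrite fineK//.
  exact: (integrable_fin_num measurableT il).
have {cI1 cI2} -> := cvg_unique (@norm_hausdorff _ _) cI1 cI2.
rewrite -RintegralZl//; last exact: L2_integrable.
rewrite Rintegral_mkcond /Rintegral; congr fine.
apply: ae_eq_integral => //.
- apply/measurable_EFinP; apply/(measurable_restrictT _ _).1 => //.
  by apply: measurable_funTS; exact: measurable_funM.
- apply/measurable_EFinP; apply: measurable_funM => //; exact: measurable_limind.
apply: (@filterS _ _ (ae_filter_ringOfSetsType mu) _ _ _ (ae_neq2 s t)) => x [xs xt] _ /=.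
rewrite /limind patchE; congr EFin; case: ifPn => xst.
  move: xst; rewrite inE/= in_itv/= !le_eqVlt (negbTE xt) eq_sym (negbTE xs) /= => ->.
  by rewrite mulrC.
case: ifP => [/andP[h1 h2]|_]; last by rewrite mulr0.
by move: xst; rewrite notin_setE/= in_itv/= !ltW.
Unshelve. all: by end_near. Qed.

End InversionFinal.

(** * The process coefficients *)

Section Core.
Variable R : realType.
Notation mu := (@lebesgue_measure R).
Implicit Types (f g a b P Q m : R -> R) (s t u : R).

Definition rint0 f t : R :=
  if 0 <= t then \int[mu]_(x in `[0, t]) f x else - \int[mu]_(x in `[t, 0]) f x.

Lemma int0E (h : R -> R[i]) t : int0 h t =
  rint0 (fun x => complex.Re (h x)) t +i* rint0 (fun x => complex.Im (h x)) t.
Proof. by rewrite /int0 /rint0; case: ifP. Qed.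

Lemma Rintegral_itvD f (r s t : R) : r <= s -> s <= t -> mu.-integrable `[r, t] (EFin \o f) ->
  \int[mu]_(x in `[r, t]) f x = \int[mu]_(x in `[r, s]) f x + \int[mu]_(x in `[s, t]) f x.
Proof.
move=> rs st i_f; have := Rintegral_itvB (a := BLeft r) (b := BRight t) (x := s) i_f.
rewrite !bnd_simp => /(_ rs st).
have ist : mu.-integrable `[s, t] (EFin \o f).
  apply: integrableS i_f => //; apply: subset_itvr; rewrite bnd_simp //.
rewrite (Rintegral_itv_obnd_cbnd (b := BRight t)).
  by move=> <-; rewrite addrC subrK.
by apply: integrableS ist => //; exact: subset_itv_oc_cc.
Qed.

Lemma rint0B f s t : s <= t -> (forall r r', mu.-integrable `[r, r'] (EFin \o f)) ->
  rint0 f t - rint0 f s = \int[mu]_(x in `[s, t]) f x.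
Proof.
move=> st i_f; rewrite /rint0; case: ifPn => t0; case: ifPn => s0.
- by rewrite (@Rintegral_itvD f 0 s t)// addrAC subrr add0r.
- by rewrite (@Rintegral_itvD f s 0 t)// ?opprK 1?addrC// ltW// ltNge.
- by move: t0; rewrite (le_trans s0 st).
- by rewrite (@Rintegral_itvD f s t 0)// ?opprK; [ring|rewrite ltW// ltNge].
Qed.

(** Agreement on nondegenerate intervals suffices because at t = 0 both integrals run over a point.
    No pointwise equality is asked of f and g. *)
Lemma rint0_eq f g t : (forall r s, r < s ->
    \int[mu]_(x in `[r, s]) f x = \int[mu]_(x in `[r, s]) g x) -> rint0 f t = rint0 g t.
Proof.
move=> fg; rewrite /rint0; case: ifPn => [|t0]; last by rewrite fg// ltNge.
rewrite le_eqVlt => /orP[/eqP<-|t0]; last by rewrite fg.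
by rewrite set_itv1 !Rintegral_set1.
Qed.

Lemma rint0_taylor f (L : R) t h : (forall x y, `|f x - f y| <= L * `|x - y|) ->
  `|rint0 f (t + h) - rint0 f t - h * f t| <= L * h ^+ 2.
Proof.
move=> fL; have cf := lip_continuous fL.
have L0 : 0 <= L by have := le_trans (normr_ge0 _) (fL 1 0); rewrite subr0 normr1 mulr1.
have i_f r r' : mu.-integrable `[r, r'] (EFin \o f) by exact: integrable_itv.
(* The base point may lie anywhere in the interval: it is the left end for h >= 0 and the right end
   for h < 0. *)
have key s s' x0 : s <= s' -> s <= x0 <= s' ->
    `|\int[mu]_(x in `[s, s']) f x - (s' - s) * f x0| <= L * (s' - s) ^+ 2.
  move=> ss /andP[x1 x2].
  have ic (c : R) : mu.-integrable `[s, s'] (EFin \o (fun=> c)).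
    by apply: integrable_itv => y; exact: cvg_cst.
  have cE (c : R) : (s' - s) * c = \int[mu]_(x in `[s, s']) c.
    by rewrite Rintegral_cst// mu_itv// mulrC.
  rewrite cE -RintegralB// (_ : L * _ = (s' - s) * (L * (s' - s))); last by ring.
  rewrite cE; apply: norm_Rintegral_le => //.
    apply: measurable_funB => //; apply: measurable_funTS.
    exact: continuous_measurable_fun.
  move=> x; rewrite /= in_itv/= => /andP[x3 x4]; apply: le_trans (fL _ _) _.
  by rewrite ler_wpM2l// ler_norml; apply/andP; split; lra.
case: (leP 0 h) => h0.
  rewrite rint0B ?lerDl//; have := key t (t + h) t.
  by rewrite lerDl lexx h0 addrAC subrr add0r => /(_ isT isT).
have := key (t + h) t t; rewrite gerDl lexx (ltW h0) => /(_ isT isT).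
rewrite -rint0B//; last by rewrite gerDl ltW.
rewrite -normrN; congr (_ <= _); last by ring.
by congr (`|_|); ring.
Qed.

Lemma ae_dominated f g : measurable_fun [set: R] f ->
  mu.-integrable [set: R] (EFin \o g) -> (forall x, 0 <= g x) ->
  (\forall x \ae mu, `|f x| <= g x) ->
  mu.-integrable [set: R] (EFin \o f) /\ \int[mu]_x `|f x| <= \int[mu]_x g x.
Proof.
move=> mf ig g0 fg.
have mnf : measurable_fun [set: R] (fun x => `|f x|%:E).
  by apply/measurable_EFinP; exact: measurableT_comp.
have le : (\int[mu]_x `|f x|%:E <= \int[mu]_x (g x)%:E)%E.
  apply: ae_ge0_le_integral => //.
  - by move=> x _; rewrite lee_fin.
  - by case/integrableP : ig.
  - by apply: (@filterS _ _ (ae_filter_ringOfSetsType mu) _ _ _ fg) => x h _; rewrite lee_fin.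
have fin := integrable_fin_num measurableT ig.
have i_f : mu.-integrable [set: R] (EFin \o f).
  apply/integrableP; split; first exact/measurable_EFinP.
  by apply: le_lt_trans le _; rewrite ltey_eq fin.
split => //; rewrite -lee_fin !fineK//.
exact: (integrable_fin_num measurableT (integrable_normr measurableT i_f)).
Qed.

Variable m : R -> R.
Hypothesis m0 : forall u, 0 < m u.
Hypothesis mm : measurable_fun [set: R] m.
Hypothesis mint : (\int[mu]_u (m u / (u ^+ 2 + 1))%:E < +oo)%E.

Definition mweight u : R := (1 + m u) * (1 + u ^+ 2)^-1.

Lemma mweight_ge0 u : 0 <= mweight u.
Proof. by rewrite mulr_ge0 ?oneDsqrV_ge0// addr_ge0// ltW. Qed.

Lemma integrable_mweight : mu.-integrable [set: R] (EFin \o mweight).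
Proof.
have -> : mweight = fun u => (1 + u ^+ 2)^-1 + m u / (u ^+ 2 + 1).
  by apply/funext => u; rewrite /mweight mulrDl mul1r (addrC (u ^+ 2)).
apply: integrable_addr => //; first exact: integrable_oneDsqrV.
apply/integrableP; split.
  apply/measurable_EFinP; apply: measurable_funM => //.
  rewrite (_ : (fun u => _) = fun u : R => (1 + u ^+ 2)^-1).
    by apply: continuous_measurable_fun; exact: continuous_oneDsqrV.
  by apply/funext => u; rewrite addrC.
under eq_integral => u _.
  rewrite /= ger0_norm; last by rewrite divr_ge0 ?(ltW (m0 _))// addr_ge0// sqr_ge0.
  over.
exact: mint.
Qed.

Lemma sqrtm_le u : Num.sqrt (m u) <= 1 + m u.
Proof.
have h : Num.sqrt (m u) ^+ 2 = m u by rewrite sqr_sqrtr// ltW.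
have := sqr_ge0 (Num.sqrt (m u) - 1); have := sqrtr_ge0 (m u); nra.
Qed.

(** The factor 1 + |u| of [cubic_weight] is spent on [wint], the factor 1 + u^2 on the denominator
    of [mweight], and sqrt m <= 1 + m does the rest. *)
Lemma wint_sqrtm P (B : R) : 0 <= B -> measurable_fun [set: R] (fun u => Num.sqrt (m u) * P u) ->
  (\forall u \ae mu, cubic_weight u * `|P u| <= B) ->
  wint (fun u => Num.sqrt (m u) * P u) /\
  \int[mu]_u ((1 + `|u|) * `|Num.sqrt (m u) * P u|) <= B * \int[mu]_u mweight u.
Proof.
move=> B0 mP PB.
have mf : measurable_fun [set: R] (fun u => (1 + `|u|) * (Num.sqrt (m u) * P u)).
  apply: measurable_funM => //; apply: continuous_measurable_fun => u.
  by apply: cvgD; [exact: cvg_cst|exact: norm_continuous].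
have [|||i le] := @ae_dominated _ (fun u => B * mweight u) mf.
- by apply: integrable_mulrl => //; exact: integrable_mweight.
- by move=> u; rewrite mulr_ge0// mweight_ge0.
- apply: (@filterS _ _ (ae_filter_ringOfSetsType mu) _ _ _ PB) => u h.
  have u2 : 0 < 1 + u ^+ 2 by rewrite ltr_wpDr// sqr_ge0.
  rewrite /mweight mulrA ler_pdivlMr// !normrM (ger0_norm (sqrtr_ge0 _)).
  rewrite (ger0_norm (x := 1 + `|u|)) ?addr_ge0//.
  have -> : (1 + `|u|) * (Num.sqrt (m u) * `|P u|) * (1 + u ^+ 2) =
    Num.sqrt (m u) * (cubic_weight u * `|P u|) by rewrite /cubic_weight; ring.
  rewrite mulrC; apply: ler_pM => //; last exact: sqrtm_le.
  by rewrite mulr_ge0// (le_trans ler01)// cubic_weight_ge1.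
split => //; rewrite -RintegralZl//; last exact: integrable_mweight.
apply: le_trans le; apply: le_Rintegral => //.
- exact: (wint_norm i).
- exact: integrable_normr.
- by move=> u _; rewrite [leRHS]normrM (ger0_norm (x := 1 + `|u|))// addr_ge0.
Qed.

End Core.

(** * The derivative of each coefficient of the process *)

Section ProcessCore.
Variable R : realType.
Notation mu := (@lebesgue_measure R).
Implicit Types (P Q : R -> R) (s t u : R).

Lemma wintN P : wint P -> wint (fun u => - P u).
Proof.
move=> h; rewrite /wint (_ : (fun u => _) = fun u => - ((1 + `|u|) * P u)).
  exact: integrable_oppf.
by apply/funext => u; rewrite mulrN.
Qed.

Lemma wnormE P Q : wint P -> wint Q -> wnorm P Q =
  \int[mu]_u ((1 + `|u|) * `|P u|) + \int[mu]_u ((1 + `|u|) * `|Q u|).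
Proof. by move=> /wint_norm hP /wint_norm hQ; rewrite -RintegralD. Qed.

Lemma wnormCN P Q : wnorm Q (fun u => - P u) = wnorm P Q.
Proof. by apply: eq_Rintegral => u _; rewrite normrN addrC. Qed.

Lemma fourier_inversion_C (g G : R -> R[i]) : is_fourier g G ->
  wint (fun u => complex.Re (G u)) -> wint (fun u => complex.Im (G u)) ->
  forall s t, s < t ->
  2 * pi * (\int[mu]_(x in `[s, t]) complex.Re (g x)) =
    \int[mu]_(y in `[s, t]) gammaR (fun u => complex.Re (G u)) (fun u => complex.Im (G u)) y /\
  2 * pi * (\int[mu]_(x in `[s, t]) complex.Im (g x)) =
    \int[mu]_(y in `[s, t]) gammaR (fun u => complex.Im (G u)) (fun u => - complex.Re (G u)) y.
Proof.
move=> FG wP wQ s t st; have [gL _ _] := FG; have [m1 m2 _] := gL.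
have a2 := L2_sqr_lty m1 gL (sqr_Re_le g); have b2 := L2_sqr_lty m2 gL (sqr_Im_le g).
have cP := fourier_cvg_Re FG; have cQ := fourier_cvg_Im FG.
have mN : measurable_fun [set: R] (fun x => - complex.Re (g x)) by exact: measurableT_comp.
have eRe n : (\int[mu]_u ((fourier_Re (fun x => complex.Re (g x)) (fun x => complex.Im (g x)) n u -
    complex.Re (G u)) ^+ 2)%:E =
    \int[mu]_u ((complex.Re (fourier_part g n u) - complex.Re (G u)) ^+ 2)%:E)%E.
  by apply: eq_integral => u _; rewrite Re_fourier_part.
have eIm n : (\int[mu]_u ((fourier_Re (fun x => complex.Im (g x)) (fun x => - complex.Re (g x)) n u -
    complex.Im (G u)) ^+ 2)%:E =
    \int[mu]_u ((complex.Im (fourier_part g n u) - complex.Im (G u)) ^+ 2)%:E)%E.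
  by apply: eq_integral => u _; rewrite Im_fourier_part.
split.
  apply: (@fourier_inversion _ _ (fun x => complex.Im (g x))) => //.
    by under eq_fun do rewrite eRe.
  by under eq_fun do rewrite eIm.
(* Inversion for -i g, whose real part is Im g and whose transform is -i G. *)
apply: (@fourier_inversion _ _ (fun x => - complex.Re (g x))) => //.
- by under eq_integral do rewrite sqrrN.
- exact: wintN.
- by under eq_fun do rewrite eIm.
- apply: cvg_trans cP; apply: near_eq_cvg; near=> n.
  apply: eq_integral => u _; rewrite Re_fourier_part// /fourier_Re.
  rewrite !oscIN//; last 2 first.
  + exact: L2_Im_itv.
  + exact: L2_Re_itv.
  by congr (_ %:E); ring.
Unshelve. all: by end_near. Qed.

Variable m : R -> R.
Hypothesis m0 : forall u, 0 < m u.
Hypothesis mm : measurable_fun [set: R] m.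
Hypothesis mint : (\int[mu]_u (m u / (u ^+ 2 + 1))%:E < +oo)%E.

Lemma process_derivative : exists C A : R, [/\ 0 <= C, 1 <= A &
  forall n, exists w : R -> R[i], [/\ forall t, normc (w t) <= C * A ^+ n,
    forall s t, normc (w s - w t) <= C * A ^+ n * `|s - t| &
    forall t h, normc (int0 (Sop m (fun x => (hermite n x)%:C)) (t + h) -
      int0 (Sop m (fun x => (hermite n x)%:C)) t - h%:C * w t) <= C * A ^+ n * h ^+ 2]].
Proof.
have [C [A [C0 A1 HD]]] := hermite_fourier_decay R.
pose M : R := \int[mu]_u mweight m u.
have M0 : 0 <= M by apply: Rintegral_ge0 => u _; exact: mweight_ge0.
have A0 : 0 <= A by lra.
(* Each C M bounds the weighted integral of one component of sqrt m H; the outer 2 adds the real and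
   imaginary parts of the derivative. The factor 1/(2 pi) is merely bounded by 1. *)
exists (2 * (C * M + C * M)), A; split => //; first by rewrite mulr_ge0// addr_ge0// mulr_ge0.
move=> n; set Sn := Sop m _.
have AN : 0 <= A ^+ n by rewrite exprn_ge0.
have CAN : 0 <= C * A ^+ n by rewrite mulr_ge0.
have B0 : 0 <= 2 * (C * M + C * M) * A ^+ n by rewrite !mulr_ge0// addr_ge0// mulr_ge0.
have [[g0 Sg]|nS] := pselect (exists g, S_spec m (fun x => (hermite n x)%:C) g); last first.
  have -> : Sn = fun=> 0.
    by rewrite /Sn /Sop; case: xgetP => [g _ /= Sg|//]; exfalso; apply: nS; exists g.
  have I0 t : int0 (fun=> 0 : R[i]) t = 0.
    by rewrite int0E /rint0 /=; case: ifP => _; rewrite /Rintegral integral0 ?oppr0.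
  exists (fun=> 0); split => [t|s t|t h].
  - by rewrite normc0.
  - by rewrite subr0 normc0 mulr_ge0.
  - by rewrite !I0 mulr0 !subr0 normc0 mulr_ge0// sqr_ge0.
have {g0 Sg} : S_spec m (fun x => (hermite n x)%:C) Sn.
  by rewrite /Sn /Sop; apply: xgetPex; exists g0.
move=> [_ gL [H FH FG]].
have [_ [mG1 mG2 _] _] := FG.
have ReE u : complex.Re ((Num.sqrt (m u))%:C * H u) = Num.sqrt (m u) * complex.Re (H u).
  by case: (H u) => x y /=; rewrite mul0r subr0.
have ImE u : complex.Im ((Num.sqrt (m u))%:C * H u) = Num.sqrt (m u) * complex.Im (H u).
  by case: (H u) => x y /=; rewrite mul0r addr0.
have ReF := funext ReE; have ImF := funext ImE.
rewrite ReF in mG1; rewrite ImF in mG2.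
have HH := HD n H FH.
have [|w1 b1] := wint_sqrtm m0 mm mint CAN mG1.
  by apply: (@filterS _ _ (ae_filter_ringOfSetsType mu) _ _ _ HH) => u [].
have [|w2 b2] := wint_sqrtm m0 mm mint CAN mG2.
  by apply: (@filterS _ _ (ae_filter_ringOfSetsType mu) _ _ _ HH) => u [].
pose P u := Num.sqrt (m u) * complex.Re (H u).
pose Q u := Num.sqrt (m u) * complex.Im (H u).
have W0 : wnorm P Q <= (C * M + C * M) * A ^+ n.
  rewrite wnormE//; apply: le_trans (lerD b1 b2) _.
  by rewrite -/M le_eqVlt; apply/orP; left; apply/eqP; ring.
have w3 : wint (fun u => - P u) by exact: wintN.
have p2 : 1 <= 2 * pi :> R by have := pi_ge2 R; lra.
have p0 : 0 < 2 * pi :> R by lra.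
pose r : R := (2 * pi)^-1.
have r0 : 0 <= r by rewrite invr_ge0 ltW.
have r1 : r <= 1 by rewrite invf_le1.
pose f1 y := r * gammaR P Q y; pose f2 y := r * gammaR Q (fun u => - P u) y.
have W1 : 0 <= wnorm P Q by apply: le_trans (gamma_le 0 w1 w2).
have lip1 x y : `|f1 x - f1 y| <= wnorm P Q * `|x - y|.
  rewrite /f1 -mulrBr normrM (ger0_norm r0); apply: le_trans (gamma_lip x y w1 w2).
  by rewrite ler_piMl.
have lip2 x y : `|f2 x - f2 y| <= wnorm P Q * `|x - y|.
  rewrite /f2 -mulrBr normrM (ger0_norm r0) -wnormCN; apply: le_trans (gamma_lip x y w2 w3).
  by rewrite ler_piMl.
have le1 x : `|f1 x| <= wnorm P Q.
  by rewrite normrM (ger0_norm r0); apply: le_trans (gamma_le x w1 w2); rewrite ler_piMl.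
have le2 x : `|f2 x| <= wnorm P Q.
  by rewrite normrM (ger0_norm r0) -wnormCN; apply: le_trans (gamma_le x w2 w3); rewrite ler_piMl.
have inv := fourier_inversion_C FG.
have NReF : (fun u => - complex.Re ((Num.sqrt (m u))%:C * H u)) = (fun u => - P u).
  by apply/funext => u; rewrite ReE.
rewrite ReF ImF NReF in inv.
have E1 t : rint0 (fun x => complex.Re (Sn x)) t = rint0 f1 t.
  apply: rint0_eq => s s' ss; have [h _] := inv w1 w2 s s' ss.
  rewrite RintegralZl//; last by apply: integrable_itv; exact: continuous_gamma.
  by rewrite -h /r mulKf// gt_eqF.
have E2 t : rint0 (fun x => complex.Im (Sn x)) t = rint0 f2 t.
  apply: rint0_eq => s s' ss; have [_ h] := inv w1 w2 s s' ss.
  rewrite RintegralZl//; last by apply: integrable_itv; exact: continuous_gamma.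
  by rewrite -h /r mulKf// gt_eqF.
exists (fun t => f1 t +i* f2 t); split => [t|s t|t h].
- apply: le_trans (normc_le_sum _) _ => /=.
  by have := le1 t; have := le2 t; have := W0; rewrite -mulrA; lra.
- apply: le_trans (normc_le_sum _) _ => /=.
  have := ler_wpM2r (normr_ge0 (s - t)) W0.
  by have := lip1 s t; have := lip2 s t; rewrite -!mulrA; lra.
- apply: le_trans (normc_le_sum _) _; rewrite !int0E !E1 !E2 /=.
  rewrite !mul0r subr0 addr0.
  have := ler_wpM2r (sqr_ge0 h) W0.
  have := rint0_taylor t h lip1; have := rint0_taylor t h lip2; rewrite -!mulrA; lra.
Qed.

End ProcessCore.

(** * Unconditional sums *)

Section Summation.
Variables (R : realType) (T : choiceType).
Implicit Types (D : set T) (u v : T -> R) (F G : T -> R[i]) (k : R).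

Lemma sum_uniq_sub_le (s t : seq T) u : (forall x, 0 <= u x) -> uniq s ->
  {subset s <= t} -> \sum_(x <- s) u x <= \sum_(x <- t) u x.
Proof.
move=> u0; elim: s t => [|x s IH] t /=; first by rewrite big_nil sumr_ge0.
move=> /andP[xs us] st.
have xt : x \in t by apply: st; rewrite inE eqxx.
rewrite big_cons (big_rem _ xt) /= lerD2l; apply: IH => // y ys.
have yx : y != x by apply: contraNneq xs => <-.
by apply: rem_mem => //; apply: st; rewrite inE ys orbT.
Qed.

Lemma esum_le_fset u D (M : R) : (forall x, 0 <= u x) ->
  (forall s : seq T, uniq s -> \sum_(x <- s) u x <= M) ->
  (\esum_(x in D) (u x)%:E <= M%:E)%E.
Proof.
move=> u0 H; apply: ge_ereal_sup => _ [X [fX XD] <-].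
by rewrite fsbig_finite//= sumEFin lee_fin H// fset_uniq.
Qed.

Lemma esumZ_le D u k : 0 <= k -> (forall x, 0 <= u x) ->
  (\esum_(x in D) (k * u x)%:E <= k%:E * \esum_(x in D) (u x)%:E)%E.
Proof.
move=> k0 u0; apply: ge_ereal_sup => _ [X [fX XD] <-].
rewrite fsbig_finite//=; under eq_bigr do rewrite EFinM.
rewrite -ge0_sume_distrr; last by move=> i _; rewrite lee_fin.
apply: lee_wpmul2l; first by rewrite lee_fin.
rewrite -fsbig_finite//; apply: esum_ge; by exists X.
Qed.

Lemma esumZ D u k : 0 <= k -> (forall x, 0 <= u x) ->
  (\esum_(x in D) (k * u x)%:E = k%:E * \esum_(x in D) (u x)%:E)%E.
Proof.
move=> k0 u0; apply/eqP; rewrite eq_le esumZ_le//=.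
have [->|kn0] := eqVneq k 0.
  by rewrite mul0e esum_ge0// => x _; rewrite mul0r.
have {kn0}k0' : 0 < k by rewrite lt_neqAle eq_sym kn0.
rewrite muleC -lee_pdivlMr//.
have /(@esumZ_le D (fun x => k * u x) k^-1) : 0 <= k^-1 by rewrite invr_ge0 ltW.
move=> H; rewrite muleC; apply: le_trans (H _); last by move=> x; rewrite mulr_ge0.
by apply: le_esum => x _; rewrite mulKf// gt_eqF.
Qed.

Definition rsummable D u := (\esum_(x in D) `|u x|%:E < +oo)%E.

Lemma esum_fin D u : (forall x, 0 <= u x) -> (\esum_(x in D) (u x)%:E < +oo)%E ->
  (\esum_(x in D) (u x)%:E)%E \is a fin_num.
Proof. by move=> u0 h; rewrite ge0_fin_numE// esum_ge0// => x _; rewrite lee_fin. Qed.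

(** This frees [rsum] from the splitting into positive and negative parts: any difference of
    nonnegative summable families will do, from which additivity and change of sign follow. *)
Lemma rsum_sub D u v : (forall x, 0 <= u x) -> (forall x, 0 <= v x) ->
  (\esum_(x in D) (u x)%:E < +oo)%E -> (\esum_(x in D) (v x)%:E < +oo)%E ->
  rsum D (fun x => u x - v x) =
  fine (\esum_(x in D) (u x)%:E) - fine (\esum_(x in D) (v x)%:E).
Proof.
move=> u0 v0 hu hv.
have su : summable D (EFin \o u).
  by rewrite /summable (eq_esum (b := EFin \o u))// => x _; rewrite /= ger0_norm.
have sv : summable D (EFin \o v).
  by rewrite /summable (eq_esum (b := EFin \o v))// => x _; rewrite /= ger0_norm.
have eu x : D x -> (0 <= (EFin \o u) x)%E by rewrite /= lee_fin.
have ev x : D x -> (0 <= (EFin \o v) x)%E by rewrite /= lee_fin.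
have := esumB su sv eu ev; set w := fun x => u x - v x.
have -> : (fun x => (EFin \o u) x - (EFin \o v) x)%E = EFin \o w.
  by apply/funext => x; rewrite /= -EFinB.
rewrite funerpos funerneg => H.
have f1 : (\esum_(x in D) (w^\+ x)%:E)%E \is a fin_num.
  rewrite ge0_fin_numE; last by apply: esum_ge0 => x _; rewrite lee_fin.
  apply: le_lt_trans hu; apply: le_esum => x _.
  by rewrite lee_fin /funrpos ge_max u0 andbT /w gerBl v0.
have f2 : (\esum_(x in D) (w^\- x)%:E)%E \is a fin_num.
  rewrite ge0_fin_numE; last by apply: esum_ge0 => x _; rewrite lee_fin.
  apply: le_lt_trans hv; apply: le_esum => x _.
  by rewrite lee_fin /funrneg ge_max v0 andbT /w opprB gerBl u0.
have := congr1 fine H; rewrite fineB// fineB//; exact: esum_fin.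
Qed.

Lemma rsummable_pos D u : rsummable D u -> (\esum_(x in D) (u^\+ x)%:E < +oo)%E.
Proof.
apply: le_lt_trans; apply: le_esum => x _; rewrite lee_fin /funrpos ge_max.
by rewrite normr_ge0 ler_norm.
Qed.

Lemma rsummable_neg D u : rsummable D u -> (\esum_(x in D) (u^\- x)%:E < +oo)%E.
Proof.
apply: le_lt_trans; apply: le_esum => x _; rewrite lee_fin /funrneg ge_max.
by rewrite normr_ge0 -normrN ler_norm.
Qed.

Lemma esum_addE D u v : (forall x, 0 <= u x) -> (forall x, 0 <= v x) ->
  (\esum_(x in D) (u x + v x)%:E = \esum_(x in D) (u x)%:E + \esum_(x in D) (v x)%:E)%E.
Proof.
move=> u0 v0; rewrite -esumD; last 2 first.
- by move=> x _; rewrite lee_fin.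
- by move=> x _; rewrite lee_fin.
by apply: eq_esum => x _; rewrite EFinD.
Qed.

Lemma esum_add_lty D u v : (forall x, 0 <= u x) -> (forall x, 0 <= v x) ->
  (\esum_(x in D) (u x)%:E < +oo)%E -> (\esum_(x in D) (v x)%:E < +oo)%E ->
  (\esum_(x in D) (u x + v x)%:E < +oo)%E.
Proof. by move=> u0 v0 hu hv; rewrite esum_addE// lte_add_pinfty. Qed.

Lemma rsumD D u v : rsummable D u -> rsummable D v ->
  rsum D (fun x => u x + v x) = rsum D u + rsum D v.
Proof.
move=> hu hv.
have pu := rsummable_pos hu; have nu := rsummable_neg hu.
have pv := rsummable_pos hv; have nv := rsummable_neg hv.
have -> : (fun x => u x + v x) = fun x => (u^\+ x + v^\+ x) - (u^\- x + v^\- x).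
  by apply/funext => x; have /(congr1 (@^~ x)) := funrDB u v; rewrite !fctE.
rewrite rsum_sub; last 4 first.
- by move=> x; rewrite addr_ge0.
- by move=> x; rewrite addr_ge0.
- exact: esum_add_lty.
- exact: esum_add_lty.
rewrite !esum_addE// !fineD ?esum_fin// /rsum; ring.
Qed.

Lemma rsumN D u : rsummable D u -> rsum D (fun x => - u x) = - rsum D u.
Proof.
move=> hu; have pu := rsummable_pos hu; have nu := rsummable_neg hu.
have -> : (fun x => - u x) = fun x => u^\- x - u^\+ x.
  by apply/funext => x; have /(congr1 (@^~ x)) := funrposBneg u; rewrite !fctE => <-; rewrite opprB.
by rewrite rsum_sub// /rsum opprB.
Qed.

Lemma rsumZ D u k : rsummable D u -> rsum D (fun x => k * u x) = k * rsum D u.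
Proof.
move=> hu.
have pu := rsummable_pos hu; have nu := rsummable_neg hu.
have pos c : 0 <= c -> rsum D (fun x => c * u x) = c * rsum D u.
  move=> c0; rewrite /rsum ge0_funrposM// ge0_funrnegM// !esumZ//.
  by rewrite !fineM ?esum_fin//= mulrBr.
case: (leP 0 k) => [/pos//|k0].
rewrite (_ : (fun x => _) = fun x => (- k) * (- u x)); last first.
  by apply/funext => x; rewrite mulrNN.
have -> : (fun x => - k * - u x) = fun x => - (- k * u x).
  by apply/funext => x; rewrite mulrN.
rewrite rsumN; first by rewrite pos ?mulNr ?opprK// oppr_ge0 ltW.
rewrite /rsummable (eq_esum (b := fun x => (- k * `|u x|)%:E)).
  by rewrite esumZ ?oppr_ge0 ?ltW// lte_mul_pinfty// lee_fin oppr_ge0 ltW.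
by move=> x _; rewrite normrM normrN (ltr0_norm k0).
Qed.

Lemma rsummableZ D u k : rsummable D u -> rsummable D (fun x => k * u x).
Proof.
move=> hu; rewrite /rsummable (eq_esum (b := fun x => (`|k| * `|u x|)%:E)).
  by rewrite esumZ// lte_mul_pinfty.
by move=> x _; rewrite normrM.
Qed.

Lemma rsummable_le D u v : (forall x, D x -> `|u x| <= v x) ->
  (\esum_(x in D) (v x)%:E < +oo)%E -> rsummable D u.
Proof. by move=> uv; apply: le_lt_trans; apply: le_esum => x Dx; rewrite lee_fin uv. Qed.

Lemma rsummableD D u v : rsummable D u -> rsummable D v -> rsummable D (fun x => u x + v x).
Proof.
move=> hu hv; have := esum_add_lty (fun x => normr_ge0 (u x)) (fun x => normr_ge0 (v x)) hu hv.
by apply: rsummable_le => x _; exact: ler_normD.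
Qed.

Lemma rsum_le D u v : (forall x, D x -> `|u x| <= v x) -> (forall x, 0 <= v x) ->
  (\esum_(x in D) (v x)%:E < +oo)%E -> `|rsum D u| <= fine (\esum_(x in D) (v x)%:E).
Proof.
move=> uv v0 hv; have hu := rsummable_le uv hv.
have pu := rsummable_pos hu; have nu := rsummable_neg hu.
have P : fine (\esum_(x in D) (u^\+ x)%:E) <= fine (\esum_(x in D) (v x)%:E).
  apply: fine_le; rewrite ?esum_fin//; apply: le_esum => x Dx.
  rewrite lee_fin /funrpos ge_max v0 andbT; apply: le_trans (uv _ Dx); exact: ler_norm.
have N : fine (\esum_(x in D) (u^\- x)%:E) <= fine (\esum_(x in D) (v x)%:E).
  apply: fine_le; rewrite ?esum_fin//; apply: le_esum => x Dx.
  rewrite lee_fin /funrneg ge_max v0 andbT; apply: le_trans (uv _ Dx).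
  by rewrite -normrN ler_norm.
have P0 : 0 <= fine (\esum_(x in D) (u^\+ x)%:E).
  by apply: fine_ge0; apply: esum_ge0 => x _; rewrite lee_fin.
have N0 : 0 <= fine (\esum_(x in D) (u^\- x)%:E).
  by apply: fine_ge0; apply: esum_ge0 => x _; rewrite lee_fin.
by rewrite ler_norml /rsum; apply/andP; split; lra.
Qed.

Definition csummable D F := (\esum_(x in D) (normc (F x))%:E < +oo)%E.

Lemma normc_Re (z : R[i]) : `|complex.Re z| <= normc z.
Proof.
rewrite -(@ler_pXn2r _ 2)// ?nnegrE ?normc_ge0// normc_sqr real_normK ?num_real//.
by rewrite lerDl sqr_ge0.
Qed.

Lemma normc_Im (z : R[i]) : `|complex.Im z| <= normc z.
Proof.
rewrite -(@ler_pXn2r _ 2)// ?nnegrE ?normc_ge0// normc_sqr real_normK ?num_real//.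
by rewrite lerDr sqr_ge0.
Qed.

Lemma csummable_Re D F : csummable D F -> rsummable D (fun x => complex.Re (F x)).
Proof. by apply: rsummable_le => x _; exact: normc_Re. Qed.

Lemma csummable_Im D F : csummable D F -> rsummable D (fun x => complex.Im (F x)).
Proof. by apply: rsummable_le => x _; exact: normc_Im. Qed.

Lemma rsum_lin3 D (p r : R) u v (w : T -> R) :
  rsummable D u -> rsummable D v -> rsummable D w ->
  rsum D (fun x => (p * u x + r * v x) + w x) = p * rsum D u + r * rsum D v + rsum D w.
Proof.
move=> hu hv hw; have pu := rsummableZ p hu; have rv := rsummableZ r hv.
rewrite rsumD//; last exact: rsummableD.
by rewrite rsumD// (rsumZ _ hu) (rsumZ _ hv).
Qed.

Lemma csum_lin D (a : R[i]) F G : csummable D F -> csummable D G ->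
  csum D (fun x => a * F x + G x) = a * csum D F + csum D G.
Proof.
move=> hF hG.
have f1 := csummable_Re hF; have f2 := csummable_Im hF.
have g1 := csummable_Re hG; have g2 := csummable_Im hG.
case: a => p q; rewrite /csum.
have -> : (fun x => complex.Re ((p +i* q) * F x + G x)) =
    fun x => (p * complex.Re (F x) + - q * complex.Im (F x)) + complex.Re (G x).
  by apply/funext => x; case: (F x) => f f'; case: (G x) => g g' /=; rewrite mulNr.
have -> : (fun x => complex.Im ((p +i* q) * F x + G x)) =
    fun x => (p * complex.Im (F x) + q * complex.Re (F x)) + complex.Im (G x).
  by apply/funext => x; case: (F x) => f f'; case: (G x) => g g' /=.
by rewrite (rsum_lin3 p (- q) f1 f2 g1) (rsum_lin3 p q f2 f1 g2) /= mulNr.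
Qed.

Lemma normc_csum_le D F (v : T -> R) : (forall x, D x -> normc (F x) <= v x) ->
  (forall x, 0 <= v x) -> (\esum_(x in D) (v x)%:E < +oo)%E ->
  normc (csum D F) <= 2 * fine (\esum_(x in D) (v x)%:E).
Proof.
move=> Fv v0 hv.
have h1 : `|rsum D (fun x => complex.Re (F x))| <= fine (\esum_(x in D) (v x)%:E).
  by apply: rsum_le => // x Dx; apply: le_trans (Fv _ Dx); exact: normc_Re.
have h2 : `|rsum D (fun x => complex.Im (F x))| <= fine (\esum_(x in D) (v x)%:E).
  by apply: rsum_le => // x Dx; apply: le_trans (Fv _ Dx); exact: normc_Im.
by apply: le_trans (normc_le_sum _) _; rewrite /csum /=; lra.
Qed.

End Summation.

(** * Nuclearity of the weights *)

Section Nuclearity.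
Variables (R : realType) (phi : weight R).
Implicit Types (al be ga : gindex).

Definition wt al : nat := (\sum_(a <- al) a.+1)%N.

Lemma weight_fun_ge0 n : 0 <= phi n.
Proof. by case: phi => w w0 wi wl /=; rewrite -w0; apply: wi. Qed.

Lemma cw_gt0 al : 0 < cw phi al.
Proof. by rewrite (lt_le_trans ltr01)// cw_ge1. Qed.

Lemma cw_sub al be : (al `<=` be)%fset -> cw phi al <= cw phi be.
Proof.
move=> /fsubsetP ab; rewrite /cw ler_expR; apply: sum_uniq_sub_le => //.
by move=> a; exact: weight_fun_ge0.
Qed.

Lemma wt_sub al be : (al `<=` be)%fset -> (wt al <= wt be)%N.
Proof.
move=> /fsubsetP ab; rewrite -(@ler_nat R) /wt !natr_sum.
exact: (@sum_uniq_sub_le R _ _ _ (fun a => a.+1%:R)).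
Qed.

Lemma weight_slope : exists2 xi : R, 0 < xi &
  forall al, expR (xi * (wt al)%:R) <= cw phi al.
Proof.
case: (weight_ge phi) => xi xi2 h; exists xi.
  by apply: lt_trans xi2; rewrite divr_gt0// ln_gt0// ltr1n.
move=> al; rewrite /cw ler_expR /wt natr_sum mulr_sumr.
by apply: ler_sum => a _; exact: h.
Qed.

(** Because c_alpha >= exp(xi wt alpha), any q with |B| <= exp(xi q) works. Here geometric growth in
    the index is absorbed by the weights. *)
Lemma cw_expn (B : R) : exists q : nat, forall al, B ^+ wt al <= cw phi al ^+ q.
Proof.
have [xi xi0 h] := weight_slope.
pose q := (Num.truncn (`|B| / xi)).+1.
have qB : `|B| <= expR (xi * q%:R).
  apply: le_trans (expR_ge1Dx _); apply: (@le_trans _ _ (xi * q%:R)); last by rewrite lerDr.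
  by rewrite mulrC -ler_pdivrMr// ltW// truncnS_gt.
exists q => al; apply: le_trans (ler_norm _) _; rewrite normrX.
apply: (@le_trans _ _ (expR (xi * q%:R) ^+ wt al)).
  by rewrite lerXn2r ?nnegrE ?expR_ge0.
rewrite -expRM_natr -mulrA (mulrC q%:R) mulrA expRM_natr.
by rewrite lerXn2r ?nnegrE ?expR_ge0 ?h// ltW// cw_gt0.
Qed.

(** The recursion on the largest element makes a sum of products over these sets factor as a product
    of terms 1 + x a. *)
Fixpoint subsets_below (k : nat) : seq gindex :=
  if k is k'.+1 then subsets_below k' ++ [seq (k' |` al)%fset | al <- subsets_below k']
  else [:: fset0].

Lemma subsets_belowP k al : (forall a, a \in al -> (a < k)%N) -> al \in subsets_below k.
Proof.
elim: k al => [|k IH] al H.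
  by rewrite inE; apply/eqP/fsetP => a; rewrite inE; apply/negbTE/negP => /H.
rewrite mem_cat; have [kal|kal] := boolP (k \in al).
  apply/orP; right; apply/mapP; exists (al `\ k)%fset; last by rewrite fsetD1K.
  apply: IH => a; rewrite !inE => /andP[ak /H]; rewrite ltnS leq_eqVlt.
  by rewrite (negbTE ak).
apply/orP; left; apply: IH => a aal; have := H _ aal; rewrite ltnS leq_eqVlt.
by case/orP => // /eqP ak; move: kal; rewrite -ak aal.
Qed.

Lemma subsets_below_lt k al a : al \in subsets_below k -> a \in al -> (a < k)%N.
Proof.
elim: k al => [|k IH] al; first by rewrite inE => /eqP ->; rewrite inE.
rewrite mem_cat => /orP[h /(IH _ h) /ltnW//|/mapP[be h ->]].
by rewrite !inE => /orP[/eqP->//|/(IH _ h) /ltnW].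
Qed.

Lemma sum_subsets_below (x : nat -> R) k :
  \sum_(al <- subsets_below k) \prod_(a <- al) x a = \prod_(a < k) (1 + x a).
Proof.
elim: k => [|k IH]; first by rewrite big_seq1 big_seq_fset0 big_ord0.
rewrite big_cat big_map big_ord_recr /= -IH mulrDr mulr1; congr (_ + _).
rewrite mulr_suml big_seq [RHS]big_seq; apply: eq_bigr => al al_in.
have kal : k \notin al by apply/negP => /(subsets_below_lt al_in); rewrite ltnn.
by rewrite (@big_fsetU1 _ _ _ _ k al x kal) /= mulrC.
Qed.

Lemma prod1D_le (r : R) k : 0 <= r -> r < 1 ->
  \prod_(a < k) (1 + r ^+ a.+1) <= expR ((1 - r)^-1).
Proof.
move=> r0 r1.
have d : 0 < 1 - r by rewrite subr_gt0.
apply: (@le_trans _ _ (expR (\sum_(a < k) r ^+ a.+1))).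
  rewrite expR_sum; apply: ler_prod => a _.
  by rewrite addr_ge0 ?exprn_ge0//= expR_ge1Dx.
rewrite ler_expR -[leRHS]mul1r ler_pdivlMr//.
have -> : (\sum_(a < k) r ^+ a.+1) * (1 - r) = r - r ^+ k.+1.
  elim: k => [|k IH]; first by rewrite big_ord0 mul0r expr1 subrr.
  by rewrite big_ord_recr /= mulrDl IH !exprS; ring.
have : 0 <= r ^+ k.+1 by rewrite exprn_ge0.
by lra.
Qed.

Definition cwV2 al : R := (cw phi al ^+ 2)^-1.

Lemma cwV2_ge0 al : 0 <= cwV2 al.
Proof. by rewrite invr_ge0 exprn_ge0// ltW// cw_gt0. Qed.

(** With r = exp(-2 xi) < 1, each term is at most a product of r^(a+1) over the entries, so finite
    sums are bounded by an Euler-type product, itself at most exp(1/(1-r)). *)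
Lemma esum_cwV2 : (\esum_(al in [set: gindex]) (cwV2 al)%:E < +oo)%E.
Proof.
have [xi xi0 h] := weight_slope.
pose r := expR (- (2 * xi)).
have r0 : 0 <= r by exact: expR_ge0.
have r1 : r < 1 by rewrite /r expR_lt1 oppr_lt0 mulr_gt0.
have le al : cwV2 al <= \prod_(a <- al) r ^+ a.+1.
  rewrite -expr_sum -/(wt al) /r -expRM_natr mulNr expRN
    lef_pV2 ?posrE ?expR_gt0 ?exprn_gt0 ?cw_gt0//.
  rewrite -mulrA expRM_natl lerXn2r ?nnegrE ?expR_ge0 ?h// ltW// cw_gt0.
apply: (@le_lt_trans _ _ (expR ((1 - r)^-1))%:E); last exact: ltry.
apply: esum_le_fset; first exact: cwV2_ge0.
move=> s us.
apply: (@le_trans _ _ (\sum_(al <- s) \prod_(a <- al) r ^+ a.+1)).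
  by apply: ler_sum => al _.
(* An entry a is smaller than its own contribution a+1 to [wt], so k exceeds every entry of every
   set in s. *)
pose k := (\sum_(al <- s) wt al).+1.
have sk : {subset s <= subsets_below k}.
  move=> al als; apply: subsets_belowP => a aal.
  rewrite /k ltnS (big_rem al)//= (leq_trans _ (leq_addr _ _))//.
  by rewrite /wt (big_rem a)//= (leq_trans (leqnSn a))// leq_addr.
apply: (le_trans (sum_uniq_sub_le _ us sk)).
  by move=> al; apply: prodr_ge0 => a _; rewrite exprn_ge0.
by rewrite sum_subsets_below prod1D_le.
Qed.

End Nuclearity.

(** * Multiplication operators and convergence in the strong dual *)

Section Operators.
Variables (R : realType) (phi : weight R).
Implicit Types (al be ga : gindex) (f g h k : gseries R) (x y : nat -> R[i]).
Implicit Types (C A N M : R) (p q : nat).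

Lemma normcD (z w : R[i]) : normc (z + w) <= normc z + normc w.
Proof. exact: le_normcD. Qed.

Lemma normc_sum (I : Type) (s : seq I) (P : pred I) (F : I -> R[i]) :
  normc (\sum_(i <- s | P i) F i) <= \sum_(i <- s | P i) normc (F i).
Proof.
elim/big_ind2 : _ => // [|z a w b za wb]; first by rewrite normc0.
exact: le_trans (normcD _ _) (lerD za wb).
Qed.

Lemma normcJ (z : R[i]) : normc (z^*) = normc z.
Proof. by case: z => a b /=; rewrite sqrrN. Qed.

Lemma normc_sign n : normc ((-1) ^+ n : R[i]) = 1.
Proof.
elim: n => [|n IH]; first by rewrite expr0 normc1.
by rewrite exprS normcM IH mulr1 /= sqrrN expr1n oppr0 expr0n addr0 sqrtr1.
Qed.

Lemma normc_real (r : R) : normc (r%:C) = `|r|.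
Proof. by rewrite /= expr0n addr0 sqrtr_sqr. Qed.

(** The degree-one series with coefficients x, in the shape of [fm] so that the process is an
    instance of it. *)
Definition gen x : gseries R := fun al => \sum_(n <- al | al == [fset n]%fset) x n.

Lemma gen_lin (r : R[i]) x y al :
  gen (fun n => r * x n + y n) al = r * gen x al + gen y al.
Proof. by rewrite /gen big_split /= -mulr_sumr. Qed.

Definition coef_bound x C A := forall n, normc (x n) <= C * A ^+ n.

Lemma gen_le x C A al : 0 <= C -> 1 <= A -> coef_bound x C A ->
  normc (gen x al) <= C * A ^+ wt al.
Proof.
move=> C0 A1 xb; have A0 : 0 <= A by lra.
have [[n ->]|nal] := pselect (exists n, al = [fset n]%fset).
  rewrite /gen /wt big_mkcond big_seq_fset1 eqxx big_seq_fset1.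
  by apply: le_trans (xb n) _; rewrite ler_wpM2l// ler_weXn2l// leqnSn.
rewrite /gen big1; first by rewrite normc0 mulr_ge0// exprn_ge0.
by move=> n /eqP aln; exfalso; apply: nal; exists n.
Qed.

(** Coefficientwise forms of membership in H_p and H_{-q}. Returning to sums costs spare powers of
    the weight, since only c_alpha^-2 is known to be summable; hence the exponents p + 2 and q + 2
    below. *)
Definition decay g N p := forall al, normc (g al) <= N * (cw phi al ^+ p)^-1.
Definition growth h M q := forall al, normc (h al) <= M * cw phi al ^+ q.

Lemma cwX_ge1 al p : 1 <= cw phi al ^+ p.
Proof. by rewrite exprn_ege1// cw_ge1. Qed.

Lemma decay_le g N p al : 0 <= N -> decay g N p -> normc (g al) <= N.
Proof.
move=> N0 /(_ al) h; apply: le_trans h _; rewrite ler_piMr// invf_le1 ?cwX_ge1//.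
by rewrite exprn_gt0// cw_gt0.
Qed.

Lemma card_wt al : (#|` al| <= wt al)%N.
Proof. by rewrite /wt -sum1_size; apply: leq_sum. Qed.

(** Each summand is at most C A^(wt ga) N, and ga has 2^|ga| <= 2^(wt ga) subsets; this crude count
    is absorbed later by [cw_expn]. *)
Lemma Mop_le x g C A N p ga : 0 <= C -> 1 <= A -> 0 <= N -> coef_bound x C A ->
  decay g N p -> normc (Mop (gen x) g ga) <= C * N * (2 * A) ^+ wt ga.
Proof.
move=> C0 A1 N0 xb gd; have A0 : 0 <= A by lra.
have AN n : 0 <= A ^+ n by rewrite exprn_ge0.
apply: le_trans (normc_sum _ _ _) _.
apply: (@le_trans _ _ (\sum_(al <- fpowerset ga) (C * A ^+ wt ga * N))).
  rewrite big_seq [leRHS]big_seq; apply: ler_sum => al; rewrite fpowersetE => ag.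
  rewrite !normcM normc_sign mul1r; apply: ler_pM; rewrite ?normc_ge0//.
    apply: le_trans (gen_le al C0 A1 xb) _.
    by rewrite ler_wpM2l// ler_weXn2l// wt_sub.
  exact: decay_le gd.
rewrite big_const_seq count_predT iter_addr_0 card_fpowerset -[leLHS]mulr_natr natrX.
rewrite exprMn (_ : _ * _ ^+ #|` ga| = C * N * (2 ^+ #|` ga| * A ^+ wt ga)); last by ring.
rewrite ler_wpM2l ?mulr_ge0// ler_wpM2r// ler_weXn2l ?card_wt//.
by rewrite ler1n.
Qed.

Let S0 : R := fine (\esum_(al in [set: gindex]) (cwV2 phi al)%:E).

Lemma S0_ge0 : 0 <= S0.
Proof. by apply: fine_ge0; apply: esum_ge0 => al _; rewrite lee_fin cwV2_ge0. Qed.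

Lemma esum_subT (D : set gindex) (u : gindex -> R) : (forall al, 0 <= u al) ->
  (\esum_(al in D) (u al)%:E <= \esum_(al in [set: gindex]) (u al)%:E)%E.
Proof.
move=> u0; rewrite esum_mkcond; apply: le_esum => al _.
by case: ifP => // _; rewrite lee_fin.
Qed.

Lemma esum_cwV2Z (D : set gindex) M : 0 <= M ->
  (\esum_(al in D) (M * cwV2 phi al)%:E <= (M * S0)%:E)%E.
Proof.
move=> M0; apply: le_trans (esum_subT _ _) _.
  by move=> al; rewrite mulr_ge0// cwV2_ge0.
rewrite esumZ//; last exact: cwV2_ge0.
rewrite EFinM /S0 fineK//; apply: esum_fin; [exact: cwV2_ge0|exact: esum_cwV2].
Qed.

Lemma csum_cwV2_le (D : set gindex) (F : gindex -> R[i]) M : 0 <= M ->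
  (forall al, D al -> normc (F al) <= M * cwV2 phi al) ->
  csummable D F /\ normc (csum D F) <= 2 * (M * S0).
Proof.
move=> M0 FM.
have le := @esum_cwV2Z D _ M0.
have lt : (\esum_(al in D) (M * cwV2 phi al)%:E < +oo)%E by apply: le_lt_trans le (ltry _).
have p al : 0 <= M * cwV2 phi al by rewrite mulr_ge0// cwV2_ge0.
split.
  by apply: le_lt_trans lt; apply: le_esum => al Dal; rewrite lee_fin FM.
apply: le_trans (normc_csum_le FM p lt) _.
rewrite ler_wpM2l// -lee_fin fineK//; exact: esum_fin.
Qed.

Definition adj_term f g ga al : R[i] := (-1) ^+ sigma al ga * (f al)^* * g (al `|` ga)%fset.

(** The weight grows with the set, so the decay of g at the union of al and ga gives c_al^-(p+2): p
    powers cancel A^(wt al), two remain for summation, uniformly in ga. *)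
Lemma adj_term_le x g C A N p ga al : 0 <= C -> 1 <= A -> 0 <= N -> coef_bound x C A ->
  (forall be, A ^+ wt be <= cw phi be ^+ p) -> decay g N (p + 2) ->
  normc (adj_term (gen x) g ga al) <= C * N * cwV2 phi al.
Proof.
move=> C0 A1 N0 xb Ap gd.
rewrite /adj_term !normcM normc_sign mul1r normcJ.
have c0 := cw_gt0 phi al.
have h1 : normc (gen x al) <= C * cw phi al ^+ p.
  by apply: le_trans (gen_le al C0 A1 xb) _; rewrite ler_wpM2l.
have h2 : normc (g (al `|` ga)%fset) <= N * (cw phi al ^+ (p + 2))^-1.
  apply: le_trans (gd _) _; rewrite ler_wpM2l// lef_pV2 ?posrE ?exprn_gt0 ?cw_gt0//.
  by rewrite lerXn2r ?nnegrE ?(ltW (cw_gt0 _ _))// cw_sub// fsubsetUl.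
apply: le_trans (ler_pM _ _ h1 h2) _; rewrite ?normc_ge0//.
rewrite /cwV2 exprD invfM [leLHS](_ : _ = C * N * (cw phi al ^+ 2)^-1 *
  (cw phi al ^+ p * (cw phi al ^+ p)^-1)); last by ring.
by rewrite mulfV ?mulr1// expf_neq0// gt_eqF.
Qed.

Lemma Madj_le x g C A N p ga : 0 <= C -> 1 <= A -> 0 <= N -> coef_bound x C A ->
  (forall be, A ^+ wt be <= cw phi be ^+ p) -> decay g N (p + 2) ->
  csummable [set al : gindex | [disjoint al & ga]%fset] (adj_term (gen x) g ga) /\
  normc (Madj (gen x) g ga) <= 2 * (C * N * S0).
Proof.
move=> C0 A1 N0 xb Ap gd; apply: csum_cwV2_le; first by rewrite mulr_ge0.
by move=> al _; exact: (adj_term_le ga al C0 A1 N0 xb Ap gd).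
Qed.

Lemma Mop_linr (a : R[i]) f g h ga : Mop f (a *: g + h) ga = a * Mop f g ga + Mop f h ga.
Proof.
rewrite /Mop mulr_sumr -big_split /=; apply: eq_bigr => al _.
rewrite !fctE /GRing.scale /=; ring.
Qed.

Lemma Mop_linl (a : R[i]) x y g ga :
  Mop (gen (fun n => a * x n + y n)) g ga = a * Mop (gen x) g ga + Mop (gen y) g ga.
Proof.
rewrite /Mop mulr_sumr -big_split /=; apply: eq_bigr => al _.
rewrite gen_lin; ring.
Qed.

Lemma conj_lin_real (r : R) (z w : R[i]) : (r%:C * z + w)^* = r%:C * z^* + w^*.
Proof.
by case: z => a b; case: w => c d; apply/eqP; rewrite eq_complex /=;
  apply/andP; split; apply/eqP; ring.
Qed.

End Operators.

(** * From coefficient bounds to the test and distribution spaces *)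

Section Spaces.
Variables (R : realType) (phi : weight R).
Implicit Types (al be ga : gindex) (f g h k : gseries R) (x y : nat -> R[i]).
Implicit Types (C A N M : R) (p q : nat).
Let S0 : R := fine (\esum_(al in [set: gindex]) (cwV2 phi al)%:E).
Let S0_ge0 : 0 <= S0 := S0_ge0 phi.

Lemma Madj_linr (a : R[i]) x g h C A N M p ga : 0 <= C -> 1 <= A -> 0 <= N -> 0 <= M ->
  coef_bound x C A -> (forall be, A ^+ wt be <= cw phi be ^+ p) ->
  decay phi g N (p + 2) -> decay phi h M (p + 2) ->
  Madj (gen x) (a *: g + h) ga = a * Madj (gen x) g ga + Madj (gen x) h ga.
Proof.
move=> C0 A1 N0 M0 xb Ap gd hd.
have [sg _] := Madj_le ga C0 A1 N0 xb Ap gd.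
have [sh _] := Madj_le ga C0 A1 M0 xb Ap hd.
rewrite /Madj -[RHS](csum_lin a sg sh); congr csum; apply/funext => al.
rewrite !fctE /GRing.scale /= /adj_term; ring.
Qed.

(** The adjoint is conjugate linear in its symbol, so the scalar is real; increments and difference
    quotients in t require no other. *)
Lemma Madj_linl (r : R) x y g C C' A N p ga : 0 <= C -> 0 <= C' -> 1 <= A -> 0 <= N ->
  coef_bound x C A -> coef_bound y C' A -> (forall be, A ^+ wt be <= cw phi be ^+ p) ->
  decay phi g N (p + 2) ->
  Madj (gen (fun n => r%:C * x n + y n)) g ga = r%:C * Madj (gen x) g ga + Madj (gen y) g ga.
Proof.
move=> C0 C'0 A1 N0 xb yb Ap gd.
have [sx _] := Madj_le ga C0 A1 N0 xb Ap gd.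
have [sy _] := Madj_le ga C'0 A1 N0 yb Ap gd.
rewrite /Madj -[RHS](csum_lin r%:C sx sy); congr csum; apply/funext => al.
rewrite gen_lin conj_lin_real /adj_term; ring.
Qed.

Lemma Hnorm_ge0 (p : int) g : 0 <= Hnorm phi p g.
Proof. exact: sqrtr_ge0. Qed.

Lemma Hsp_decay (p : int) g al : Hsp phi p g ->
  normc (g al) * cw phi al ^ p <= Hnorm phi p g.
Proof.
move=> hg; have c0 := cw_gt0 phi al.
have t0 : 0 <= normc (g al) * cw phi al ^ p.
  by rewrite mulr_ge0 ?normc_ge0// exprz_ge0// ltW.
rewrite -[leLHS]ger0_norm// -sqrtr_sqr; apply: ler_wsqrtr.
rewrite -lee_fin fineK; last first.
  by apply: esum_fin => // be; exact: Hterm_ge0.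
rewrite exprMn [X in _ * X]exprnP exprz_exp [p * _]mulrC.
apply: le_trans (@esum_subT _ [set al] _ (Hterm_ge0 phi p g)).
by rewrite esum_set1// lee_fin Hterm_ge0.
Qed.

Lemma test_decay g p : g \in test_set phi -> decay phi g (Hnorm phi p%:Z g) p.
Proof.
rewrite inE => /= hg al; rewrite ler_pdivlMr; first exact: (Hsp_decay al (hg p%:Z)).
by rewrite exprn_gt0// cw_gt0.
Qed.

Lemma dist_growth h : h \in dist_set phi -> exists M q, 0 <= M /\ growth phi h M q.
Proof.
rewrite inE => -[p hp]; exists (Hnorm phi (- p) h), `|p|%N; split; first exact: Hnorm_ge0.
move=> al; have c0 := cw_gt0 phi al.
have := Hsp_decay al hp; rewrite -ler_pdivlMr ?exprz_gt0// => H.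
apply: le_trans H _; rewrite ler_wpM2l ?Hnorm_ge0// invr_expz opprK.
by rewrite exprnP ler_weXz2l ?cw_ge1// abszE ler_norm.
Qed.

Lemma growth_dist h M q : growth phi h M q -> h \in dist_set phi.
Proof.
(* One order more than q: squaring leaves exactly c_alpha^-2. *)
move=> hg; rewrite inE /=; exists (q.+1)%:Z; rewrite /Hsp /= /Hnorm2.
have M0 : 0 <= M.
  have := le_trans (normc_ge0 _) (hg fset0).
  by rewrite pmulr_lge0// exprn_gt0// cw_gt0.
have M20 : 0 <= M ^+ 2 by rewrite exprn_ge0.
apply: le_lt_trans (ltry (M ^+ 2 * S0)).
apply: le_trans (esum_cwV2Z phi setT M20); apply: le_esum => al _.
have c0 := cw_gt0 phi al; have cq : 0 < cw phi al ^+ q by rewrite exprn_gt0.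
rewrite lee_fin mulrN -invr_expz (_ : 2 * (q.+1)%:Z = (2 * q.+1)%N)//.
rewrite -exprnP mulnS exprD /cwV2 invfM mulrCA [leRHS]mulrC ler_wpM2l//.
  by rewrite invr_ge0 exprn_ge0// ltW.
rewrite mulnC exprM ler_pdivrMr ?exprn_gt0// -exprMn.
by rewrite lerXn2r ?nnegrE ?normc_ge0 ?mulr_ge0 ?(ltW cq).
Qed.

Lemma inner_term_le h g M N q al : 0 <= M -> 0 <= N -> growth phi h M q -> decay phi g N (q + 2) ->
  normc (h al * (g al)^*) <= M * N * cwV2 phi al.
Proof.
move=> M0 N0 hM gN; have c0 := cw_gt0 phi al.
rewrite normcM normcJ; apply: le_trans (ler_pM _ _ (hM al) (gN al)) _; rewrite ?normc_ge0//.
rewrite /cwV2 exprD invfM [leLHS](_ : _ = M * N * (cw phi al ^+ 2)^-1 *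
  (cw phi al ^+ q * (cw phi al ^+ q)^-1)); last by ring.
by rewrite mulfV ?mulr1// expf_neq0// gt_eqF.
Qed.

Lemma inner_le h g M N q : 0 <= M -> 0 <= N -> growth phi h M q -> decay phi g N (q + 2) ->
  csummable [set: gindex] (fun al => h al * (g al)^*) /\
  normc (inner h g) <= 2 * (M * N * S0).
Proof.
move=> M0 N0 hM gN; apply: csum_cwV2_le; first by rewrite mulr_ge0.
by move=> al _; exact: inner_term_le gN.
Qed.

Lemma innerB h k g : h \in dist_set phi -> k \in dist_set phi -> g \in test_set phi ->
  inner (h - k) g = inner h g - inner k g.
Proof.
move=> /dist_growth[M [q [M0 hM]]] /dist_growth[N [r [N0 kN]]] hg.
have [sh _] := inner_le M0 (Hnorm_ge0 _ _) hM (test_decay (q + 2) hg).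
have [sk _] := inner_le N0 (Hnorm_ge0 _ _) kN (test_decay (r + 2) hg).
have -> : inner h g - inner k g = (-1) * inner k g + inner h g by ring.
rewrite /inner -(csum_lin _ sk sh); congr csum; apply/funext => al.
rewrite !fctE; ring.
Qed.

(** A bounded set has bounded norm of order q + 2, so pairing with a difference of growth e(t) at
    order q is at most a constant times e(t), uniformly on that set. Convergence in the strong dual
    thus follows from e(t) tending to 0 at one fixed q. *)
Lemma Sm1_cvg (T : Type) (F : set_system T) (FF : Filter F) (H : T -> Sm1 phi)
    (h0 : Sm1 phi) (e : T -> R) q :
  (forall eps, 0 < eps -> \forall t \near F, e t <= eps) ->
  (\forall t \near F, growth phi (val (H t) - val h0) (e t) q) ->
  H @ F --> h0.
Proof.
move=> e0 Hg.
suff cv : (@Sm1_dual R phi \o H) @ F --> Sm1_dual h0.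
  move=> B /= [_ [[B' oB' <-] B'h sB]].
  have nB : nbhs (Sm1_dual h0) B' by apply: open_nbhs_nbhs.
  by apply: (filterS (F:=F) _ (cv _ nB)) => t; exact: sB.
apply/fam_cvgP => B Bb P nP; have [E [entE sE]] := (uniform_nbhs _ _).1 nP.
move: entE; rewrite -entourage_from_ballE => -[eps /= eps0 epsE].
have [M HM] := Bb (q + 2)%:Z.
(* The bound M may be negative when the bounded set is empty. *)
pose M' := Num.max M 0.
have M'0 : 0 <= M' by rewrite le_max lexx orbT.
have epsE' : eps = (complex.Re eps)%:C.
  by move: eps0; rewrite ltcE /= => /andP[/eqP i0 _]; case: (eps) i0 => a b /= ->.
have r0 : 0 < complex.Re eps by move: eps0; rewrite ltcE /= => /andP[].
pose c := 2 * (M' * S0) + 1.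
have c0 : 0 < c by rewrite ltr_wpDl// mulr_ge0// mulr_ge0.
have ec0 : 0 < complex.Re eps / (2 * c) by rewrite divr_gt0// mulr_gt0.
have := e0 _ ec0; move: Hg; apply: filterS2 => t Hg et; apply: sE => k Bk; apply: epsE.
rewrite /= -ball_normE /=.
rewrite distrC (_ : _ - _ = inner (val (H t) - val h0) (val k)); last first.
  by rewrite innerB//; [exact: Sm1_valP|exact: Sm1_valP|exact: S1_valP].
have et0 : 0 <= e t.
  have := le_trans (normc_ge0 _) (Hg fset0).
  by rewrite pmulr_lge0// exprn_gt0// cw_gt0.
have kM : decay phi (val k) M' (q + 2).
  move=> al; apply: le_trans (test_decay (q + 2) (S1_valP k) al) _.
  apply: ler_wpM2r; first by rewrite invr_ge0 exprn_ge0// ltW// cw_gt0.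
  by rewrite le_max (HM k Bk).
have [_ le] := inner_le et0 M'0 Hg kM.
rewrite epsE' [X in X < _](_ : _ = (normc (inner (val (H t) - val h0) (val k)))%:C)// ltcR.
apply: le_lt_trans le _.
apply: (@le_lt_trans _ _ (complex.Re eps / 2)); last lra.
apply: (@le_trans _ _ (e t * c)).
  rewrite /c mulrDr mulr1 -mulrA mulrCA lerDl//.
by move: et; rewrite invfM mulrA ler_pdivlMr.
Qed.

Lemma continuous_Hnorm_sub p (g0 : S1 phi) eps : 0 < eps ->
  \forall g \near g0, Hnorm phi p%:Z (val (g - g0)) <= eps.
Proof.
move=> eps0.
have c1 : continuous (@S1_dist R phi) by exact: initial_continuous.
(* The coordinate of [S1_dist] at the pair (p, g0) is the seminorm of the difference with g0, and it
   vanishes at g0. *)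
have c2 := continuous_comp (c1 g0) (@proj_continuous _ _ (p%:Z, g0) (S1_dist g0)).
move/cvgrPdist_le : c2 => /(_ _ eps0) /=; apply: filterS => g.
rewrite /proj /S1_dist /= subrr.
have -> : Hnorm phi p%:Z (\val (0 : S1 phi)) = 0.
  rewrite /Hnorm /Hnorm2 esum1 ?sqrtr0// => al _.
  by rewrite normc0 expr0n mul0r.
by rewrite sub0r normrN ger0_norm ?Hnorm_ge0.
Qed.

(** The orders p, q and the constant K depend only on A, and the bound is the product C N; smallness
    of either the symbol or the test function is thus transmitted at fixed orders. *)
Lemma Tmul_le A : 1 <= A -> exists p q K, [/\ 0 <= K,
  (forall be, A ^+ wt be <= cw phi be ^+ p) &
  forall C N x g, 0 <= C -> 0 <= N -> coef_bound x C A -> decay phi g N (p + 2) ->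
    growth phi (Tmul (gen x) g) (C * N * K) q].
Proof.
move=> A1; have [p Ap] := cw_expn phi A; have [q Aq] := cw_expn phi (2 * A).
exists p, q, (1 + 2 * S0); split => //; first by rewrite addr_ge0// mulr_ge0.
move=> C N x g C0 N0 xb gd ga; rewrite /Tmul fctE.
apply: le_trans (normcD _ _) _.
have h1 := Mop_le ga C0 A1 N0 xb gd.
have [_ h2] := Madj_le ga C0 A1 N0 xb Ap gd.
have c1 := cwX_ge1 phi ga q.
have CN : 0 <= C * N by rewrite mulr_ge0.
rewrite mulrDr mulr1 mulrDl; apply: lerD.
  by apply: le_trans h1 _; rewrite ler_wpM2l.
apply: le_trans h2 _; rewrite mulrCA [leRHS]mulrC ler_peMl//.
by rewrite mulr_ge0// mulr_ge0.
Qed.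

Lemma Tmul_linl (r : R) x y g C C' A N p : 0 <= C -> 0 <= C' -> 1 <= A -> 0 <= N ->
  coef_bound x C A -> coef_bound y C' A -> (forall be, A ^+ wt be <= cw phi be ^+ p) ->
  decay phi g N (p + 2) ->
  Tmul (gen (fun n => r%:C * x n + y n)) g = r%:C *: Tmul (gen x) g + Tmul (gen y) g.
Proof.
move=> C0 C'0 A1 N0 xb yb Ap gd; apply/funext => ga.
rewrite /Tmul !fctE Mop_linl (Madj_linl r ga C0 C'0 A1 N0 xb yb Ap gd).
rewrite /GRing.scale /=; ring.
Qed.

Lemma Tmul_linr (a : R[i]) x g h C A N M p : 0 <= C -> 1 <= A -> 0 <= N -> 0 <= M ->
  coef_bound x C A -> (forall be, A ^+ wt be <= cw phi be ^+ p) ->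
  decay phi g N (p + 2) -> decay phi h M (p + 2) ->
  Tmul (gen x) (a *: g + h) = a *: Tmul (gen x) g + Tmul (gen x) h.
Proof.
move=> C0 A1 N0 M0 xb Ap gd hd; apply/funext => ga.
rewrite /Tmul !fctE Mop_linr (Madj_linr a ga C0 A1 N0 M0 xb Ap gd hd).
rewrite /GRing.scale /=; ring.
Qed.

End Spaces.

(** * Continuity and differentiability of the process in the strong dual *)

Theorem theorem5p5 (R : realType) (phi : weight R) (m : R -> R)
    (b K : R) (N : nat) :
  (forall u, 0 < m u) ->
  measurable_fun [set: R] m ->
  (\int[@lebesgue_measure R]_u (m u / (u ^+ 2 + 1))%:E < +oo)%E ->
  b < 2 ->
  0 < K ->
  (forall u, 0 < `|u| <= 1 -> m u <= K * `|u| `^ (- b)) ->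
  (forall u, 1 < `|u| -> m u <= K * `|u| ^+ (2 * N)) ->
  exists X : R -> S1 phi -> Sm1 phi,
    [/\ forall (t : R) (g : S1 phi), val (X t g) = Xm m t (val g),
        forall g : S1 phi, continuous (X ^~ g) &
        exists W : R -> {linear S1 phi -> Sm1 phi},
          [/\ forall t : R, continuous (W t),
              forall (g : S1 phi) (t : R),
                (h^-1)%:C *: (X (t + h) g - X t g) @[h --> (0 : R)^'] --> W t g &
              forall (g : S1 phi) (c d : R),
                {within `[c, d], continuous (fun t => W t g)}]].
Proof.
move=> m0 mm mint _ _ _ _.
have [C [A [C0 A1 core]]] := process_derivative m0 mm mint.
pose I t n : R[i] := int0 (Sop m (fun x => (hermite n x)%:C)) t.
have /choice[w Hw] := core.
have [p [q [L [L0 Ap T]]]] := Tmul_le phi A1.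
have A0 : 0 <= A by rewrite (le_trans ler01).
have AN n : 0 <= A ^+ n by rewrite exprn_ge0.
pose Nm (g : S1 phi) := Hnorm phi (p + 2)%:Z (val g).
have N0 g : 0 <= Nm g by exact: Hnorm_ge0.
have gd (g : S1 phi) : decay phi (val g) (Nm g) (p + 2) by apply: test_decay; exact: S1_valP.
(* Size of an increment of the coefficients: the linear Taylor term plus the quadratic remainder. *)
pose om (h : R) := C * (`|h| + h ^+ 2).
have om0 h : 0 <= om h by rewrite mulr_ge0// addr_ge0// sqr_ge0.
have wb t : coef_bound (fun n => w n t) C A by move=> n; have [] := Hw n.
have Ib t h : coef_bound (fun n => (-1)%:C * I t n + I (t + h) n) (om h) A.
  move=> n; have [w1 _ w3] := Hw n.
  rewrite (_ : _ + _ = (I (t + h) n - I t n - h%:C * w n t) + h%:C * w n t); last first.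
    by rewrite rmorphN1; ring.
  apply: le_trans (normcD _ _) _; rewrite normcM normc_real.
  apply: le_trans (lerD (w3 t h) (ler_wpM2l (normr_ge0 h) (w1 t))) _.
  by rewrite /om le_eqVlt; apply/orP; left; apply/eqP; ring.
(* As the process starts at 0, the bound on increments from 0 also bounds the coefficients
   themselves. *)
have I0 n : I 0 n = 0.
  by rewrite /I int0E /rint0 lexx set_itv1 !Rintegral_set1.
have Ibt t : coef_bound (I t) (om t) A.
  by move=> n; have := Ib 0 t n; rewrite I0 mulr0 !add0r.
have memX t (g : S1 phi) : Tmul (gen (I t)) (val g) \in dist_set phi.
  exact: growth_dist (T _ _ _ _ (om0 t) (N0 g) (Ibt t) (gd g)).
pose X t g : Sm1 phi := MkSm1 (memX t g).
have memW t (g : S1 phi) : Tmul (gen (fun n => w n t)) (val g) \in dist_set phi.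
  exact: growth_dist (T _ _ _ _ C0 (N0 g) (wb t) (gd g)).
pose Wf t g : Sm1 phi := MkSm1 (memW t g).
have Wlin t : linear (Wf t).
  move=> a u v; apply: val_inj => /=.
  exact: (Tmul_linr a C0 A1 (N0 u) (N0 v) (wb t) Ap (gd u) (gd v)).
pose W t : {linear S1 phi -> Sm1 phi} :=
  HB.pack (Wf t) (GRing.isLinear.Build _ _ _ _ (Wf t) (Wlin t)).
(* Shared by the two moduli in use, |h| and |h| + h^2, both at most 2 |h| near 0. *)
have small (c : R) (u : R -> R) : 0 <= c -> (forall h, 0 <= u h) ->
    (forall h, `|h| <= 1 -> u h <= 2 * `|h|) ->
    forall eps, 0 < eps -> \forall h \near (0 : R), c * u h <= eps.
  move=> c0 u0 u2 eps eps0.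
  have c1 : 0 < c + 1 by rewrite ltr_wpDl.
  have e2 : 0 < eps / (2 * (c + 1)) by rewrite divr_gt0// mulr_gt0.
  apply: filterS2 (@nbhs0_le R R 1 ltr01) (@nbhs0_le R R _ e2) => h h1 h2.
  apply: (@le_trans _ _ ((c + 1) * (2 * `|h|))).
    by apply: ler_pM => //; [rewrite lerDl|exact: u2].
  by rewrite mulrCA mulrA mulrC -ler_pdivlMr// mulr_gt0.
have sub0 t0 : (fun t : R => t - t0) @ t0 --> (0 : R).
  by rewrite -(subrr t0); apply: cvgB; [exact: cvg_id|exact: cvg_cst].
have om2 (h : R) : `|h| <= 1 -> `|h| + h ^+ 2 <= 2 * `|h|.
  move=> h1; rewrite -(real_normK (num_real h)) mulrDl mul1r lerD2l expr2.
  by rewrite ler_piMr.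
have om1 (h : R) : 0 <= `|h| + h ^+ 2 by rewrite addr_ge0// sqr_ge0.
have smallX := small _ _ _ om1 om2.
exists X; split => //.
- move=> g t0.
  apply: (@Sm1_cvg _ phi _ _ _ (X ^~ g) _ (fun t => om (t - t0) * Nm g * L) q).
  + move=> eps eps0; have c0 : 0 <= C * Nm g * L by rewrite !mulr_ge0.
    have : \forall t \near t0, C * Nm g * L * (`|t - t0| + (t - t0) ^+ 2) <= eps.
      exact: (sub0 t0 _ (smallX _ c0 _ eps0)).
    apply: filterS => t.
    by rewrite /om; congr (_ <= _); ring.
  + near=> t.
    have -> : \val (X t g) - \val (X t0 g) = Tmul (gen (fun n => (-1)%:C * I t0 n + I t n)) (val g).
      rewrite (Tmul_linl (-1) (om0 t0) (om0 t) A1 (N0 g) (Ibt t0) (Ibt t) Ap (gd g)).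
      by rewrite rmorphN1 scaleN1r addrC.
    apply: T => //.
    by have := Ib t0 (t - t0); rewrite (addrC t0) subrK.
exists W; split.
- move=> t g0.
  apply: (@Sm1_cvg R phi (S1 phi) (nbhs g0) (nbhs_filter g0) (Wf t) _
    (fun g => C * Nm (g - g0) * L) q).
  + move=> eps eps0; have CL : 0 < C * L + 1 by rewrite ltr_wpDl// mulr_ge0.
    apply: filterS (continuous_Hnorm_sub (p + 2) g0 (divr_gt0 eps0 CL)) => g.
    rewrite ler_pdivlMr// => h; apply: le_trans h; rewrite -/(Nm (g - g0)).
    by rewrite mulrDr mulr1 mulrAC mulrC lerDl.
  + apply: (@filterE _ (nbhs g0) (nbhs_filter g0)) => g.
    have -> : \val (Wf t g) - \val (Wf t g0) = Tmul (gen (fun n => w n t)) (val (g - g0)).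
      by have := linearB (W t) g g0 => /(congr1 val) /= <-.
    exact: T.
- move=> g t.
  apply: (@Sm1_cvg _ phi _ _ _ (fun h => (h^-1)%:C *: (X (t + h) g - X t g)) _
    (fun h => C * `|h| * Nm g * L) q).
  + move=> eps eps0; have c0 : 0 <= C * Nm g * L by rewrite !mulr_ge0.
    have u2 (h : R) : `|h| <= 1 -> `|h| <= 2 * `|h| by move=> _; rewrite ler_peMl// ler1n.
    have := small _ (fun h => `|h|) c0 (fun h => normr_ge0 h) u2 _ eps0.
    move/(@nbhs_dnbhs _ (0 : R)); apply: filterS => h /=.
    by congr (_ <= _); ring.
  + have : \forall h \near (0 : R)^', h != 0 by exact: nbhs_dnbhs_neq.
    apply: filterS => h h0.
    pose d n := (-1)%:C * I t n + I (t + h) n.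
    have eb : coef_bound (fun n => (- h)%:C * w n t + d n) (C * h ^+ 2) A.
      move=> n; have [_ _ w3] := Hw n.
      have -> : (- h)%:C * w n t + d n = I (t + h) n - I t n - h%:C * w n t.
        have -> : d n = (-1)%:C * I t n + I (t + h) n by [].
        by rewrite rmorphN1 rmorphN; ring.
      by rewrite mulrAC; exact: w3.
    (* The error of the difference quotient is h^-1 times the operator of the Taylor remainders,
       whose coefficients are at most C h^2 A^n; this leaves C |h|. *)
    have -> : \val ((h^-1)%:C *: (X (t + h) g - X t g)) - \val (W t g) =
        (h^-1)%:C *: Tmul (gen (fun n => (- h)%:C * w n t + d n)) (val g).
      rewrite (Tmul_linl (- h) C0 (om0 h) A1 (N0 g) (wb t) (Ib t h) Ap (gd g)).
      rewrite (Tmul_linl (-1) (om0 t) (om0 (t + h)) A1 (N0 g) (Ibt t) (Ibt (t + h)) Ap (gd g)).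
      rewrite [in RHS]scalerDr scalerA -rmorphM mulrN mulVf// !rmorphN1 !scaleN1r.
      by rewrite [in RHS]addrC [in RHS](addrC (- _)).
    move=> al; rewrite fctE /GRing.scale /= normcM normc_real normfV.
    have Ch0 : 0 <= C * h ^+ 2 by rewrite mulr_ge0// sqr_ge0.
    apply: le_trans (ler_wpM2l _ (T _ _ _ _ Ch0 (N0 g) eb (gd g) al)) _; first by rewrite invr_ge0.
    have hn : `|h| != 0 by rewrite normr_eq0.
    rewrite -(real_normK (num_real h)) le_eqVlt; apply/orP; left; apply/eqP; by field.
- move=> g c d; apply: continuous_subspaceT => t0.
  apply: (@Sm1_cvg _ phi _ _ _ (fun t => W t g) _ (fun t => C * `|t - t0| * Nm g * L) q).
  + move=> eps eps0; have c0 : 0 <= C * Nm g * L by rewrite !mulr_ge0.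
    have u2 (h : R) : `|h| <= 1 -> `|h| <= 2 * `|h| by move=> _; rewrite ler_peMl// ler1n.
    have : \forall t \near t0, C * Nm g * L * `|t - t0| <= eps.
      exact: (sub0 t0 _ (small _ (fun h => `|h|) c0 (fun h => normr_ge0 h) u2 _ eps0)).
    apply: filterS => t.
    by congr (_ <= _); ring.
  + near=> t.
    have -> : \val (W t g) - \val (W t0 g) = Tmul (gen (fun n => (-1)%:C * w n t0 + w n t)) (val g).
      rewrite (Tmul_linl (-1) C0 C0 A1 (N0 g) (wb t0) (wb t) Ap (gd g)).
      by rewrite rmorphN1 scaleN1r addrC.
    apply: T => //; first by rewrite mulr_ge0.
    move=> n; have [_ w2 _] := Hw n.
    by rewrite rmorphN1 mulN1r addrC mulrAC.
Unshelve. all: by end_near.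
Qed.
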